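(* Let $1<p<\infty$, let $\Omega\subset\mathbb{R}^N$, $N\ge 2$, be a bounded domain with $\partial\Omega$ of class $\mathcal{C}^2$, let $c,h\in L^\infty(\Omega)$ with $c\gneqq 0$ and $h\gneqq 0$, and let $\mu>0$ be a constant. For $\lambda\in\mathbb{R}$ consider the problem $$(P_\lambda)\qquad -\Delta_p u=\lambda c(x)|u|^{p-2}u+\mu|\nabla u|^p+h(x),\qquad u\in W_0^{1,p}(\Omega)\cap L^\infty(\Omega),$$ and let $\gamma_1>0$ be the first eigenvalue of $-\Delta_p u=\gamma c(x)|u|^{p-2}u$, $u\in W_0^{1,p}(\Omega)$. If $(P_\lambda)$ has a solution for some $\lambda\in(0,\gamma_1)$, then $(P_0)$ has a solution.
   Context: $\Delta_p u=\operatorname{div}(|\nabla u|^{p-2}\nabla u)$. $f\gneqq 0$ means $f\ge 0$ a.e. in $\Omega$ and $f>0$ on a set of positive measure. A solution of $(P_\lambda)$ is a weak solution: $u\in W_0^{1,p}(\Omega)\cap L^\infty(\Omega)$ with $\int_\Omega|\nabla u|^{p-2}\nabla u\cdot\nabla\varphi\,dx=\int_\Omega\big(\lambda c|u|^{p-2}u+\mu|\nabla u|^p+h\big)\varphi\,dx$ for all $\varphi\in W_0^{1,p}(\Omega)\cap L^\infty(\Omega)$. *)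

(* Defs.v *)
From HB Require Import structures.
From mathcomp Require Import all_boot all_order all_algebra.
From mathcomp Require Import all_classical all_reals all_analysis.

Set Implicit Arguments.
Unset Strict Implicit.
Unset Printing Implicit Defensive.
Import Order.TTheory GRing.Theory Num.Theory.
Import numFieldNormedType.Exports.
Local Open Scope classical_set_scope.
Local Open Scope ring_scope.

(* R^n is ['rV[R]_n]: its topology is the library's (sup norm), its sigma-algebra
   is the one generated by the coordinates, i.e. the Borel sigma-algebra. *)
Definition measure_rV_display : measure_display -> measure_display.
Proof. exact. Qed.

Section measurable_rV.
Context {d} {T : measurableType d} (n : nat).

Let coord : 'I_n -> 'rV[T]_n -> T := fun i v => v ord0 i.

Let rV_set0 : g_sigma_preimage coord set0.
Proof. exact: sigma_algebra0. Qed.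

Let rV_setC A : g_sigma_preimage coord A -> g_sigma_preimage coord (~` A).
Proof. exact: sigma_algebraC. Qed.

Let rV_bigcup (F : (set 'rV[T]_n)^nat) :
  (forall i, g_sigma_preimage coord (F i)) ->
  g_sigma_preimage coord (\bigcup_i F i).
Proof. exact: sigma_algebra_bigcup. Qed.

HB.instance Definition _ := @isMeasurable.Build (measure_rV_display d)
  'rV[T]_n (g_sigma_preimage coord) rV_set0 rV_setC rV_bigcup.

Lemma measurable_coord (i : 'I_n) :
  measurable_fun setT (fun v : 'rV[T]_n => v ord0 i).
Proof.
move=> _ Y mY; rewrite setTI; apply: sub_sigma_algebra => /=.
rewrite -bigcup_seq/=; exists i => /=; first by rewrite mem_index_enum.
by exists Y => //; rewrite setTI.
Qed.

Lemma measurable_fun_rV d' (S : measurableType d') (f : S -> 'rV[T]_n) :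
  (forall i, measurable_fun setT (fun x => f x ord0 i)) ->
  measurable_fun setT f.
Proof.
move=> mf; suff : g_sigma_preimage (fun i => coord i \o f) `<=` measurable.
  rewrite g_sigma_preimage_comp => prefS _ A mA.
  by apply: prefS; exists A.
apply: smallest_sub; first exact: sigma_algebra_measurable.
by rewrite -bigcup_seq => A [i _] [B mB <-]; exact: mf.
Qed.

End measurable_rV.

Lemma product_sigma_finite d1 d2 (T1 : measurableType d1)
    (T2 : measurableType d2) (R : realType)
    (m1 : {sigma_finite_measure set T1 -> \bar R})
    (m2 : {sigma_finite_measure set T2 -> \bar R}) :
  sigma_finite setT (m1 \x m2)%E.
Proof.
have /sigma_finiteP[F [TF ndF Foo]] := sigma_finiteT m1.
have /sigma_finiteP[G [TG ndG Goo]] := sigma_finiteT m2.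
exists (fun n => F n `*` G n).
  rewrite -setXTT TF TG predeqE => -[x y]; split.
    move=> [/= [n _ Fnx] [k _ Gky]]; exists (maxn n k) => //; split.
    - by move: x Fnx; exact/subsetPset/ndF/leq_maxl.
    - by move: y Gky; exact/subsetPset/ndG/leq_maxr.
  by move=> [n _ []/= ? ?]; split; exists n.
move=> k; have [? ?] := Foo k; have [? ?] := Goo k.
split; first exact: measurableX.
by rewrite product_measure1E// lte_mul_pinfty// ge0_fin_numE.
Qed.

Section lebesgue_rV.
Context {R : realType}.

Definition rV_cons n (xv : R * 'rV[R]_n) : 'rV[R]_n.+1 :=
  row_mx xv.1%:M xv.2.

Definition rV_behead n (v : 'rV[R]_n.+1) : 'rV[R]_n :=
  \row_i v ord0 (lift ord0 i).

Lemma rV_cons0 n (xv : R * 'rV[R]_n) : rV_cons xv ord0 ord0 = xv.1.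
Proof.
have -> : (ord0 : 'I_n.+1) = lshift n (ord0 : 'I_1) by exact: val_inj.
by rewrite [LHS](row_mxEl xv.1%:M) mxE eqxx.
Qed.

Lemma rV_consS n (xv : R * 'rV[R]_n) i :
  rV_cons xv ord0 (lift ord0 i) = xv.2 ord0 i.
Proof.
have -> : lift ord0 i = rshift 1 i by exact: val_inj.
by rewrite [LHS](row_mxEr xv.1%:M).
Qed.

Lemma measurable_rV_cons n : measurable_fun setT (@rV_cons n).
Proof.
apply: measurable_fun_rV => i.
have [j ->|->] := unliftP ord0 i.
  under eq_fun do rewrite rV_consS.
  exact: (measurableT_comp (measurable_coord j) measurable_snd).
by under eq_fun do rewrite rV_cons0; exact: measurable_fst.
Qed.

Lemma measurable_rV_uncons n :
  measurable_fun setT (fun v : 'rV[R]_n.+1 => (v ord0 ord0, rV_behead v)).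
Proof.
apply: measurable_fun_pair; first exact: measurable_coord.
apply: measurable_fun_rV => i; under eq_fun do rewrite mxE.
exact: measurable_coord.
Qed.

Lemma rV_consK n (xv : R * 'rV[R]_n) :
  (rV_cons xv ord0 ord0, rV_behead (rV_cons xv)) = xv.
Proof.
case: xv => x v; congr pair; first exact: rV_cons0.
by apply/rowP => i; rewrite mxE rV_consS.
Qed.

Section step.
Variables (n : nat) (m : {sigma_finite_measure set 'rV[R]_n -> \bar R}).

Definition lebesgue_rVS : set 'rV[R]_n.+1 -> \bar R :=
  pushforward (lebesgue_measure \x m)%E (@rV_cons n).

Let measurable_preimage A : measurable A -> measurable (@rV_cons n @^-1` A).
Proof. by move=> mA; rewrite -[X in measurable X]setTI; exact: measurable_rV_cons. Qed.

Let lebesgue_rVS0 : lebesgue_rVS set0 = 0%E.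
Proof. by rewrite /lebesgue_rVS /pushforward preimage_set0 measure0. Qed.

Let lebesgue_rVS_ge0 A : (0 <= lebesgue_rVS A)%E.
Proof. by rewrite /lebesgue_rVS /pushforward; exact: measure_ge0. Qed.

Let lebesgue_rVS_sigma_additive : semi_sigma_additive lebesgue_rVS.
Proof.
move=> F mF tF mUF; rewrite /lebesgue_rVS /pushforward preimage_bigcup.
apply: measure_semi_sigma_additive.
- by move=> k; exact: measurable_preimage.
- apply/trivIsetP => /= i j _ _ ij; rewrite -preimage_setI.
  by move/trivIsetP : tF => /(_ _ _ _ _ ij) ->//; rewrite preimage_set0.
- by rewrite -preimage_bigcup; exact: measurable_preimage.
Qed.

HB.instance Definition _ := isMeasure.Build _ _ _ lebesgue_rVS
  lebesgue_rVS0 lebesgue_rVS_ge0 lebesgue_rVS_sigma_additive.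

Let lebesgue_rVS_sigma_finite : sigma_finite setT lebesgue_rVS.
Proof.
have [F TF Foo] := product_sigma_finite lebesgue_measure m.
exists (fun k => (fun v : 'rV[R]_n.+1 => (v ord0 ord0, rV_behead v)) @^-1` F k).
  by rewrite -preimage_bigcup -TF preimage_setT.
move=> k; have [mF Fk] := Foo k; split.
  by rewrite -[X in measurable X]setTI; exact: measurable_rV_uncons.
rewrite /lebesgue_rVS /pushforward -comp_preimage.
by rewrite (_ : _ \o _ = id)//; apply/funext => xv; exact: rV_consK.
Qed.

HB.instance Definition _ := Measure_isSigmaFinite.Build _ _ _ lebesgue_rVS
  lebesgue_rVS_sigma_finite.

End step.

(* n-dimensional Lebesgue measure: the n-fold product of [lebesgue_measure],
   with R^0 carrying the unit mass. *)
Fixpoint lebesgue_rV n : {sigma_finite_measure set 'rV[R]_n -> \bar R} :=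
  match n with
  | 0 => @dirac _ 'rV[R]_0 0 R
  | n'.+1 => lebesgue_rVS (lebesgue_rV n')
  end.

Lemma lebesgue_rV_box n (A : 'I_n -> set R) : (forall i, measurable (A i)) ->
  lebesgue_rV n [set v | forall i, A i (v ord0 i)] =
  (\prod_(i < n) lebesgue_measure (A i))%E.
Proof.
elim: n A => [|n IHn] A mA.
  by rewrite big_ord0/= diracE mem_set//= => -[].
have mB : measurable [set v : 'rV[R]_n | forall i, A (lift ord0 i) (v ord0 i)].
  rewrite (_ : [set v | _] = \bigcap_(i in setT)
      ((fun v : 'rV[R]_n => v ord0 i) @^-1` A (lift ord0 i))).
    apply: fin_bigcap_measurable => // i _.
    by rewrite -[X in measurable X]setTI; exact: measurable_coord.
  by apply/seteqP; split => v /= Av i; [move=> _; exact: Av|exact: (Av i)].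
rewrite big_ord_recl -IHn; last by move=> i; exact: mA.
rewrite -product_measure1E//; last exact: (mA ord0).
rewrite /= /lebesgue_rVS /pushforward; congr (_ _).
apply/seteqP; split => -[x v] /=.
  move=> Axv; split=> [|i]; first by have := Axv ord0; rewrite rV_cons0.
  by have := Axv (lift ord0 i); rewrite rV_consS.
move=> [Ax Av] i; have [j ->|->] := unliftP ord0 i.
  by rewrite rV_consS.
by rewrite rV_cons0.
Qed.

End lebesgue_rV.

Section calculus.
Context {R : realType} (n : nat).
Implicit Types (x v w : 'rV[R]_n) (f : 'rV[R]_n -> R).

Definition dotrV v w : R := \sum_i v ord0 i * w ord0 i.

(* Euclidean norm: [`|v|] is the sup norm *)
Definition enorm v : R := Num.sqrt (dotrV v v).

Definition partial (i : 'I_n) f x : R := 'D_(delta_mx ord0 i) f x.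

Fixpoint Ck (k : nat) f : Prop :=
  match k with
  | 0 => continuous f
  | k'.+1 => continuous f /\
      forall i, (forall x, derivable f x (delta_mx ord0 i)) /\
                Ck k' (partial i f)
  end.

Definition smooth f : Prop := forall k, Ck k f.

Definition test_function (Omega : set 'rV[R]_n) f : Prop :=
  let supp := closure [set x | f x != 0] in
  [/\ smooth f, compact supp & supp `<=` Omega].

End calculus.

Definition domain {R : realType} n (Omega : set 'rV[R]_n) : Prop :=
  [/\ open Omega, connected Omega & Omega !=set0].

(* Up to relabeling and reorienting the axes (axis [i], orientation [s]),
   [Omega] is near each boundary point the strict epigraph of a C^2 function of
   the n - 1 other coordinates. *)
Definition C2_boundary {R : realType} n (Omega : set 'rV[R]_n) : Prop :=
  forall x0, (closure Omega `\` interior Omega) x0 ->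
  exists (i : 'I_n) (s : bool) (psi : 'rV[R]_n.-1 -> R), Ck 2 psi /\
    \forall x \near x0, Omega x <-> psi (col' i x) < (-1) ^+ s * x ord0 i.

Section sobolev.
Context {R : realType} (n : nat) (Omega : set 'rV[R]_n).
Local Notation leb := (lebesgue_rV n).
Implicit Types (u phi f : 'rV[R]_n -> R) (g : 'rV[R]_n -> 'rV[R]_n).

(* Elements of L^q(Omega), 1 <= q <= +oo, are represented by functions on R^n
   whose values outside Omega are irrelevant ([f \_ Omega] is f extended by 0). *)
Definition in_Lp (q : \bar R) f : Prop := (f \_ Omega) \in Lfun leb q.

Definition Lp_dist (q : \bar R) f1 f2 : \bar R :=
  Lnorm leb q (EFin \o ((f1 \- f2) \_ Omega)).

Definition weak_gradient u g : Prop :=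
  forall phi, test_function Omega phi -> forall i,
    \int[leb]_(x in Omega) (u x * partial i phi x) =
    - \int[leb]_(x in Omega) (g x ord0 i * phi x).

(* u belongs to W^{1,p}(Omega) and g is its gradient *)
Definition W1p (p : R) u g : Prop :=
  [/\ in_Lp p%:E u, forall i, in_Lp p%:E (fun x => g x ord0 i)
    & weak_gradient u g].

(* u belongs to W_0^{1,p}(Omega), the closure of C_c^oo(Omega) in W^{1,p}(Omega),
   and g is its gradient *)
Definition W01p (p : R) u g : Prop :=
  W1p p u g /\
  exists phi : nat -> 'rV[R]_n -> R,
    [/\ forall k, test_function Omega (phi k),
        Lp_dist p%:E (phi k) u @[k --> \oo] --> 0%E
      & forall i, Lp_dist p%:E (partial i (phi k)) (fun x => g x ord0 i)
          @[k --> \oo] --> 0%E].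

Definition nonneg_nonzero f : Prop :=
  {ae leb, forall x, Omega x -> 0 <= f x} /\
  (0 < leb (Omega `&` [set x | (0 < f x)%R]))%E.

(* [\int |∇u|^{p-2} ∇u · ∇phi] for gradients g, gphi of u, phi. As [0 `^ r = 0] for
   r != 0, the integrand vanishes where g does, also when p < 2; likewise for
   [ppow]. *)
Definition plap_form (p : R) g gphi : R :=
  \int[leb]_(x in Omega) (enorm (g x) `^ (p - 2) * dotrV (g x) (gphi x)).

Definition ppow (p t : R) : R := `|t| `^ (p - 2) * t.

Definition solution (p mu : R) (c h : 'rV[R]_n -> R) (lambda : R) u : Prop :=
  exists g, [/\ W01p p u g, in_Lp +oo%E u
    & forall phi gphi, W01p p phi gphi -> in_Lp +oo%E phi ->
        plap_form p g gphi =
        \int[leb]_(x in Omega)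
          ((lambda * c x * ppow p (u x) + mu * enorm (g x) `^ p + h x)
           * phi x)].

(* gamma is an eigenvalue of [-Δ_p u = gamma c |u|^{p-2} u] in W_0^{1,p}(Omega) *)
Definition eigenvalue_plap (p : R) (c : 'rV[R]_n -> R) (gamma : R) : Prop :=
  exists u g, [/\ W01p p u g, ~ {ae leb, forall x, Omega x -> u x = 0}
    & forall phi gphi, W01p p phi gphi ->
        plap_form p g gphi =
        \int[leb]_(x in Omega) (gamma * c x * ppow p (u x) * phi x)].

Definition first_eigenvalue (p : R) (c : 'rV[R]_n -> R) (gamma : R) : Prop :=
  eigenvalue_plap p c gamma /\
  forall gamma', eigenvalue_plap p c gamma' -> gamma <= gamma'.

End sobolev.

(* Main.v *)
Require Import Defs.
From mathcomp Require Import all_boot all_order all_algebra.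
From mathcomp Require Import all_classical all_reals all_analysis.
From mathcomp Require Import measurable_realfun ess_sup_inf.
From mathcomp Require Import ring lra.

Set Implicit Arguments.
Unset Strict Implicit.
Unset Printing Implicit Defensive.
Import Order.TTheory GRing.Theory Num.Theory.
Import numFieldNormedType.Exports.
Local Open Scope classical_set_scope.
Local Open Scope ring_scope.


(** Let [u] solve the problem for some [lambda] below the first eigenvalue, and put
    [kappa = mu / (p - 1)].

    First, [u >= 0]. Tested with the negative part [w] of [u], the equation gives
    [\int |grad w|^p <= lambda \int c |w|^p], and since [lambda] is smaller than every eigenvalue
    this forces [w = 0] ([solution_ge0], [rayleigh]).

    The Hopf-Cole transform [V = exp (kappa u) - 1] removes the gradient term: discarding the
    nonnegative term in [lambda], [V] is a bounded supersolution of
    [- Delta_p v = kappa^(p-1) h (1 + v)^(p-1)] ([hopf_cole_super]). A solution of this equation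
    between 0 and [V] is found by truncation. With [(1 + v)^(p-1)] replaced by the (p-1)-st power
    of [1 + v] clamped between [1] and [1 + V], the source is bounded, and its primitive yields a coercive
    energy with a minimiser ([truncated_existence]); comparison by the strict monotonicity
    of [a |-> |a|^(p-2) a] gives [0 <= v <= V] ([truncated_ge0], [truncated_le]), so that the
    truncation is inactive. Undoing the transform, [ln (1 + v) / kappa] is bounded and solves
    the problem for [lambda = 0] ([hopf_cole_inverse], [solution_at_zero]).

    Both existence arguments, for [v] and for the Rayleigh quotient, rest on one minimisation theorem
    for [E(grad u) / p - Phi(u)], with [E] the integral of [|grad u|^p] and [Phi] continuous on L^p
    ([minimiser], [euler_lagrange]). For the Rayleigh quotient [Phi] is a bounded increasing
    function of the weighted mass: if some function had a quotient below the first eigenvalue,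
    the minimum would be negative, and the Euler-Lagrange equation of the minimiser would produce
    a smaller eigenvalue.

    The minimiser exists by Rellich's theorem ([rellich_W]) together with the uniform convexity of
    [|.|^p] ([uniform_convexity]), which makes minimising gradients converge strongly. Rellich's
    theorem follows from an Ehrling inequality
    [\int |f|^p <= e \sum_i \int |partial i f|^p + C \sum_j |l_j f|^p], with finitely many bounded
    additive functionals [l_j] ([ehrling_C1c]). It is proved by induction on the dimension, slice by
    slice, and applies to test functions because they extend by zero to the whole space.

    [W_0^{1,p}] is handled through approximating sequences of test functions ([W01pP]). Chain
    rules for truncations come from smooth approximations of [|t - a|] ([chain_smooth],
    [chain_lim], [chain_clamp]). *)

(** * Powers and the Euclidean norm *)

Section powers.
Context {R : realType}.
Implicit Types (x y r s p : R).

Lemma ler_powR2 p x y : 0 <= p -> 0 <= x -> x <= y -> x `^ p <= y `^ p.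
Proof. by move=> p0 x0 xy; apply: ge0_ler_powR; rewrite ?nnegrE// (le_trans x0). Qed.

Lemma bernoulli_powR p x : 1 < p -> 0 <= x -> x != 1 -> 1 + p * (x - 1) < x `^ p.
Proof.
move=> p1; rewrite le_eqVlt => /predU1P[<- _|x0 x1].
  by rewrite powR0 ?gt_eqF//; lra.
have cts a b : 0 < a -> {within `[a, b], continuous (@powR R ^~ p)}.
  move=> a0; apply: derivable_within_continuous => y /=; rewrite in_itv/= => /andP[ay _].
  by apply: derivable_powR; rewrite in_itv/= andbT (lt_le_trans a0).
have dv y : 0 < y -> is_derive y 1 (@powR R ^~ p) (p * y `^ (p - 1)).
  by move=> y0; exact: is_derive1_powR.
have p0 : 0 < p by lra.
move: x1; rewrite neq_lt => /orP[x1|x1].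
- have dx y : y \in `]x, 1[%R -> is_derive y 1 (@powR R ^~ p) (p * y `^ (p - 1)).
    by rewrite in_itv/= => /andP[xy _]; apply: dv; lra.
  have [c] := MVT x1 dx (cts _ _ x0).
  rewrite in_itv/= => /andP[xc c1]; rewrite powR1 => e.
  have : c `^ (p - 1) < 1.
    by rewrite -[ltRHS](@congr1 _ _ (fun f => f (p - 1)) _ _ (@powR1 R)) gt0_ltr_powR ?nnegrE ?subr_gt0//; lra.
  move: (c `^ _) e => d e d1.
  have : 0 < p * (1 - x) * (1 - d) by rewrite !mulr_gt0//; lra.
  by nra.
- have dx y : y \in `]1, x[%R -> is_derive y 1 (@powR R ^~ p) (p * y `^ (p - 1)).
    by rewrite in_itv/= => /andP[xy _]; apply: dv; lra.
  have [c] := MVT x1 dx (cts _ _ ltr01).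
  rewrite in_itv/= => /andP[xc c1]; rewrite powR1 => e.
  have : 1 < c `^ (p - 1).
    by rewrite -[ltLHS](@congr1 _ _ (fun f => f (p - 1)) _ _ (@powR1 R)) gt0_ltr_powR ?nnegrE ?subr_gt0//; lra.
  have : 0 < p * (x - 1) by rewrite mulr_gt0//; lra.
  by nra.
Qed.

Lemma powR_pow_pred p s : 1 < p -> 0 <= s -> s `^ p = s * s `^ (p - 1).
Proof. by move=> p1 s0; rewrite mulr_powRB1//; lra. Qed.

(** Bernoulli's inequality at [r / s], multiplied by [s `^ p]. *)
Lemma powR_tangent_lt p s r : 1 < p -> 0 <= s -> 0 <= r -> r != s ->
  s `^ p + p * s `^ (p - 1) * (r - s) < r `^ p.
Proof.
move=> p1; rewrite le_eqVlt => /predU1P[<- r0 rs|s0 r0 rs].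
  have rp : 0 < r by rewrite lt_neqAle eq_sym rs.
  rewrite !powR0 ?gt_eqF ?subr_gt0//; last lra.
  by rewrite mulr0 mul0r addr0 powR_gt0.
have rE : r = s * (r / s) by rewrite mulrC divfK// gt_eqF.
have x0 : 0 <= r / s by rewrite divr_ge0// ltW.
have rpE : r `^ p = s `^ p * (r / s) `^ p by rewrite -powRM ?(ltW s0)// -rE.
have rsE : r - s = s * (r / s - 1) by rewrite mulrBr mulr1 -rE.
have x1 : r / s != 1 by apply: contra rs => /eqP e; rewrite rE e mulr1.
have := bernoulli_powR p1 x0 x1.
rewrite rpE rsE (powR_pow_pred p1 (ltW s0)).
have t0 : 0 < s `^ (p - 1) by exact: powR_gt0.
set t := s `^ _ in t0 *; set x := r / s; set y := x `^ p => h.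
have : 0 < s * t * (y - (1 + p * (x - 1))) by rewrite !mulr_gt0// subr_gt0.
by nra.
Qed.

Lemma powR_tangent p s r : 1 < p -> 0 <= s -> 0 <= r ->
  s `^ p + p * s `^ (p - 1) * (r - s) <= r `^ p.
Proof.
move=> p1 s0 r0; have [->|rs] := eqVneq r s; first by rewrite subrr mulr0 addr0.
exact/ltW/powR_tangent_lt.
Qed.

(** A crude Young inequality, by comparing [a] with [b]; it supplies the integrable bounds below. *)
Lemma powR_mixed p a b : 1 < p -> 0 <= a -> 0 <= b ->
  a `^ (p - 1) * b <= a `^ p + b `^ p.
Proof.
move=> p1 a0 b0; rewrite (powR_pow_pred p1 a0) (powR_pow_pred p1 b0).
have := powR_ge0 a (p - 1); have := powR_ge0 b (p - 1).
have [ab|ba] := leP a b.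
  have := @ler_powR2 (p - 1) a b ltac:(lra) a0 ab.
  by nra.
by nra.
Qed.

Lemma powR_add_le p a b : 1 < p ->
  `|(a + b : R)| `^ p <= 2 `^ p * (`|a : R| `^ p + `|b : R| `^ p).
Proof.
move=> p1; wlog ab : a b / `|a| <= `|b|.
  by move=> h; have [/h//|/ltW/h] := leP `|a| `|b|; rewrite addrC [X in _ * X]addrC.
have : `|a + b| <= 2 * `|b| by rewrite (le_trans (ler_normD _ _))//; lra.
move=> /(@ler_powR2 p _ _ ltac:(lra) (normr_ge0 _)) /le_trans; apply.
rewrite powRM//; have := powR_ge0 2 p; have := powR_ge0 `|a| p; nra.
Qed.

Lemma continuous_normr_powR p : 0 < p -> continuous (fun x : R => `|x| `^ p).
Proof.
move=> p0 x; have [->|x0] := eqVneq x 0.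
  apply/cvgrPdist_lt => e e0; rewrite normr0 powR0 ?gt_eqF//.
  have E : e = (e `^ p^-1) `^ p by rewrite -powRrM mulVf ?gt_eqF// powRr1// ltW.
  apply/nbhs_ballP; exists (e `^ p^-1) => /=; first exact: powR_gt0.
  move=> y; rewrite /ball/= sub0r normrN => ye.
  rewrite sub0r normrN ger0_norm ?powR_ge0// E.
  by apply: gt0_ltr_powR; rewrite ?nnegrE ?powR_ge0.
have c : {for `|x|, continuous (@powR R ^~ p)}.
  apply: differentiable_continuous; apply/derivable1_diffP.
  by apply: derivable_powR; rewrite in_itv/= andbT normr_gt0.
by apply: (@continuous_comp _ _ _ (@Num.norm _ R) (@powR R ^~ p)) => //; exact: norm_continuous.
Qed.

End powers.

Section euclidean.
Context {R : realType} {n : nat}.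
Implicit Types (a b v w : 'rV[R]_n).

Lemma dotrVC v w : dotrV v w = dotrV w v.
Proof. by apply: eq_bigr => i _; rewrite mulrC. Qed.

Lemma dotrVDr v w w' : dotrV v (w + w') = dotrV v w + dotrV v w'.
Proof. by rewrite /dotrV -big_split; apply: eq_bigr => i _; rewrite mxE mulrDr. Qed.

Lemma dotrVZr k v w : dotrV v (k *: w) = k * dotrV v w.
Proof. by rewrite /dotrV mulr_sumr; apply: eq_bigr => i _; rewrite mxE mulrCA. Qed.

Lemma dotrVNr v w : dotrV v (- w) = - dotrV v w.
Proof. by rewrite -scaleN1r dotrVZr mulN1r. Qed.

Lemma dotrVBr v w w' : dotrV v (w - w') = dotrV v w - dotrV v w'.
Proof. by rewrite dotrVDr dotrVNr. Qed.

Lemma dotrVDl v w w' : dotrV (w + w') v = dotrV w v + dotrV w' v.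
Proof. by rewrite !(dotrVC _ v) dotrVDr. Qed.

Lemma dotrVZl k v w : dotrV (k *: v) w = k * dotrV v w.
Proof. by rewrite dotrVC dotrVZr dotrVC. Qed.

Lemma dotrVBl v w w' : dotrV (w - w') v = dotrV w v - dotrV w' v.
Proof. by rewrite !(dotrVC _ v) dotrVBr. Qed.

Lemma dotrV_ge0 v : 0 <= dotrV v v.
Proof. by apply: sumr_ge0 => i _; rewrite -expr2 sqr_ge0. Qed.

Lemma dotrV_eq0 v : dotrV v v = 0 -> v = 0.
Proof.
move=> /eqP; rewrite /dotrV psumr_eq0; last by move=> i _; rewrite -expr2 sqr_ge0.
move=> /allP v0; apply/rowP => i; rewrite mxE; apply/eqP.
by have := v0 i (mem_index_enum _); rewrite -expr2 sqrf_eq0.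
Qed.

Lemma enorm_ge0 v : 0 <= enorm v. Proof. exact: sqrtr_ge0. Qed.

Lemma enorm_sqr v : enorm v ^+ 2 = dotrV v v.
Proof. by rewrite sqr_sqrtr// dotrV_ge0. Qed.

Lemma enorm0 : enorm (0 : 'rV[R]_n) = 0.
Proof. by rewrite /enorm /dotrV big1 ?sqrtr0// => i _; rewrite mxE mul0r. Qed.

Lemma enorm_eq0 v : enorm v = 0 -> v = 0.
Proof. by move=> v0; apply: dotrV_eq0; rewrite -enorm_sqr v0 expr0n. Qed.

Lemma enormZ k v : enorm (k *: v) = `|k| * enorm v.
Proof.
by rewrite /enorm dotrVZl dotrVZr mulrA -expr2 sqrtrM ?sqr_ge0// sqrtr_sqr.
Qed.

Lemma enormN v : enorm (- v) = enorm v.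
Proof. by rewrite -scaleN1r enormZ normrN1 mul1r. Qed.

Lemma dotrV_le v w : `|dotrV v w| <= enorm v * enorm w.
Proof.
have [w0|w0] := eqVneq (enorm w) 0.
  rewrite w0 (enorm_eq0 w0) -(scale0r (0 : 'rV[R]_n)) dotrVZr mul0r normr0.
  by rewrite mulr0.
have wp : 0 < enorm w by rewrite lt_neqAle eq_sym w0 enorm_ge0.
have h : 0 <= enorm w ^+ 2 * (enorm v ^+ 2 * enorm w ^+ 2 - dotrV v w ^+ 2).
  have := dotrV_ge0 (dotrV w w *: v - dotrV v w *: w).
  rewrite !dotrVBl !dotrVBr !dotrVZl !dotrVZr -!enorm_sqr (dotrVC w v).
  by move: (enorm _) (enorm _) (dotrV _ _) => a b c; congr (_ <= _); ring.
rewrite pmulr_rge0 ?exprn_gt0// subr_ge0 -exprMn in h.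
by rewrite -(@ler_pXn2r _ 2) ?nnegrE ?mulr_ge0 ?enorm_ge0// real_normK ?num_real.
Qed.

Lemma enormD v w : enorm (v + w) <= enorm v + enorm w.
Proof.
rewrite -(@ler_pXn2r _ 2) ?nnegrE ?addr_ge0 ?enorm_ge0// enorm_sqr.
rewrite dotrVDl !dotrVDr (dotrVC w v) -!enorm_sqr.
by have := le_trans (ler_norm _) (dotrV_le v w); nra.
Qed.

Lemma coord_le_enorm v i : `|v ord0 i| <= enorm v.
Proof.
rewrite -(@ler_pXn2r _ 2) ?nnegrE ?enorm_ge0// enorm_sqr /dotrV (bigD1 i)//=.
rewrite real_normK ?num_real// expr2 lerDl sumr_ge0// => j _.
by rewrite -expr2 sqr_ge0.
Qed.

Lemma enorm_le_sum v : enorm v <= \sum_i `|v ord0 i|.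
Proof.
rewrite {1}(matrix_sum_delta v) big_ord1.
elim/big_ind2 : _ => [|x1 x2 y1 y2 h1 h2|i _].
- by rewrite enorm0.
- by rewrite (le_trans (enormD _ _))// lerD.
rewrite enormZ ler_piMr// /enorm /dotrV (bigD1 i)//= big1 ?addr0.
  by rewrite !mxE !eqxx mulr1 sqrtr1.
by move=> j ji; rewrite mxE (negbTE ji) andbF mul0r.
Qed.

Lemma enorm_continuous : continuous (@enorm R n).
Proof.
move=> v; apply: (@continuous_comp _ _ _ (fun v => dotrV v v) Num.sqrt).
  move: v; apply: continuous_big => [|i _ v]; first exact: add_continuous.
  have c := @coord_continuous R 1 n ord0 i v; exact: (cvgM c c).
exact: sqrt_continuous.
Qed.

(** By the Cauchy-Schwarz inequality it is enough to compare [|a|] and [|b|], where this is the tangent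
    inequality for powers; when [|a| = |b|] strictness comes from the equality case of Cauchy-Schwarz.
    This is the only form of strict convexity used below. *)
Lemma plap_tangent_lt p a b : 1 < p -> a != b ->
  enorm a `^ p + p * (enorm a `^ (p - 2) * dotrV a (b - a)) < enorm b `^ p.
Proof.
move=> p1 ab; set s := enorm a; set r := enorm b.
have s0 : 0 <= s := enorm_ge0 _; have r0 : 0 <= r := enorm_ge0 _.
have [sE|sn0] := eqVneq s 0.
  have a0 : a = 0 by exact: enorm_eq0.
  rewrite sE a0 -(scale0r (0 : 'rV[R]_n)) dotrVZl mul0r !mulr0 addr0.
  rewrite powR0; last by rewrite gt_eqF//; lra.
  rewrite powR_gt0// lt_neqAle r0 andbT; apply: contra ab => /eqP re.
  by rewrite a0 eq_sym; apply/eqP/enorm_eq0.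
have sp : 0 < s by rewrite lt_neqAle eq_sym sn0.
have sE : s `^ (p - 1) = s * s `^ (p - 2).
  rewrite -{2}(powRr1 s0) -powRD ?(gt_eqF sp) ?implybT//.
  by congr (_ `^ _); ring.
have t0 : 0 < s `^ (p - 2) by exact: powR_gt0.
have := le_trans (ler_norm _) (dotrV_le a b); rewrite -/s -/r => ab_le.
rewrite dotrVBr -enorm_sqr -/s.
have [rs|rs] := eqVneq r s.
  rewrite rs; rewrite rs in ab_le.
  have p0 : 0 < p by lra.
  suff : dotrV a b < s * s.
    by rewrite gtrDl (pmulr_rlt0 _ p0) (pmulr_rlt0 _ t0) subr_lt0 expr2.
  rewrite lt_neqAle ab_le andbT; apply: contra ab => /eqP abE.
  rewrite -subr_eq0; apply/eqP/dotrV_eq0; rewrite dotrVBl !dotrVBr (dotrVC b a).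
  by rewrite abE -!enorm_sqr -/s -/r rs; ring.
have := powR_tangent_lt p1 s0 r0 rs; rewrite sE; move: (s `^ (p - 2)) t0 => t t0.
have : p * (t * dotrV a b) <= p * (t * (s * r)).
  by rewrite ler_pM2l ?ler_pM2l//; lra.
nra.
Qed.

Lemma plap_tangent p a b : 1 < p ->
  enorm a `^ p + p * (enorm a `^ (p - 2) * dotrV a (b - a)) <= enorm b `^ p.
Proof.
move=> p1; have [->|ab] := eqVneq a b; last exact/ltW/plap_tangent_lt.
by rewrite subrr -(scale0r (0 : 'rV[R]_n)) dotrVZr mul0r !mulr0 addr0.
Qed.

(** Add the tangent inequality at [a] to the one at [b]. *)
Lemma plap_monotone_lt p a b : 1 < p -> a != b ->
  0 < enorm a `^ (p - 2) * dotrV a (a - b) - enorm b `^ (p - 2) * dotrV b (a - b).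
Proof.
move=> p1 ab; have h1 := plap_tangent_lt p1 ab.
have h2 := @plap_tangent_lt p b a p1 ltac:(by rewrite eq_sym).
rewrite -(opprB b a) !dotrVNr; rewrite -(opprB b a) !dotrVNr in h2.
have p0 : 0 < p by lra.
rewrite -(pmulr_rgt0 _ p0); move: (enorm a `^ p) (enorm b `^ p) h1 h2 => X Y.
by move: (enorm a `^ _) (enorm b `^ _) (dotrV _ _) (dotrV _ _) => *; lra.
Qed.

Lemma plap_self p a : 1 < p -> enorm a `^ (p - 2) * dotrV a a = enorm a `^ p.
Proof.
move=> p1; have [->|a0] := eqVneq a 0.
  by rewrite enorm0 -(scale0r (0 : 'rV[R]_n)) dotrVZl mul0r mulr0 powR0// gt_eqF; lra.
have e0 : 0 < enorm a.
  by rewrite lt_neqAle enorm_ge0 andbT eq_sym; apply: contra a0 => /eqP/enorm_eq0 ->.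
rewrite -enorm_sqr -powR_mulrn ?enorm_ge0// -powRD ?(gt_eqF e0) ?implybT//.
by congr (_ `^ _); ring.
Qed.

Lemma plap_le p a b : 1 < p ->
  `|enorm a `^ (p - 2) * dotrV a b| <= enorm a `^ (p - 1) * enorm b.
Proof.
move=> p1; have [->|a0] := eqVneq a 0.
  rewrite -(scale0r (0 : 'rV[R]_n)) dotrVZl mul0r mulr0 normr0.
  by rewrite mulr_ge0 ?powR_ge0 ?enorm_ge0.
have e0 : 0 < enorm a.
  by rewrite lt_neqAle enorm_ge0 andbT eq_sym; apply: contra a0 => /eqP/enorm_eq0 ->.
rewrite normrM ger0_norm ?powR_ge0// (_ : p - 1 = (p - 2) + 1); last ring.
rewrite (@powRD _ _ (p - 2) 1) ?(gt_eqF e0) ?implybT// powRr1 ?enorm_ge0// -mulrA.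
by rewrite ler_wpM2l ?powR_ge0// dotrV_le.
Qed.

Lemma plap_mixed p a b : 1 < p ->
  `|enorm a `^ (p - 2) * dotrV a b| <= enorm a `^ p + enorm b `^ p.
Proof.
by move=> p1; rewrite (le_trans (plap_le _ _ p1))// powR_mixed ?enorm_ge0.
Qed.

End euclidean.

Section compactness.
Context {R : realType}.

(** Both sides are [p]-homogeneous, so it suffices to compare them on the unit
    sphere, where [Q] is bounded away from zero as long as [P >= e]. *)
Lemma homogeneous_le m (P Q : 'rV[R]_m -> R) p :
  0 < p -> continuous P -> continuous Q ->
  (forall t z, 0 <= t -> P (t *: z) = t `^ p * P z) ->
  (forall t z, 0 <= t -> Q (t *: z) = t `^ p * Q z) ->
  (forall z, 0 <= Q z) -> (forall z, Q z = 0 -> P z <= 0) ->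
  forall e, 0 < e -> exists2 C, 0 <= C & forall z, P z <= e * `|z| `^ p + C * Q z.
Proof.
move=> p0 cP cQ hP hQ Q0 QP e e0.
pose S := [set z : 'rV[R]_m | `|z| = 1].
have bS (A : set 'rV[R]_m) : A `<=` S -> closed A -> compact A.
  move=> AS cA; apply: bounded_closed_compact => //.
  by exists 1; split => // x x1 z /AS; rewrite /S/= => ->; exact: ltW.
have cS : closed S.
  rewrite (_ : S = (fun z => `|z|) @^-1` [set 1]) //.
  by apply: closed_comp; [move=> z _; exact: norm_continuous|exact: closed_eq].
suff [C C0 hC] : exists2 C, 0 <= C & forall z, S z -> P z <= e + C * Q z.
  exists C => // z; have [->|z0] := eqVneq z 0.
    rewrite -(scale0r (0 : 'rV[R]_m)) hP// hQ// powR0 ?gt_eqF// !mul0r mulr0 addr0.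
    by rewrite mulr_ge0 ?powR_ge0// ltW.
  have nz : 0 < `|z| by rewrite normr_gt0.
  have zE : z = `|z| *: (`|z|^-1 *: z) by rewrite scalerA divff ?gt_eqF// scale1r.
  have -> : P z = `|z| `^ p * P (`|z|^-1 *: z) by rewrite -hP// -zE.
  have -> : Q z = `|z| `^ p * Q (`|z|^-1 *: z) by rewrite -hQ// -zE.
  rewrite [C * _]mulrCA (mulrC e) -mulrDr ler_wpM2l ?powR_ge0// hC// /S/= normrZ normfV normr_id mulVf ?gt_eqF//.
have [S0|/set0P S0] := eqVneq S set0.
  by exists 0 => // z; rewrite S0.
have within (f : 'rV[R]_m -> R) A : continuous f -> {within A, continuous f}.
  exact: continuous_subspaceT.
have [M _ PM] := compact_EVT_max S0 (bS _ (@subset_refl _ _) cS) (within _ _ cP).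
pose K := S `&` [set z | e <= P z].
have cK : closed K.
  apply: closedI => //; rewrite (_ : [set _ | _] = P @^-1` [set x | e <= x])//.
  by apply: closed_comp; [move=> z _; exact: cP|exact: closed_ge].
have [K0|/set0P K0] := eqVneq K set0.
  exists 0 => // z Sz; rewrite mul0r addr0 leNgt; apply/negP => /ltW Pz.
  by have : K z by []; rewrite K0.
have [q] := compact_EVT_min K0 (bS K (@subIsetl _ _ _) cK) (within _ _ cQ).
rewrite inE => -[Sq Pq] Qq.
have Qq0 : 0 < Q q.
  rewrite lt_neqAle eq_sym Q0 andbT; apply/eqP => /QP.
  by rewrite leNgt (lt_le_trans e0 Pq).
have PM0 : 0 < P M by rewrite (lt_le_trans e0)// (le_trans Pq)// PM// inE.
exists (P M / Q q); first by rewrite divr_ge0// ltW.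
move=> z Sz; have [Pz|Pz] := ltP (P z) e.
  by rewrite (le_trans (ltW Pz))// lerDl mulr_ge0 ?divr_ge0// ltW.
rewrite (le_trans (PM z _)) ?inE// -[leLHS]add0r lerD ?(ltW e0)//.
by rewrite -mulrA ler_peMr ?(ltW PM0)// ler_pdivlMl// mulr1 Qq// inE.
Qed.

End compactness.

(** * Integrals and L^p spaces on a set *)

Section real_sequences.
Context {R : realType}.
Implicit Types (u : nat -> R).

Lemma eq_ler (x y : R) : x = y -> x <= y. Proof. by move=> ->. Qed.

Lemma cvg_normr_powR0 u p : 0 < p -> u @ \oo --> (0 : R) ->
  (fun n => `|u n| `^ p) @ \oo --> (0 : R).
Proof.
move=> p0 cu; have := @continuous_normr_powR R p p0 0.
rewrite /continuous_at normr0 powR0 ?gt_eqF// => cp.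
exact: cvg_comp cu cp.
Qed.

Lemma powR_exprn (a q : R) k : 0 <= a -> (a ^+ k) `^ q = (a `^ q) ^+ k.
Proof.
move=> a0; have e : a ^+ k = a `^ k%:R by rewrite powR_mulrn.
by rewrite e -powRrM mulrC powRrM powR_mulrn ?powR_ge0.
Qed.

Lemma cvgZ0 u (k : R) : u @ \oo --> (0 : R) -> (fun n => k * u n) @ \oo --> (0 : R).
Proof.
move=> cu; have c : (fun n => k * u n) @ \oo --> k * 0 by exact: cvgMr.
by rewrite mulr0 in c.
Qed.

Lemma cvgD0 u (v : nat -> R) : u @ \oo --> (0 : R) -> v @ \oo --> (0 : R) ->
  (fun n => u n + v n) @ \oo --> (0 : R).
Proof.
move=> cu cv; have c : (fun n => u n + v n) @ \oo --> (0 + 0 : R) by exact: cvgD.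
by rewrite addr0 in c.
Qed.

Lemma squeeze0 u (v : nat -> R) : (forall n, 0 <= u n <= v n) ->
  v @ \oo --> (0 : R) -> u @ \oo --> (0 : R).
Proof.
move=> uv; apply: (@squeeze_cvgr _ _ _ _ (cst 0)); last exact: cvg_cst.
exact: nearW.
Qed.

End real_sequences.

Section real_integral.
Context d (T : measurableType d) (R : realType) (mu : {measure set T -> \bar R}).
Variables (D : set T) (mD : measurable D).
Implicit Types (f g h u v w : T -> R) (p a b C e : R).
Local Notation itg f := (mu.-integrable D (EFin \o f)).
Local Notation Int f := (\int[mu]_(x in D) f x).

Lemma itg_meas f : itg f -> measurable_fun D f.
Proof. by move=> /integrableP[/measurable_EFinP]. Qed.

Lemma itg_fin f : itg f -> (\int[mu]_(x in D) (f x)%:E)%E = (Int f)%:E.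
Proof. by move=> /(integrable_fin_num mD) /fineK. Qed.

Lemma itg_le f g : measurable_fun D f -> (forall x, D x -> `|f x| <= g x) ->
  itg g -> itg f.
Proof.
move=> mf fg; apply: le_integrable => //; first exact/measurable_EFinP.
by move=> x Dx; rewrite /= lee_fin (le_trans (fg _ Dx))// ler_norm.
Qed.

Lemma itg_ae_eq f g : measurable_fun D g -> {ae mu, forall x, D x -> f x = g x} ->
  itg f -> itg g.
Proof.
move=> mg fg fi; have mf := itg_meas fi.
have := fi => /integrableP[_ foo]; apply/integrableP.
split; first exact/measurable_EFinP.
rewrite (ge0_ae_eq_integral (g := fun x => `|(f x)%:E|%E))//.
- by apply: measurableT_comp => //; exact/measurable_EFinP.
- by apply: measurableT_comp => //; exact/measurable_EFinP.
- by apply: filterS fg => x fg Dx /=; rewrite fg.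
Qed.

Lemma itg_ae_le f g : measurable_fun D f -> {ae mu, forall x, D x -> `|f x| <= g x} ->
  itg g -> itg f.
Proof.
move=> mf fg /integrableP[/measurable_EFinP mg goo].
apply/integrableP; split; first exact/measurable_EFinP.
apply: le_lt_trans goo; apply: ae_ge0_le_integral => //.
- by do 2 apply: measurableT_comp => //.
- by do 2 apply: measurableT_comp => //.
- by apply: filterS fg => x fg Dx /=; rewrite lee_fin (le_trans (fg Dx))// ler_norm.
Qed.

Lemma itgD f g : itg f -> itg g -> itg (fun x => f x + g x).
Proof. by move=> fi gi; exact: (integrableD mD fi gi). Qed.

Lemma itgB f g : itg f -> itg g -> itg (fun x => f x - g x).
Proof. by move=> fi gi; exact: (integrableB mD fi gi). Qed.

Lemma itgZ a f : itg f -> itg (fun x => a * f x).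
Proof. by move=> fi; exact: (integrableZl mD a fi). Qed.

Lemma itg_norm f : itg f -> itg (fun x => `|f x|).
Proof. exact: integrable_norm. Qed.

Lemma itg_sum (I : Type) (r : seq I) (P : pred I) (f : I -> T -> R) :
  (forall i, P i -> itg (f i)) -> itg (fun x => \sum_(i <- r | P i) f i x).
Proof.
move=> fi; have := integrable_sum mD r fi.
by apply: eq_integrable => // x _ /=; rewrite sumEFin.
Qed.

Lemma Int_sum (I : Type) (r : seq I) (P : pred I) (f : I -> T -> R) :
  (forall i, P i -> itg (f i)) ->
  Int (fun x => \sum_(i <- r | P i) f i x) = \sum_(i <- r | P i) Int (f i).
Proof.
move=> fi; elim: r => [|i r IH].
  under eq_Rintegral do rewrite big_nil.
  by rewrite big_nil Rintegral_cst// mul0r.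
under eq_Rintegral do rewrite big_cons.
rewrite big_cons; case: ifPn => // Pi.
by rewrite RintegralD ?IH//; [exact: fi|exact: itg_sum].
Qed.

Lemma Int_ae_eq f g : measurable_fun D f -> measurable_fun D g ->
  {ae mu, forall x, D x -> f x = g x} -> Int f = Int g.
Proof.
move=> mf mg fg; congr fine; apply: ae_eq_integral => //; first exact/measurable_EFinP.
  exact/measurable_EFinP.
by apply: filterS fg => x fg Dx /=; rewrite fg.
Qed.

Lemma Int_ae_ge0 f : measurable_fun D f -> {ae mu, forall x, D x -> 0 <= f x} ->
  0 <= Int f.
Proof.
move=> mf f0; rewrite (@Int_ae_eq _ (fun x => `|f x|))//.
- exact: Rintegral_ge0.
- exact: measurableT_comp.
- by apply: filterS f0 => x f0 Dx; rewrite ger0_norm// f0.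
Qed.

Lemma Int_eq0 f : itg f -> {ae mu, forall x, D x -> 0 <= f x} -> Int f <= 0 ->
  {ae mu, forall x, D x -> f x = 0}.
Proof.
move=> fi f0 If0; have mf := itg_meas fi.
have /eqP I0 : Int (fun x => `|f x|) == 0.
  rewrite -(@Int_ae_eq f)//; last 2 first.
  - exact: measurableT_comp.
  - by apply: filterS f0 => x f0 Dx; rewrite ger0_norm// f0.
  by rewrite eq_le If0 Int_ae_ge0.
have : (\int[mu]_(x in D) `|(f x)%:E| = 0)%E.
  by have := itg_fin (itg_norm fi); rewrite I0.
have mEf : measurable_fun D (fun x => (f x)%:E) by exact/measurable_EFinP.
move=> /(ae_eq_integral_abs mu mD mEf).
by apply: filterS => x /= xf /xf[].
Qed.

Lemma dct (f_ : nat -> T -> R) f g : (forall n, measurable_fun D (f_ n)) ->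
  measurable_fun D f -> {ae mu, forall x, D x -> f_ ^~ x @ \oo --> f x} ->
  itg g -> {ae mu, forall x, forall n, D x -> `|f_ n x| <= g x} ->
  [/\ itg f, (fun n => Int (fun x => `|f_ n x - f x|)) @ \oo --> 0
    & (fun n => Int (f_ n)) @ \oo --> Int f].
Proof.
move=> mf_ mf cf gi fg.
have [|||||fi h1 h2] := @dominated_convergence _ _ _ mu D mD
  (fun n x => (f_ n x)%:E) (EFin \o f) (EFin \o g).
- by move=> n; exact/measurable_EFinP.
- exact/measurable_EFinP.
- by apply: filterS cf => x cf Dx; apply: cvg_EFin; [exact: nearW|exact: cf].
- by [].
- by apply: filterS fg => x fg n Dx /=; rewrite lee_fin fg.
split => //; first exact: (fine_cvg h1).
by have := h2; rewrite /= (itg_fin fi) => /fine_cvg.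
Qed.

(** For limits known to be integrable only through a bound on the integrals. *)
Lemma fatou_real (f_ : nat -> T -> R) f C : (forall n, itg (f_ n)) ->
  (forall n x, D x -> 0 <= f_ n x) -> (forall n, Int (f_ n) <= C) ->
  measurable_fun D f -> {ae mu, forall x, D x -> f_ ^~ x @ \oo --> f x} ->
  itg f /\ Int f <= C.
Proof.
move=> fi f0 IC mf [N [mN N0 cvN]].
have mN1 : measurable_fun D (\1_(~` N) : T -> R).
  by apply: measurable_indic; exact: measurableC.
pose f' x := f x * \1_(~` N) x; pose f'_ n x := f_ n x * \1_(~` N) x.
have cf x : D x -> f'_ ^~ x @ \oo --> f' x.
  move=> Dx; have [Nx|Nx] := pselect (N x).
    rewrite /f'_ /f' indicE memNset; last by move=> /(_ Nx).
    by under eq_fun do rewrite mulr0; rewrite mulr0; exact: cvg_cst.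
  apply: cvgMl; apply: contrapT => h; apply/Nx/cvN => /= /(_ Dx).
  exact: h.
have mf' : measurable_fun D f' by exact: measurable_funM.
have mf'_ n : measurable_fun D (f'_ n).
  by apply: measurable_funM => //; exact: itg_meas.
have ind x : 0 <= (\1_(~` N) x : R) <= 1.
  by rewrite indicE; case: (_ \in _); rewrite ?lexx ler01.
have f'_0 n x : D x -> 0 <= f'_ n x.
  by move=> Dx; have /andP[? _] := ind x; rewrite mulr_ge0// f0.
have f'0 x : D x -> 0 <= f' x.
  move=> Dx; have /cvg_lim <-// := cf x Dx.
  by apply: limr_ge; [exact: cvgP (cf x Dx)|apply: nearW => n; exact: f'_0].
have f'C : (\int[mu]_(x in D) (f' x)%:E <= C%:E)%E.
  rewrite (@eq_integral _ _ _ _ _ (fun x => limn_einf (fun n => (f'_ n x)%:E))); last first.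
    move=> x; rewrite inE => Dx.
    have c : (fun n => (f'_ n x)%:E) @ \oo --> (f' x)%:E.
      by apply: cvg_EFin; [exact: nearW|exact: cf].
    by rewrite is_cvg_limn_einfE ?(cvg_lim _ c)//; exact: cvgP c.
  apply: le_trans.
    apply: (@fatou _ _ _ mu D mD (fun n x => (f'_ n x)%:E)) => [n|n x Dx].
      exact/measurable_EFinP.
    by rewrite lee_fin f'_0.
  rewrite limn_einf_lim; apply: lime_le; first exact: is_cvg_einfs.
  apply: nearW => n; apply: (@le_trans _ _ (\int[mu]_(x in D) (f'_ n x)%:E)%E).
    by apply: ereal_inf_lbound; exists n => /=.
  rewrite (le_trans _ (_ : (Int (f_ n))%:E <= _)%E) ?lee_fin//.
  rewrite -itg_fin//; apply: ge0_le_integral => //.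
  - by move=> x Dx; rewrite lee_fin f'_0.
  - exact/measurable_EFinP.
  - by apply/measurable_EFinP; exact: itg_meas.
  - by move=> x Dx; rewrite lee_fin ler_piMr ?f0//; have /andP[] := ind x.
have fi' : itg f'.
  apply/integrableP; split; first exact/measurable_EFinP.
  rewrite (@eq_integral _ _ _ _ _ (fun x => (f' x)%:E)).
    exact: le_lt_trans f'C (ltry _).
  by move=> x; rewrite inE => Dx; rewrite /= ger0_norm// f'0.
have ff' : {ae mu, forall x, D x -> f' x = f x}.
  exists N; split => // x /= h; apply: contrapT => Nx; apply: h => _.
  by rewrite /f' indicE mem_set// mulr1.
split; first exact: itg_ae_eq ff' fi'.
by rewrite -(@Int_ae_eq f' f)// -lee_fin -itg_fin.
Qed.

(** Borel-Cantelli in disguise: the sum of [2^k f_k] is integrable, hence finite almost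
    everywhere. *)
Lemma fast_ae_bound (f : nat -> T -> R) : (forall k, itg (f k)) ->
  (forall k x, D x -> 0 <= f k x) -> (forall k, Int (f k) <= 4^-1 ^+ k) ->
  {ae mu, forall x, D x -> exists M, forall k, f k x <= M * 2^-1 ^+ k}.
Proof.
move=> fi f0 If; pose g k x := (2 ^+ k * f k x)%:E.
have gi k : itg (fun x => 2 ^+ k * f k x) by exact: itgZ.
have g0 k x : D x -> (0 <= g k x)%E.
  by move=> Dx; rewrite lee_fin mulr_ge0 ?exprn_ge0 ?f0.
have mg k : measurable_fun D (g k) by apply/measurable_EFinP; exact: itg_meas.
pose S x := (\sum_(k <oo) g k x)%E.
have mS : measurable_fun D S.
  by apply: (@ge0_emeasurable_sum _ _ _ D g xpredT) => // k x Dx _; exact: g0.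
have S0 x : D x -> (0 <= S x)%E by move=> Dx; apply: nneseries_ge0 => k _ _; exact: g0.
have iS : mu.-integrable D S.
  apply/integrableP; split => //.
  rewrite (@eq_integral _ _ _ _ _ S); last first.
    by move=> x; rewrite inE => Dx; rewrite gee0_abs ?S0.
  rewrite /S integral_nneseries//.
  apply: (@le_lt_trans _ _ (\sum_(k <oo) ((2 / (2 ^ (k + 1))%:R)%:E : \bar R))%E).
    apply: lee_nneseries => [k _ _|k _]; first by apply: integral_ge0 => x Dx; exact: g0.
    rewrite (itg_fin (gi k)) lee_fin RintegralZl// addn1 expnS natrM natrX.
    rewrite invfM mulrA divff// mul1r.
    rewrite (le_trans (ler_wpM2l _ (If k))) ?exprn_ge0// -exprMn.
    by rewrite -exprVn (_ : 2 / 4 = 2^-1 :> R)//; field.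
  have /cvg_lim -> // := @cvg_geometric_eseries_half R 2 0.
  exact: ltry.
have := integrable_ae mD iS; apply: filterS => x Sx Dx.
exists (fine (S x)) => k; rewrite exprVn ler_pdivlMr ?exprn_gt0// mulrC -lee_fin fineK ?Sx//.
have := @nneseries_lim_ge R (fun k => g k x) xpredT 0 k.+1.
rewrite big_nat_recr//= => h.
have : (\sum_(0 <= i < k) g i x + g k x <= S x)%E by apply: h => i _ _; exact: g0.
by apply: le_trans; apply: leeDr; apply: sume_ge0 => i _; exact: g0.
Qed.


(** Membership and convergence in L^p without roots: all estimates below compare integrals
    of [p]-th powers. *)
Definition Lp p f := measurable_fun D f /\ itg (fun x => `|f x| `^ p).

Definition cvLp p (u_ : nat -> T -> R) u :=
  (fun n => Int (fun x => `|u_ n x - u x| `^ p)) @ \oo --> (0 : R).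

Lemma measurable_normr_powR p f : measurable_fun D f ->
  measurable_fun D (fun x => `|f x| `^ p).
Proof.
move=> mf; apply: (measurableT_comp (measurable_powR p)).
exact: (measurableT_comp (@normr_measurable R setT)).
Qed.

Section Lp_theory.
Variable p : R.
Hypothesis p1 : 1 < p.

Let p0 : 0 < p. Proof. by rewrite (lt_trans _ p1). Qed.

Lemma Lp_ae_le f g : measurable_fun D f -> {ae mu, forall x, D x -> `|f x| <= `|g x|} ->
  Lp p g -> Lp p f.
Proof.
move=> mf fg [mg gi]; split => //; apply: itg_ae_le gi; first exact: measurable_normr_powR.
by apply: filterS fg => x fg Dx; rewrite ger0_norm ?powR_ge0// ler_powR2 ?(ltW p0)// fg.
Qed.

Lemma Lp_le f g : measurable_fun D f -> (forall x, D x -> `|f x| <= `|g x|) ->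
  Lp p g -> Lp p f.
Proof. by move=> mf fg; apply: Lp_ae_le => //; exact: aeW. Qed.

Lemma Lp_ae_eq f g : measurable_fun D g -> {ae mu, forall x, D x -> f x = g x} ->
  Lp p f -> Lp p g.
Proof. by move=> mg fg; apply: Lp_ae_le => //; apply: filterS fg => x fg Dx; rewrite fg. Qed.

Lemma LpD f g : Lp p f -> Lp p g -> Lp p (fun x => f x + g x).
Proof.
move=> [mf fi] [mg gi]; split; first exact: measurable_funD.
apply: itg_le (itgZ (2 `^ p) (itgD fi gi)).
  by apply: measurable_normr_powR; exact: measurable_funD.
by move=> x Dx; rewrite ger0_norm ?powR_ge0// powR_add_le.
Qed.

Lemma LpZ a f : Lp p f -> Lp p (fun x => a * f x).
Proof.
move=> [mf fi]; split; first exact: measurable_funM.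
apply: itg_le (itgZ (`|a| `^ p) fi).
  by apply: measurable_normr_powR; exact: measurable_funM.
by move=> x Dx; rewrite ger0_norm ?powR_ge0// normrM powRM.
Qed.

Lemma LpB f g : Lp p f -> Lp p g -> Lp p (fun x => f x - g x).
Proof.
move=> fi gi; have := LpD fi (LpZ (-1) gi).
by under eq_fun do rewrite mulN1r.
Qed.

Lemma Lp_norm f : Lp p f -> Lp p (fun x => `|f x|).
Proof.
move=> [mf fi]; apply: (Lp_le (g := f)) => [|x _|//]; last by rewrite normr_id.
exact: measurableT_comp.
Qed.

Lemma Lp0 : Lp p (fun=> 0).
Proof.
split; first exact: measurable_cst.
under eq_fun do rewrite normr0 powR0 ?gt_eqF//.
exact: integrable0.
Qed.

Lemma Lp_sum (I : Type) (r : seq I) (P : pred I) (f : I -> T -> R) :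
  (forall i, P i -> Lp p (f i)) -> Lp p (fun x => \sum_(i <- r | P i) f i x).
Proof.
move=> fi; elim: r => [|i r IH]; first by under eq_fun do rewrite big_nil; exact: Lp0.
under eq_fun do rewrite big_cons; case: (boolP (P i)) => Pi //.
by apply: LpD => //; exact: fi.
Qed.

Lemma Np_ge0 f : 0 <= Int (fun x => `|f x| `^ p).
Proof. by apply: Rintegral_ge0 => x _; exact: powR_ge0. Qed.

Lemma NpD f g : Lp p f -> Lp p g -> Int (fun x => `|f x + g x| `^ p) <=
  2 `^ p * (Int (fun x => `|f x| `^ p) + Int (fun x => `|g x| `^ p)).
Proof.
move=> Lf Lg; rewrite -RintegralD ?(Lf.2, Lg.2)// -RintegralZl//; last first.
  exact: itgD (Lf.2) (Lg.2).
apply: le_Rintegral => //; first exact: (LpD Lf Lg).2.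
  exact: itgZ (itgD Lf.2 Lg.2).
by move=> x _; exact: powR_add_le.
Qed.

Lemma NpZ a f : Lp p f ->
  Int (fun x => `|a * f x| `^ p) = `|a| `^ p * Int (fun x => `|f x| `^ p).
Proof.
move=> Lf; rewrite -RintegralZl ?Lf.2//.
by apply: eq_Rintegral => x _; rewrite normrM powRM.
Qed.

Lemma Np_distC f g :
  Int (fun x => `|f x - g x| `^ p) = Int (fun x => `|g x - f x| `^ p).
Proof. by apply: eq_Rintegral => x _; rewrite distrC. Qed.

Lemma Np_triangle f g h : Lp p f -> Lp p g -> Lp p h ->
  Int (fun x => `|f x - h x| `^ p) <=
  2 `^ p * (Int (fun x => `|f x - g x| `^ p) + Int (fun x => `|g x - h x| `^ p)).
Proof.
move=> Lf Lg Lh; have := NpD (LpB Lf Lg) (LpB Lg Lh); apply: le_trans.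
apply: eq_ler; apply: eq_Rintegral => x _; congr (`|_| `^ _); ring.
Qed.

Lemma cvLpP (u_ : nat -> T -> R) u : cvLp p u_ u <->
  (forall e, 0 < e -> exists N, forall n, (N <= n)%N ->
     Int (fun x => `|u_ n x - u x| `^ p) <= e).
Proof.
split=> [/cvgrPdist_le h e /h[N _ hN]|h].
  exists N => n Nn; have := hN n Nn.
  by rewrite sub0r normrN ger0_norm ?Np_ge0.
apply/cvgrPdist_le => e /h[N hN]; exists N => // n Nn.
by rewrite sub0r normrN ger0_norm ?Np_ge0//; exact: hN.
Qed.

Lemma cvLpD (u_ v_ : nat -> T -> R) u v :
  (forall n, Lp p (u_ n)) -> Lp p u -> (forall n, Lp p (v_ n)) -> Lp p v ->
  cvLp p u_ u -> cvLp p v_ v ->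
  cvLp p (fun n x => u_ n x + v_ n x) (fun x => u x + v x).
Proof.
move=> Lu_ Lu Lv_ Lv cu cv.
apply: (@squeeze0 _ _ (fun n => 2 `^ p *
  (Int (fun x => `|u_ n x - u x| `^ p) + Int (fun x => `|v_ n x - v x| `^ p)))).
- move=> n; rewrite Np_ge0/=.
  have := NpD (LpB (Lu_ n) Lu) (LpB (Lv_ n) Lv); apply: le_trans.
  apply: eq_ler; apply: eq_Rintegral => x _; congr (`|_| `^ _); ring.
- exact: (cvgZ0 _ (cvgD0 cu cv)).
Qed.

Lemma cvLpZ a (u_ : nat -> T -> R) u :
  (forall n, Lp p (u_ n)) -> Lp p u -> cvLp p u_ u ->
  cvLp p (fun n x => a * u_ n x) (fun x => a * u x).
Proof.
move=> Lu_ Lu cu; rewrite /cvLp (_ : (fun n => _) =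
  (fun n => `|a| `^ p * Int (fun x => `|u_ n x - u x| `^ p))); first exact: cvgZ0.
apply/funext => n; rewrite -(NpZ a (LpB (Lu_ n) Lu)).
by apply: eq_Rintegral => x _; rewrite mulrBr.
Qed.

Lemma Lp_dct (u_ : nat -> T -> R) u g : (forall n, measurable_fun D (u_ n)) ->
  measurable_fun D u -> {ae mu, forall x, D x -> u_ ^~ x @ \oo --> u x} ->
  Lp p g -> (forall n x, D x -> `|u_ n x| <= `|g x|) ->
  Lp p u /\ cvLp p u_ u.
Proof.
move=> mu_ mu' cu Lg ug.
have ug' : {ae mu, forall x, D x -> `|u x| <= `|g x|}.
  apply: filterS cu => x cu Dx; have {}cu := cu Dx.
  have c : `|u_ n x| @[n --> \oo] --> `|u x| by exact: cvg_norm.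
  rewrite -(cvg_lim _ c)//.
  by apply: limr_le; [exact: cvgP c|apply: nearW => n; exact: ug].
have Lu : Lp p u by exact: Lp_ae_le ug' Lg.
split => //; have Lgg := LpZ 2 Lg.
have [|||||_ _] := @dct (fun n x => `|u_ n x - u x| `^ p) (fun=> 0)
  (fun x => `|2 * g x| `^ p).
- by move=> n; apply: measurable_normr_powR; exact: measurable_funB.
- exact: measurable_cst.
- apply: filterS cu => x cu Dx.
  by apply: cvg_normr_powR0 => //; apply/subr_cvg0; exact: cu.
- exact: Lgg.2.
- apply: filterS ug' => x ug' n Dx.
  rewrite ger0_norm ?powR_ge0// ler_powR2 ?(ltW p0)//.
  rewrite normrM ger0_norm// mulr2n mulrDl mul1r (le_trans (ler_normB _ _))// lerD ?ug//.
  exact: ug'.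
by rewrite Rintegral_cst// mul0r.
Qed.

(** Along a subsequence with [\int |u_(s k) - u|^p <= 4^-k] the pointwise bound for
    rapidly decreasing integrals applies. *)
Lemma cvLp_subseq (u_ : nat -> T -> R) u :
  (forall n, Lp p (u_ n)) -> Lp p u -> cvLp p u_ u ->
  exists2 s : nat -> nat, (forall k, (k <= s k)%N) &
    {ae mu, forall x, D x -> u_ (s k) x @[k --> \oo] --> u x}.
Proof.
move=> Lu_ Lu /cvLpP cu.
have /choice[s hs] k : exists n, (k <= n)%N /\ Int (fun x => `|u_ n x - u x| `^ p) <= 4^-1 ^+ k.
  have [|N hN] := cu (4^-1 ^+ k); first by rewrite exprn_gt0.
  by exists (maxn k N); rewrite leq_maxl hN// leq_maxr.
exists s => [k|]; first by have [] := hs k.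
have := @fast_ae_bound (fun k x => `|u_ (s k) x - u x| `^ p).
move=> /(_ _ _ _)/filterS; apply; last 3 first.
- by move=> k; exact: (LpB (Lu_ _) Lu).2.
- by move=> k x Dx; exact: powR_ge0.
- by move=> k; have [] := hs k.
move=> x h Dx; have [M hM] := h Dx.
apply/subr_cvg0/norm_cvg0P.
have cq : (M * 2^-1 ^+ k) @[k --> \oo] --> (0 : R).
  by have := @cvg_geometric R M 2^-1; apply; rewrite ger0_norm// invf_lt1// ltr1n.
have c1 : (`|u_ (s k) x - u x| `^ p) @[k --> \oo] --> (0 : R).
  apply: (@squeeze0 _ _ (fun k => M * 2^-1 ^+ k)) => // k.
  by rewrite powR_ge0 hM.
have pi0 : 0 < p^-1 by rewrite invr_gt0.
have := cvg_normr_powR0 pi0 c1.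
by under eq_fun do rewrite ger0_norm ?powR_ge0// -powRrM divff ?gt_eqF// powRr1//.
Qed.

(** A subsequence whose increments have integral at most [4^-k] is pointwise Cauchy almost
    everywhere; Fatou's lemma identifies its pointwise limit as the limit in L^p. *)
Theorem Lp_complete (u_ : nat -> T -> R) : (forall n, Lp p (u_ n)) ->
  (forall e, 0 < e -> exists N, forall m n, (N <= m)%N -> (N <= n)%N ->
     Int (fun x => `|u_ m x - u_ n x| `^ p) <= e) ->
  exists2 u, Lp p u & cvLp p u_ u.
Proof.
move=> Lu_ cu.
have /choice[N hN] k : exists N, forall m n, (N <= m)%N -> (N <= n)%N ->
    Int (fun x => `|u_ m x - u_ n x| `^ p) <= 4^-1 ^+ k.
  by apply: cu; rewrite exprn_gt0.
(* a nondecreasing sequence with [N k <= s k] *)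
pose s k := (\sum_(j < k.+1) N j + k)%N.
have Ns k : (N k <= s k)%N by rewrite /s big_ord_recr -addnA addnCA leq_addr.
have ss k : (s k <= s k.+1)%N by rewrite /s [in leqRHS]big_ord_recr addnS leqW// leq_add2r leq_addr.
have [A [mA A0 bA]] := @fast_ae_bound (fun k x => `|u_ (s k.+1) x - u_ (s k) x| `^ p)
  (fun k => (LpB (Lu_ _) (Lu_ _)).2) (fun k x _ => powR_ge0 _ _)
  (fun k => hN k _ _ (leq_trans (Ns k) (ss k)) (Ns k)).
(* set to zero on the exceptional null set, so that the limit exists everywhere *)
pose v_ k x := u_ (s k) x * \1_(~` A) x.
have cv x : D x -> cvgn (v_ ^~ x).
  move=> Dx; have [Ax|Ax] := pselect (A x).
    rewrite /v_ indicE memNset; last by move=> /(_ Ax).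
    by under eq_fun do rewrite mulr0; exact: is_cvg_cst.
  have [M hM] : exists M, forall k, `|u_ (s k.+1) x - u_ (s k) x| `^ p <= M * 2^-1 ^+ k.
    by apply: contrapT => h; apply/Ax/bA => /(_ Dx).
  have M0 : 0 <= M by have := hM 0%N; rewrite expr0 mulr1; exact: le_trans (powR_ge0 _ _).
  rewrite /v_ indicE mem_set//; under eq_fun do rewrite mulr1.
  pose w k := u_ (s k) x.
  have tw : cvgn (series (telescope w)).
    apply: normed_cvg; apply: (@series_le_cvg _ _ (geometric (M `^ p^-1) (2^-1 `^ p^-1))).
    - by move=> k /=.
    - by move=> k; rewrite geometric_ge0 ?powR_ge0.
    - move=> k; rewrite /telescope /w/= -(@powRr1 _ `|_|)//.
      rewrite -[X in _ `^ X](divff (lt0r_neq0 p0)) powRrM.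
      apply: (le_trans (ler_powR2 _ (powR_ge0 _ _) (hM k))).
        by rewrite invr_ge0 ltW.
      by rewrite powRM ?exprn_ge0// powR_exprn.
    - apply: is_cvg_geometric_series; rewrite ger0_norm ?powR_ge0//.
      have : 2^-1 `^ p^-1 < 1 `^ p^-1 :> R.
        by rewrite gt0_ltr_powR ?nnegrE ?invr_gt0// invf_lt1// ltr1n.
      by rewrite powR1.
  move: tw; rewrite telescopeK => tw.
  change (cvgn w).
  have -> : w = (fun k => (w k - w 0%N) + w 0%N) by apply/funext => k; rewrite subrK.
  by apply: is_cvgD => //; exact: is_cvg_cst.
pose u x := if x \in D then limn (v_ ^~ x) else 0.
have cv' x : D x -> v_ ^~ x @ \oo --> u x.
  by move=> Dx; rewrite /u mem_set//; exact: cv.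
have mv k : measurable_fun D (v_ k).
  apply: measurable_funM; first exact: (Lu_ _).1.
  by apply: measurable_indic; exact: measurableC.
have mu' : measurable_fun D u by exact: measurable_fun_cvg mv cv'.
have cus : {ae mu, forall x, D x -> u_ (s k) x @[k --> \oo] --> u x}.
  exists A; split => // x /= h; apply: contrapT => Ax; apply: h => Dx.
  have := cv' x Dx; rewrite /v_ indicE mem_set//.
  by under eq_fun do rewrite mulr1.
have key e n0 : (forall m n, (n0 <= m)%N -> (n0 <= n)%N ->
     Int (fun x => `|u_ m x - u_ n x| `^ p) <= e) -> forall n, (n0 <= n)%N ->
    itg (fun x => `|u_ n x - u x| `^ p) /\ Int (fun x => `|u_ n x - u x| `^ p) <= e.
  move=> h n hn; apply: (@fatou_real (fun k x => `|u_ n x - u_ (s (k + n0)%N) x| `^ p)).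
  - by move=> k; exact: (LpB (Lu_ _) (Lu_ _)).2.
  - by move=> k x _; exact: powR_ge0.
  - move=> k; apply: h => //; rewrite (leq_trans _ (leq_addl _ _))//.
    by rewrite leq_addl.
  - by apply: measurable_normr_powR; apply: measurable_funB => //; exact: (Lu_ _).1.
  apply: filterS cus => x cx Dx.
  apply: (continuous_cvg _ (@continuous_normr_powR R p p0 _)).
  apply: cvgB; first exact: cvg_cst.
  by rewrite (cvg_shiftn n0 (fun k => u_ (s k) x)); exact: cx.
exists u; last first.
  apply/cvLpP => e /cu[n0 hn0]; exists n0 => n n0n.
  by have [] := key e n0 hn0 n n0n.
have [n0 /key/(_ n0 (leqnn n0))[ui _]] := cu 1 ltr01.
have := LpB (Lu_ n0) (conj (measurable_funB (Lu_ n0).1 mu') ui).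
by under eq_fun do rewrite subKr.
Qed.

End Lp_theory.

End real_integral.

(** * Continuous functions with bounded support and Fubini *)

Section topology_rV.
Context {R : realType}.

Lemma cvg_rV (T : topologicalType) n (f : T -> 'rV[R]_n) x :
  (forall i, {for x, continuous (fun z => f z ord0 i)}) -> {for x, continuous f}.
Proof.
move=> cf; apply/cvg_ballP => e e0.
have h i : \forall z \near x, ball (f x ord0 i) e (f z ord0 i).
  by have := cf i => /cvg_ballP/(_ e e0).
have : \forall z \near x, forall i, ball (f x ord0 i) e (f z ord0 i).
  exact: filter_forall.
by apply: filterS => z hz; split => // i j; rewrite (ord1 i).
Qed.

Lemma rV_cons_eq n (t : R) (y : 'rV[R]_n) (v : 'rV[R]_n.+1) :
  v ord0 ord0 = t -> (forall j, v ord0 (lift ord0 j) = y ord0 j) -> rV_cons (t, y) = v.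
Proof.
move=> h1 h2; apply/rowP => i; have [j ->|->] := unliftP ord0 i.
  by have := rV_consS (t, y) j; rewrite /= -h2.
by have := rV_cons0 (t, y); rewrite /= -h1.
Qed.

Lemma rV_consD0 n (t h : R) (y : 'rV[R]_n) :
  rV_cons (h *: 1 + t, y) = h *: delta_mx ord0 ord0 + rV_cons (t, y).
Proof.
by apply: rV_cons_eq => [|j]; rewrite mxE ?rV_cons0 ?rV_consS !mxE eqxx//= mulr0 add0r.
Qed.

Lemma rV_consDS n (t h : R) (y : 'rV[R]_n) i :
  rV_cons (t, h *: delta_mx ord0 i + y) =
  h *: delta_mx ord0 (lift ord0 i) + rV_cons (t, y).
Proof.
apply: rV_cons_eq => [|j]; rewrite mxE ?rV_cons0 ?rV_consS !mxE /= ?mulr0 ?add0r//.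
Qed.

Lemma norm_coord n (y : 'rV[R]_n) i : `|y ord0 i| <= `|y|.
Proof.
rewrite [leRHS]mx_normrE.
by apply: (@le_bigmax_cond _ _ _ _ (ord0, i) xpredT (fun ij => `|y ij.1 ij.2|)).
Qed.

Lemma norm_rV_cons0 n (t : R) (y : 'rV[R]_n) : `|t| <= `|rV_cons (t, y)|.
Proof. by have := norm_coord (rV_cons (t, y)) ord0; rewrite rV_cons0. Qed.

Lemma norm_rV_le n (y : 'rV[R]_n) B : 0 <= B -> (forall i, `|y ord0 i| <= B) -> `|y| <= B.
Proof.
move=> B0 h; rewrite [leLHS]mx_normrE; apply: bigmax_le => // -[i j] _ /=.
by rewrite (ord1 i) h.
Qed.

Lemma norm_rV_consS n (t : R) (y : 'rV[R]_n) : `|y| <= `|rV_cons (t, y)|.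
Proof.
by apply: norm_rV_le => // i; rewrite -[y]/((t, y).2) -rV_consS norm_coord.
Qed.

Lemma continuous_rV_consl n (y : 'rV[R]_n) : continuous (fun t : R => rV_cons (t, y)).
Proof.
move=> t; apply: cvg_rV => i; have [j ->|->] := unliftP ord0 i.
  by under [X in {for _, continuous X}]eq_fun do rewrite rV_consS; exact: cvg_cst.
by under [X in {for _, continuous X}]eq_fun do rewrite rV_cons0; exact: cvg_id.
Qed.

Lemma continuous_rV_consr n (t : R) : continuous (fun y : 'rV[R]_n => rV_cons (t, y)).
Proof.
move=> y; apply: cvg_rV => i; have [j ->|->] := unliftP ord0 i.
  by under [X in {for _, continuous X}]eq_fun do rewrite rV_consS; exact: coord_continuous.
rewrite (_ : (fun z => rV_cons (t, z) ord0 ord0) = cst t); first exact: cst_continuous.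
by apply/funext => z; rewrite rV_cons0.
Qed.

Lemma measurable_box n (A : 'I_n -> set R) : (forall i, measurable (A i)) ->
  measurable [set v : 'rV[R]_n | forall i, A i (v ord0 i)].
Proof.
move=> mA; rewrite (_ : [set v | _] = \bigcap_(i in setT)
    ((fun v : 'rV[R]_n => v ord0 i) @^-1` A i)).
  apply: fin_bigcap_measurable => // i _.
  by rewrite -[X in measurable X]setTI; apply: measurable_coord.
by apply/seteqP; split => v /= Av i; [move=> _; exact: Av|exact: (Av i)].
Qed.

Lemma measurable_ball_rV n (x : 'rV[R]_n) e : measurable (ball x e).
Proof.
have [e0|e0] := ltP 0 e; last first.
  by rewrite (_ : ball x e = set0)//; apply/seteqP; split => // y [] /lt_geF; rewrite e0.
rewrite (_ : ball x e = [set v | forall i, (ball (x ord0 i) e) (v ord0 i)]).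
  apply: (@measurable_box n (fun i => ball (x ord0 i) e)) => i.
  exact: measurable_ball.
by apply/seteqP; split => [y [_ h] i|y h]; [exact: h|split=> // i j; rewrite (ord1 i)].
Qed.

(** The sigma-algebra of the coordinates contains the open sets: an open set is the
    union of the countably many rational boxes that it contains. *)
Lemma open_measurable_rV n (U : set 'rV[R]_n) : open U -> measurable U.
Proof.
move=> oU.
pose F (q : {ffun 'I_n -> rat} * nat) := let b :=
  ball (\row_i ratr (q.1 i) : 'rV[R]_n) q.2.+1%:R^-1 in if `[< b `<=` U >] then b else set0.
rewrite (_ : U = \bigcup_q F q).
  apply: countable_bigcupT_measurable; first exact: countableP.
  move=> q; rewrite /F; case: ifPn => // _.
  exact: measurable_ball_rV.
apply/seteqP; split => [x Ux|x [q _]]; last by rewrite /F; case: asboolP => // bU ?; exact: bU.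
have /nbhs_ballP[e /= e0 eU] : nbhs x U by exact: open_nbhs_nbhs.
have [k ke] : exists k : nat, k.+1%:R^-1 < e / 2.
  have e20 : 0 < e / 2 by rewrite divr_gt0.
  have [N _ hN] := @near_infty_natSinv_lt R (PosNum e20).
  by exists N; exact: (hN N (leqnn N)).
have k0 : 0 < k.+1%:R^-1 :> R by rewrite invr_gt0.
have /choice[q hq] i : exists q : rat, `|x ord0 i - ratr q| < k.+1%:R^-1.
  have /rat_in_itvoo[q] : x ord0 i - k.+1%:R^-1 < x ord0 i + k.+1%:R^-1.
    by rewrite ltrBlDr -addrA ltrDl addr_gt0.
  rewrite in_itv/= => /andP[h1 h2]; exists q.
  by rewrite ltr_distlC h1 h2.
exists ([ffun i => q i], k) => //; rewrite /F /= asboolT.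
  by split => // i j; rewrite (ord1 i) mxE ffunE /ball/= distrC.
move=> y [_ hy]; apply: eU; split => // i j; rewrite (ord1 i).
have := hy ord0 j; rewrite mxE ffunE /ball/= => h; have {}hq := hq j.
have : `|x ord0 j - y ord0 j| <= `|x ord0 j - ratr (q j)| + `|ratr (q j) - y ord0 j|.
  by rewrite -{1}(subrK (ratr (q j)) (x ord0 j)) -addrA ler_normD.
by move=> /le_lt_trans; apply; rewrite (lt_trans (ltrD hq h))// [ltRHS]splitr ltrD.
Qed.

Lemma continuous_measurable_rV n (f : 'rV[R]_n -> R) : continuous f ->
  measurable_fun setT f.
Proof.
move=> /continuousP cf; apply: (measurability _ (RGenOpens.measurableE R)).
move=> _ [_ [a [b ->] <-]]; rewrite setTI; apply: open_measurable_rV.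
exact/cf/interval_open.
Qed.

End topology_rV.

Section compact_support.
Context {R : realType}.
Local Notation leb := lebesgue_rV.

(** A common box for the supports lets all slices of a function share the same bound [B],
    which inductions on the dimension rely on. *)
Definition Cc n (B : R) (f : 'rV[R]_n -> R) :=
  continuous f /\ forall x, B <= `|x| -> f x = 0.

Lemma Cc_bounded n B (f : 'rV[R]_n -> R) : 0 < B -> Cc B f ->
  exists2 M, 0 <= M & forall x, `|f x| <= M.
Proof.
move=> B0 [cf f0]; pose K := [set x : 'rV[R]_n | `|x| <= B].
have cK : compact K.
  apply: bounded_closed_compact.
    by exists B; split; [exact: num_real|] => r Br x Kx; exact: le_trans Kx (ltW Br).
  rewrite (_ : K = (fun z => `|z|) @^-1` [set x | x <= B])//.
  by apply: closed_comp; [move=> z _; exact: norm_continuous|exact: closed_le].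
have K0 : K !=set0 by exists 0; rewrite /K/= normr0 ltW.
have cnf : continuous (fun x => `|f x|).
  by move=> x; apply: (continuous_comp (cf x)); exact: norm_continuous.
have [m _ hm] := compact_EVT_max K0 cK (continuous_subspaceT cnf).
exists `|f m| => // x; have [xB|Bx] := leP `|x| B; first by apply: hm; rewrite inE.
by rewrite f0 ?normr0// ltW.
Qed.

Lemma Cc_itg n B (f : 'rV[R]_n -> R) : 0 < B -> Cc B f ->
  (leb n).-integrable setT (EFin \o f).
Proof.
move=> B0 Cf; have [M M0 fM] := Cc_bounded B0 Cf; case: Cf => cf f0.
pose J := `[- B, B]%classic : set R.
have mJ : measurable J by exact: measurable_itv.
pose Q := [set v : 'rV[R]_n | forall i, J (v ord0 i)].
have mQ : measurable Q by exact: (@measurable_box _ n (fun=> J)).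
have mf := continuous_measurable_rV cf.
have -> : EFin \o f = (EFin \o f) \_ Q.
  apply/funext => x; rewrite patchE; case: ifPn => // /negP xQ /=.
  congr EFin; apply: f0; rewrite leNgt; apply/negP => xB; apply: xQ; rewrite inE => i /=.
  by rewrite /J/= in_itv/= -ler_norml (le_trans (norm_coord _ _))// ltW.
apply/(integrable_restrict _ mQ measurableT); rewrite setTI.
apply: measurable_bounded_integrable => //.
- have QE : leb n Q = (\prod_(i < n) lebesgue_measure J)%E.
    exact: (@lebesgue_rV_box R n (fun=> J)).
  have : (\prod_(i < n) lebesgue_measure J < +oo)%E.
    rewrite (eq_bigr (fun=> (B + B)%:E)); first by rewrite prodEFin ltry.
    by move=> i _; rewrite /J lebesgue_measure_itv/= lte_fin gtrN// -EFinB opprK.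
  by rewrite -QE.
- exact: measurable_funTS.
- by exists M; split; [exact: num_real|] => r Mr x _; exact: le_trans (fM x) (ltW Mr).
Qed.

Lemma continuous_itg (f : R -> R) (J : set R) : compact J -> continuous f ->
  lebesgue_measure.-integrable J (EFin \o f).
Proof.
move=> cJ cf; apply: continuous_compact_integrable => //.
exact: continuous_subspaceT.
Qed.

Lemma patch_itv (f : R -> R) B : (forall t, B <= `|t| -> f t = 0) ->
  f \_ `[- B, B] = f.
Proof.
move=> f0; apply/funext => t; rewrite patchE; case: ifPn => // /negP tB.
apply/esym/f0; rewrite leNgt; apply/negP => h; apply: tB; rewrite inE /=.
by rewrite in_itv/= -ler_norml ltW.
Qed.

Lemma continuous_itgT (f : R -> R) B : 0 < B -> continuous f ->
  (forall t, B <= `|t| -> f t = 0) -> lebesgue_measure.-integrable setT (EFin \o f).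
Proof.
move=> B0 cf f0; pose J := `[- B, B]%classic : set R.
have mJ : measurable J by exact: measurable_itv.
have -> : EFin \o f = (EFin \o f) \_ J.
  by rewrite restrict_EFin /J (patch_itv f0).
apply: (@integrable_mkcond _ _ _ lebesgue_measure J (EFin \o f) mJ).1.
by apply: continuous_itg => //; exact: segment_compact.
Qed.

Lemma continuous_RintT (f : R -> R) B : (forall t, B <= `|t| -> f t = 0) ->
  \int[lebesgue_measure]_t f t = \int[lebesgue_measure]_(t in `[- B, B]) f t.
Proof. by move=> f0; rewrite [RHS]Rintegral_mkcond (patch_itv f0). Qed.

Lemma Cc_consl n B (f : 'rV[R]_n.+1 -> R) y : Cc B f ->
  continuous (fun t => f (rV_cons (t, y))) /\ forall t, B <= `|t| -> f (rV_cons (t, y)) = 0.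
Proof.
move=> [cf f0]; split => [t|t Bt].
  by apply: continuous_comp; [exact: continuous_rV_consl|exact: cf].
by apply: f0; exact: le_trans Bt (norm_rV_cons0 _ _).
Qed.

Lemma Cc_consr n B (f : 'rV[R]_n.+1 -> R) t : Cc B f -> Cc B (fun y => f (rV_cons (t, y))).
Proof.
move=> [cf f0]; split => [y|y Bt].
  by apply: continuous_comp; [exact: continuous_rV_consr|exact: cf].
by apply: f0; exact: le_trans Bt (norm_rV_consS _ _).
Qed.

Lemma Cc_consr0 n B (f : 'rV[R]_n.+1 -> R) t y : Cc B f -> B <= `|t| ->
  f (rV_cons (t, y)) = 0.
Proof. by move=> [cf f0] Bt; apply: f0; exact: le_trans Bt (norm_rV_cons0 _ _). Qed.

Section fubini.
Variables (n : nat) (B : R) (f : 'rV[R]_n.+1 -> R).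
Hypotheses (B0 : 0 < B) (Cf : Cc B f).

Let fi := Cc_itg B0 Cf.
Let g (z : R * 'rV[R]_n) := f (rV_cons z).

(** [lebesgue_rV n.+1] is the image of the product measure under [rV_cons], so integrals
    over the space are integrals over the product and Fubini's theorem applies. *)
Lemma Cc_itg_prod : (lebesgue_measure \x leb n)%E.-integrable setT (EFin \o g).
Proof.
have mf := continuous_measurable_rV Cf.1.
apply/integrableP; split.
  by apply/measurable_EFinP; apply: (measurableT_comp mf); exact: measurable_rV_cons.
move/integrableP : fi => [_]; apply: le_lt_trans.
rewrite -[leRHS]/(\int[pushforward (lebesgue_measure \x leb n)%E (@rV_cons R n)]_x
  (abse \o (EFin \o f)) x)%E.
rewrite ge0_integral_pushforward//.
- exact: measurable_rV_cons.
- by apply: measurableT_comp => //; exact/measurable_EFinP.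
- by move=> y _; exact: abse_ge0.
Qed.

Lemma Cc_prod_Rintegral : \int[leb n.+1]_x f x =
  fine (\int[(lebesgue_measure \x leb n)%E]_z (g z)%:E).
Proof.
rewrite /Rintegral; congr fine.
rewrite -[LHS]/(\int[pushforward (lebesgue_measure \x leb n)%E (@rV_cons R n)]_x
  (EFin \o f) x)%E.
rewrite integral_pushforward//.
- exact: measurable_rV_cons.
- by apply/measurable_EFinP; exact: continuous_measurable_rV Cf.1.
- exact: Cc_itg_prod.
Qed.

Lemma Rint_cons : \int[leb n.+1]_x f x =
  \int[lebesgue_measure]_t \int[leb n]_y f (rV_cons (t, y)).
Proof.
rewrite Cc_prod_Rintegral /Rintegral -(integral12_prod_meas1 Cc_itg_prod).
congr fine; apply: eq_integral => t _; rewrite fineK//.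
by apply: integrable_fin_num => //; exact: Cc_itg B0 (Cc_consr t Cf).
Qed.

Lemma Rint_cons_swap : \int[leb n.+1]_x f x =
  \int[leb n]_y \int[lebesgue_measure]_t f (rV_cons (t, y)).
Proof.
rewrite Cc_prod_Rintegral /Rintegral -(integral21_prod_meas1 Cc_itg_prod).
congr fine; apply: eq_integral => y _; rewrite fineK//.
apply: integrable_fin_num => //; have [c1 c2] := Cc_consl y Cf.
exact: continuous_itgT c1 c2.
Qed.

Lemma Cc_itg_inner : lebesgue_measure.-integrable setT
  (fun t => (\int[leb n]_y f (rV_cons (t, y)))%:E).
Proof.
have := integrable_fubini_F Cc_itg_prod; apply: eq_integrable => // t _.
rewrite /fubini_F fineK//.
by apply: integrable_fin_num => //; exact: Cc_itg B0 (Cc_consr t Cf).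
Qed.

Lemma Cc_itg_outer (J : set R) : measurable J ->
  (leb n).-integrable setT (fun y => (\int[lebesgue_measure]_(t in J) f (rV_cons (t, y)))%:E).
Proof.
move=> mJ; pose h (z : R * 'rV[R]_n) := g z * \1_J z.1.
have hi : (lebesgue_measure \x leb n)%E.-integrable setT (EFin \o h).
  have := @itg_le _ _ _ (lebesgue_measure \x leb n)%E setT measurableT h (fun z => `|g z|).
  apply.
  - apply: measurable_funM; first exact: itg_meas Cc_itg_prod.
    by apply: measurableT_comp => //; exact: measurable_fst.
  - move=> z _; rewrite normrM ler_piMr// ger0_norm ?indicE//.
    by case: (_ \in _).
  - exact: integrable_norm Cc_itg_prod.
have hG : (leb n).-integrable setT (fubini_G lebesgue_measure (EFin \o h)).
  have mh := measurable_int _ hi; apply/integrableP; split; first exact: (measurable_fubini_G hi).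
  apply: le_lt_trans ((integrable21ltyP _ _ mh).1 hi); apply: ge0_le_integral => //.
  - by apply: measurableT_comp => //; exact: (measurable_fubini_G hi).
  - apply: (@measurable_fun_fubini_tonelli_G _ _ _ _ _ lebesgue_measure (abse \o (EFin \o h))) => //.
    exact: measurableT_comp.
  - by move=> z; exact: abse_ge0.
  - by move=> y _; apply: le_abse_integral => //; exact: (measurableT_comp mh).
move: hG; apply: eq_integrable => // y _.
rewrite /fubini_G /= /h /= /Rintegral.
have [c1 c2] := Cc_consl y Cf.
have fyi := continuous_itgT B0 c1 c2.
rewrite -[RHS]/((\int[lebesgue_measure]_(t in J) f (rV_cons (t, y)))%:E).
rewrite -(@itg_fin _ _ _ lebesgue_measure J mJ (fun t => f (rV_cons (t, y)))); last first.
  exact: integrableS fyi.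
rewrite [RHS]integral_mkcond; apply: eq_integral => t _.
by rewrite /g patchE /= indicE; case: (t \in J); rewrite ?mulr1 ?mulr0.
Qed.

End fubini.

End compact_support.

(** * One-dimensional estimates, integration by parts and the Poincare inequality *)

Section jensen.
Context d (T : measurableType d) (R : realType) (mu : {measure set T -> \bar R}).

(** Integrate the tangent line of [r `^ p] at the mean value of [f]. *)
Lemma jensen_powR (D : set T) (f : T -> R) (p m : R) : measurable D ->
  mu D = m%:E -> 0 < m -> 1 < p -> (forall x, D x -> 0 <= f x) ->
  mu.-integrable D (EFin \o f) -> mu.-integrable D (EFin \o (fun x => f x `^ p)) ->
  (\int[mu]_(x in D) f x) `^ p <= m `^ (p - 1) * \int[mu]_(x in D) f x `^ p.
Proof.
move=> mD muD m0 p1 f0 fi fpi; set A := \int[mu]_(x in D) f x.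
have A0 : 0 <= A by exact: Rintegral_ge0.
pose w := A / m; have w0 : 0 <= w by rewrite divr_ge0// ltW.
have ci k : mu.-integrable D (EFin \o cst k).
  apply: measurable_bounded_integrable => //; first by rewrite muD ltry.
  by exists `|k|; split; [exact: num_real|] => r kr x _ /=; exact: ltW.
have fw := itgB mD fi (ci w); have fw2 := itgZ mD (p * w `^ (p - 1)) fw.
have : m * w `^ p <= \int[mu]_(x in D) f x `^ p.
  have -> : m * w `^ p = \int[mu]_(x in D) (w `^ p + p * w `^ (p - 1) * (f x - w)).
    rewrite (RintegralD mD (ci _) fw2) (RintegralZl _ mD fw) (RintegralB mD fi (ci w)).
    rewrite !Rintegral_cst// -/A muD /= /w divfK ?gt_eqF//.
    by rewrite subrr mulr0 addr0 mulrC.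
  apply: le_Rintegral => //; first exact: (itgD mD (ci _) fw2).
  by move=> x Dx; apply: powR_tangent => //; exact: f0.
have -> : m * w `^ p = A `^ p / m `^ (p - 1).
  rewrite /w powRM ?invr_ge0 ?(ltW m0)// mulrCA; congr (_ * _).
  rewrite (powR_pow_pred p1) ?invr_ge0 ?(ltW m0)// mulrA divff ?gt_eqF// mul1r.
  rewrite -(powR_inv1 (ltW m0)) -powRrM mulN1r powRN.
  by [].
by rewrite ler_pdivrMr ?powR_gt0// mulrC.
Qed.

End jensen.

Section one_dimension.
Context {R : realType}.
Local Notation lm := (@lebesgue_measure R).
Implicit Types (f F g : R -> R) (a b p s t : R).

Lemma lm_segment a b : a <= b -> lm `[a, b]%classic = (b - a)%:E.
Proof.
rewrite le_eqVlt => /predU1P[->|ab]; first by rewrite set_itv1 lebesgue_measure_set1 subrr.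
by rewrite lebesgue_measure_itv/= lte_fin ab -EFinB.
Qed.

Lemma measurable_segment a b : measurable (`[a, b]%classic : set R).
Proof. exact: measurable_itv. Qed.

Lemma Rint_cst_segment a b (k : R) : a <= b -> \int[lm]_(t in `[a, b]) k = k * (b - a).
Proof.
move=> ab; rewrite Rintegral_cst; first exact: (congr1 (fun x => k * fine x) (lm_segment ab)).
exact: measurable_itv.
Qed.

Lemma itg_segment a b f : continuous f -> lm.-integrable `[a, b] (EFin \o f).
Proof. by move=> cf; apply: continuous_itg => //; exact: segment_compact. Qed.

Lemma continuous_abs_powR (T : topologicalType) (f : T -> R) p : 0 < p ->
  continuous f -> continuous (fun x => `|f x| `^ p).
Proof.
move=> p0 cf x; apply: (@continuous_comp _ _ _ f (fun r : R => `|r| `^ p)); first exact: cf.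
exact: continuous_normr_powR.
Qed.

Lemma continuous_normf (T : topologicalType) (f : T -> R) :
  continuous f -> continuous (fun x => `|f x|).
Proof. by move=> cf x; apply: (continuous_comp (cf x)); exact: norm_continuous. Qed.

Lemma ftc_eq f f' a b : (forall t, is_derive t 1 f (f' t)) -> continuous f' ->
  a < b -> \int[lm]_(t in `[a, b]) f' t = f b - f a.
Proof.
move=> df cf' ab.
have cf : continuous f.
  by move=> t; apply: differentiable_continuous; apply/derivable1_diffP.
rewrite /Rintegral (@continuous_FTC2 _ f' f a b)//.
- exact: continuous_subspaceT.
- split; first by move=> t _; have := df t.
  + by apply: cvg_at_right_filter; exact: cf.
  + by apply: cvg_at_left_filter; exact: cf.
- by move=> t _; rewrite derive1E; exact: derive_val.
Qed.

Lemma ftc_le f f' a b s t : (forall t, is_derive t 1 f (f' t)) -> continuous f' ->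
  a <= s <= b -> a <= t <= b -> `|f s - f t| <= \int[lm]_(r in `[a, b]) `|f' r|.
Proof.
move=> df cf'; wlog st : s t / s <= t.
  by move=> h sb tb; have [/h|/ltW/h] := leP s t; [|rewrite distrC]; apply.
move=> /andP[as_ sb] /andP[at_ tb].
have cn := continuous_normf cf'.
have h0 : 0 <= \int[lm]_(r in `[a, b]) `|f' r| by exact: Rintegral_ge0.
move: st; rewrite le_eqVlt => /predU1P[->|st]; first by rewrite subrr normr0.
rewrite distrC -(ftc_eq df cf' st).
have h1 := @le_normr_Rintegral _ _ _ lm _ f' (measurable_itv `[s, t]) (itg_segment s t cf').
apply: (le_trans h1).
rewrite -lee_fin -!itg_fin//; [|exact: itg_segment..].
apply: ge0_subset_integral => //.
  by apply/measurable_EFinP; apply: itg_meas; exact: itg_segment.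
by move=> r /=; rewrite !in_itv/= => /andP[sr rt]; rewrite (le_trans as_ sr) (le_trans rt tb).
Qed.

(** Jensen's inequality applied to the length bound of the fundamental theorem of calculus. *)
Lemma ftc_powR_le f f' a b s t p : 1 < p -> (forall t, is_derive t 1 f (f' t)) ->
  continuous f' -> a < b -> a <= s <= b -> a <= t <= b ->
  `|f s - f t| `^ p <= (b - a) `^ (p - 1) * \int[lm]_(r in `[a, b]) `|f' r| `^ p.
Proof.
move=> p1 df cf' ab sab tab; have p0 : 0 < p by rewrite (lt_trans _ p1).
apply: (@le_trans _ _ ((\int[lm]_(r in `[a, b]) `|f' r|) `^ p)).
  by apply: ler_powR2 (ftc_le df cf' sab tab); rewrite ?(ltW p0).
apply: jensen_powR => //; rewrite ?subr_gt0//.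
- by apply: lm_segment; exact: ltW.
- by apply: itg_segment; exact: continuous_normf.
- by apply: itg_segment; exact: continuous_abs_powR.
Qed.

(** The mean of [F] lies between its extreme values, so [F t] differs from it by at most
    [M `^ p^-1]. *)
Lemma oscillation_le F a b M p : 1 < p -> a < b -> continuous F ->
  (forall s t, a <= s <= b -> a <= t <= b -> `|F s - F t| `^ p <= M) ->
  \int[lm]_(t in `[a, b]) `|F t| `^ p <= 2 `^ p *
  ((b - a) * M + (b - a) `^ (1 - p) * `|\int[lm]_(t in `[a, b]) F t| `^ p).
Proof.
move=> p1 ab cF osc; have p0 : 0 < p by rewrite (lt_trans _ p1).
have ba0 : 0 < b - a by rewrite subr_gt0.
have mab : measurable (`[a, b]%classic : set R) by exact: measurable_itv.
have ci k : lm.-integrable `[a, b] (EFin \o cst k).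
  by apply: itg_segment; exact: cst_continuous.
have [s1 s1ab hs1] := @EVT_min R F a b (ltW ab) (continuous_subspaceT cF).
have [s2 s2ab hs2] := @EVT_max R F a b (ltW ab) (continuous_subspaceT cF).
set A := \int[lm]_(t in `[a, b]) F t; pose w := A / (b - a).
have fm k : fine (lm `[a, b]%classic) * k = (b - a) * k by rewrite (lm_segment (ltW ab)).
have w1 : F s1 <= w.
  rewrite /w ler_pdivlMr// mulrC -fm mulrC -Rintegral_cst//; apply: le_Rintegral => //; first exact: ci.
  exact: itg_segment.
have w2 : w <= F s2.
  rewrite /w ler_pdivrMr// mulrC -fm mulrC -Rintegral_cst//; apply: le_Rintegral => //; first exact: itg_segment.
  exact: ci.
have dev t : a <= t <= b -> `|F t - w| `^ p <= M.
  move=> tab; have [wt|tw] := leP w (F t).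
    apply: le_trans (osc t s1 tab _); last by move: s1ab; rewrite in_itv.
    by rewrite ler_powR2 ?(ltW p0)// !ger0_norm ?subr_ge0//; [lra|exact: le_trans wt].
  apply: le_trans (osc t s2 tab _); last by move: s2ab; rewrite in_itv.
  rewrite ler_powR2 ?(ltW p0)// ![`|F t - _|]distrC !ger0_norm ?subr_ge0//; [lra| |exact: ltW].
  by rewrite (le_trans (ltW tw)).
apply: (@le_trans _ _ (\int[lm]_(t in `[a, b]) (2 `^ p * (M + `|w| `^ p)))).
  apply: le_Rintegral => //; first by apply: itg_segment; exact: continuous_abs_powR.
    exact: ci.
  move=> t /=; rewrite in_itv/= => tab.
  rewrite -{1}(subrK w (F t)) (le_trans (powR_add_le _ _ p1))//.
  by rewrite ler_wpM2l ?powR_ge0// lerD2r dev.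
rewrite Rint_cst_segment ?(ltW ab)// -mulrA ler_wpM2l ?powR_ge0//.
rewrite mulrDl lerD ?[M * _]mulrC// /w normrM normfV (gtr0_norm ba0).
rewrite powRM ?invr_ge0 ?(ltW ba0)// -mulrA mulrC ler_wpM2r ?powR_ge0//.
rewrite -(powR_inv1 (ltW ba0)) -powRrM mulN1r -{2}(powRr1 (ltW ba0)) -powRD.
  by rewrite [- p + 1]addrC.
by rewrite (gt_eqF ba0) implybT.
Qed.

Lemma Rint_segment_split g a b e : a <= b <= e -> continuous g ->
  \int[lm]_(t in `[a, e]) g t =
  \int[lm]_(t in `[a, b]) g t + \int[lm]_(t in `[b, e]) g t.
Proof.
move=> /andP[ab be] cg.
have := @Rintegral_itvB R g (BLeft a) (BRight e) b (itg_segment _ _ cg).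
rewrite !bnd_simp => /(_ ab be); rewrite (Rintegral_itv_obnd_cbnd (r := b)).
  by move=> <-; rewrite addrC subrK.
apply: integrableS (itg_segment b e cg) => //.
by apply: subset_itvr; rewrite bnd_simp.
Qed.

Lemma Rint_subdivision g a (dl : R) m : 0 <= dl -> continuous g ->
  \int[lm]_(t in `[a, a + m%:R * dl]) g t =
  \sum_(k < m) \int[lm]_(t in `[a + k%:R * dl, a + k.+1%:R * dl]) g t.
Proof.
move=> dl0 cg; elim: m => [|m IH].
  by rewrite big_ord0 mul0r addr0 set_itv1 Rintegral_set1.
rewrite big_ord_recr /= -IH -Rint_segment_split//.
by rewrite lerDl mulr_ge0//= lerD2l ler_wpM2r// ler_nat.
Qed.

End one_dimension.

Section C1_functions.
Context {R : realType}.
Local Notation leb := lebesgue_rV.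
Local Notation lm := (@lebesgue_measure R).

Definition C1c n (B : R) (f : 'rV[R]_n -> R) :=
  Cc B f /\ forall i, (forall x, derivable f x (delta_mx ord0 i)) /\ Cc B (partial i f).

Lemma Cc_abs_powR n B (f : 'rV[R]_n -> R) p : 0 < p -> Cc B f ->
  Cc B (fun x => `|f x| `^ p).
Proof.
move=> p0 [cf f0]; split; first exact: continuous_abs_powR.
by move=> x /f0 ->; rewrite normr0 powR0 ?gt_eqF.
Qed.

Lemma CcB n B (f g : 'rV[R]_n -> R) : Cc B f -> Cc B g -> Cc B (fun x => f x - g x).
Proof.
move=> [cf f0] [cg g0]; split.
  by move=> x; exact: (cvgB (cf x) (cg x)).
by move=> x Bx; rewrite f0// g0// subrr.
Qed.

Lemma C1cB n B (f g : 'rV[R]_n -> R) : C1c B f -> C1c B g ->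
  C1c B (fun x => f x - g x).
Proof.
move=> [Cf df] [Cg dg]; split; first exact: CcB.
move=> i; have [dfi Cfi] := df i; have [dgi Cgi] := dg i; split.
  by move=> x; exact: derivableB.
rewrite (_ : partial i _ = fun x => partial i f x - partial i g x); first exact: CcB.
by apply/funext => x; exact: deriveB.
Qed.

Lemma partial_slice n (f : 'rV[R]_n.+1 -> R) t i :
  partial i (fun y => f (rV_cons (t, y))) =
  fun y => partial (lift ord0 i) f (rV_cons (t, y)).
Proof.
apply/funext => y; rewrite /partial /derive.
suff -> : (fun h : R => h^-1 *: (f (rV_cons (t, h *: delta_mx ord0 i + y)) - f (rV_cons (t, y)))) =
  (fun h => h^-1 *: (f (h *: delta_mx ord0 (lift ord0 i) + rV_cons (t, y)) - f (rV_cons (t, y)))).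
  by [].
by apply/funext => h; rewrite rV_consDS.
Qed.

Lemma derivable_slice n (f : 'rV[R]_n.+1 -> R) t i y :
  derivable f (rV_cons (t, y)) (delta_mx ord0 (lift ord0 i)) ->
  derivable (fun y => f (rV_cons (t, y))) y (delta_mx ord0 i).
Proof.
rewrite /derivable.
suff -> : (fun h : R => h^-1 *: (f (rV_cons (t, h *: delta_mx ord0 i + y)) - f (rV_cons (t, y)))) =
  (fun h => h^-1 *: (f (h *: delta_mx ord0 (lift ord0 i) + rV_cons (t, y)) - f (rV_cons (t, y)))).
  by [].
by apply/funext => h; rewrite rV_consDS.
Qed.

Lemma C1c_slice n B (f : 'rV[R]_n.+1 -> R) t : C1c B f ->
  C1c B (fun y => f (rV_cons (t, y))).
Proof.
move=> [Cf df]; split; first exact: Cc_consr.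
move=> i; have [dfi Cfi] := df (lift ord0 i); split.
  by move=> y; apply: derivable_slice; exact: dfi.
by rewrite partial_slice; exact: (Cc_consr t Cfi).
Qed.

Lemma is_derive_slice0 n B (f : 'rV[R]_n.+1 -> R) (y : 'rV[R]_n) : C1c B f ->
  forall t : R, is_derive t 1 (fun t : R => f (rV_cons (t, y))) (partial ord0 f (rV_cons (t, y))).
Proof.
move=> [_ df] t; have [dfi _] := df ord0.
have E : (fun h : R => h^-1 *: (f (rV_cons (h *: 1 + t, y)) - f (rV_cons (t, y)))) =
  (fun h : R => h^-1 *: (f (h *: delta_mx ord0 ord0 + rV_cons (t, y)) - f (rV_cons (t, y)))).
  by apply/funext => h; rewrite rV_consD0.
split; first by rewrite /derivable E; exact: dfi.
by rewrite /partial /derive E.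
Qed.

(** By Fubini: for the first coordinate the inner integral is that of a derivative of a
    compactly supported function, for the others it is handled by induction on slices. *)
Theorem Rint_partial_eq0 n B (f : 'rV[R]_n -> R) i : 0 < B -> C1c B f ->
  \int[leb n]_x partial i f x = 0.
Proof.
move=> B0; elim: n f i => [|n IH] f i Cf; first by case: i.
have [_ Ci] := Cf.2 i; have [j iE|iE] := unliftP ord0 i.
  rewrite (Rint_cons B0 Ci) (_ : (fun t => _) = cst 0).
    by rewrite Rintegral_cst// mul0r.
  apply/funext => t; rewrite iE.
  by have := IH _ j (C1c_slice t Cf); rewrite partial_slice.
rewrite iE in Ci *; rewrite (Rint_cons_swap B0 Ci) (_ : (fun t => _) = cst 0).
  by rewrite Rintegral_cst// mul0r.
apply/funext => y; have [c1 c2] := Cc_consl y Ci.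
rewrite (continuous_RintT c2) (@ftc_eq _ (fun t => f (rV_cons (t, y))) _ _ _ (is_derive_slice0 y Cf))//.
- by rewrite !(Cc_consr0 _ Cf.1) ?subrr// ?normrN ler_norm.
- by rewrite gtrN.
Qed.

(** Each slice in the first direction vanishes at [-B], so its values are bounded by the
    integral of its derivative over a segment of length [B + B]. *)
Theorem poincare_C1c n B (f : 'rV[R]_n.+1 -> R) p : 1 < p -> 0 < B -> C1c B f ->
  \int[leb n.+1]_x `|f x| `^ p <=
  (B + B) `^ p * \int[leb n.+1]_x `|partial ord0 f x| `^ p.
Proof.
move=> p1 B0 Cf; have p0 : 0 < p by rewrite (lt_trans _ p1).
have [_ Ci] := Cf.2 ord0.
have Cp := Cc_abs_powR p0 Cf.1; have Cip := Cc_abs_powR p0 Ci.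
rewrite (Rint_cons_swap B0 Cp) (Rint_cons_swap B0 Cip).
have oi := Cc_itg_outer B0 Cip (@measurableT _ R).
have oi' := Cc_itg_outer B0 Cp (@measurableT _ R).
have mT : measurable [set: 'rV[R]_n] by exact: measurableT.
rewrite -(RintegralZl _ mT oi); apply: (le_Rintegral mT oi' (itgZ mT _ oi)).
move=> y _; have [c1 c2] := Cc_consl y Cip; have [c1' c2'] := Cc_consl y Cp.
rewrite (continuous_RintT c2) (continuous_RintT c2').
set E := \int[_]_(t in _) `|partial _ _ _| `^ p.
have [d1 d2] := Cc_consl y Ci.
have h t : -B <= t <= B -> `|f (rV_cons (t, y))| `^ p <= (B + B) `^ (p - 1) * E.
  move=> tB; rewrite -[f _]subr0 -(Cc_consr0 (t := B) y Cf.1) ?ler_norm//.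
  have := @ftc_powR_le R (fun t => f (rV_cons (t, y))) _ (- B) B t B p p1
    (is_derive_slice0 y Cf) d1.
  rewrite opprK; apply => //; first by rewrite gtrN.
  by rewrite lexx andbT (le_trans _ (ltW B0))// oppr_le0 ltW.
apply: (@le_trans _ _ (\int[lm]_(t in `[- B, B]) ((B + B) `^ (p - 1) * E))).
  apply: le_Rintegral => //; first exact: itg_segment.
  by apply: itg_segment; exact: cst_continuous.
rewrite Rint_cst_segment; last by rewrite ge0_cp// ltW.
rewrite opprK mulrAC (powR_pow_pred p1) ?addr_ge0 ?(ltW B0)//.
by rewrite [_ `^ _ * (B + B)]mulrC.
Qed.

End C1_functions.

(** * An Ehrling inequality *)

Lemma Int_le_lincomb d (T : measurableType d) (R : realType)
    (mu : {measure set T -> \bar R}) (D : set T) (I J : finType)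
    (A : T -> R) (G : I -> T -> R) (L : J -> T -> R) (e C : R) : measurable D ->
  mu.-integrable D (EFin \o A) -> (forall i, mu.-integrable D (EFin \o G i)) ->
  (forall j, mu.-integrable D (EFin \o L j)) ->
  (forall t, D t -> A t <= e * (\sum_i G i t) + C * (\sum_j L j t)) ->
  \int[mu]_(t in D) A t <= e * (\sum_i \int[mu]_(t in D) G i t) +
    C * (\sum_j \int[mu]_(t in D) L j t).
Proof.
move=> mD iA iG iL AGL.
have iSG := itg_sum mD (index_enum I) (fun i (_ : true) => iG i).
have iSL := itg_sum mD (index_enum J) (fun i (_ : true) => iL i).
have eG := itgZ mD e iSG; have CL := itgZ mD C iSL.
rewrite -(Int_sum mD _ (fun i (_ : true) => iG i)) -(Int_sum mD _ (fun i (_ : true) => iL i)).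
rewrite -(RintegralZl _ mD iSG) -(RintegralZl _ mD iSL) -(RintegralD mD eG CL).
exact: (le_Rintegral mD iA (itgD mD eG CL)).
Qed.

Section ehrling.
Context {R : realType}.
Local Notation leb := lebesgue_rV.
Local Notation lm := (@lebesgue_measure R).
Variable p : R.
Hypothesis p1 : 1 < p.

Let p0 : 0 < p. Proof. by rewrite (lt_trans _ p1). Qed.

(** The functionals [l i] are bounded for the L^p norm, so this inequality makes the
    embedding of W^{1,p} into L^p compact: on a bounded sequence it is enough to
    extract a subsequence along which the finitely many [l i] converge. *)
Definition ehrling n (B : R) := forall e : R, 0 < e ->
  exists (I : finType) (l : I -> ('rV[R]_n -> R) -> R) (K C : R),
  [/\ 0 <= K, 0 <= C,
      forall i f g, C1c B f -> C1c B g -> l i (fun x => f x - g x) = l i f - l i g,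
      forall i f, C1c B f -> `|l i f| `^ p <= K * \int[leb n]_x `|f x| `^ p
    & forall f, C1c B f -> \int[leb n]_x `|f x| `^ p <=
        e * \sum_i \int[leb n]_x `|partial i f x| `^ p + C * \sum_i `|l i f| `^ p].

Section slices.
Variables (n : nat) (B : R).
Hypothesis B0 : 0 < B.

Definition strip_energy (f : 'rV[R]_n.+1 -> R) a b :=
  \int[leb n]_y \int[lm]_(t in `[a, b]) `|partial ord0 f (rV_cons (t, y))| `^ p.

Lemma slice_diff_le f a b s t : C1c B f -> a < b -> a <= s <= b -> a <= t <= b ->
  \int[leb n]_y `|f (rV_cons (s, y)) - f (rV_cons (t, y))| `^ p <=
  (b - a) `^ (p - 1) * strip_energy f a b.
Proof.
move=> Cf ab sab tab; have [_ Ci] := Cf.2 ord0.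
have oi := Cc_itg_outer B0 (Cc_abs_powR p0 Ci) (measurable_itv `[a, b]).
have mT : measurable [set: 'rV[R]_n] by exact: measurableT.
rewrite /strip_energy -(RintegralZl _ mT oi).
apply: (le_Rintegral mT _ (itgZ mT _ oi)).
  exact: Cc_itg B0 (Cc_abs_powR p0 (CcB (Cc_consr s Cf.1) (Cc_consr t Cf.1))).
move=> y _; have [d1 d2] := Cc_consl y Ci.
exact: (ftc_powR_le p1 (is_derive_slice0 y Cf) d1).
Qed.

Lemma strip_energy_sum f m : C1c B f -> (0 < m)%N ->
  \sum_(k < m) strip_energy f (- B + k%:R * ((B + B) / m%:R)) (- B + k.+1%:R * ((B + B) / m%:R)) =
  \int[leb n.+1]_x `|partial ord0 f x| `^ p.
Proof.
move=> Cf m0; have [_ Ci] := Cf.2 ord0; have Cip := Cc_abs_powR p0 Ci.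
have mT : measurable [set: 'rV[R]_n] by exact: measurableT.
rewrite (Rint_cons_swap B0 Cip) -(Int_sum mT); last first.
  by move=> k _; exact: (Cc_itg_outer B0 Cip (@measurable_segment _ _ _)).
apply: eq_Rintegral => y _; have [c1 c2] := Cc_consl y Cip.
have dl0 : 0 <= (B + B) / m%:R by rewrite divr_ge0// addr_ge0// ltW.
have := @Rint_subdivision R _ (- B) _ m dl0 c1.
have -> : - B + m%:R * ((B + B) / m%:R) = B by rewrite mulrC divfK ?addKr// pnatr_eq0 -lt0n.
by rewrite (continuous_RintT c2) => ->.
Qed.

Variables (l : ('rV[R]_n -> R) -> R) (K : R).
Hypothesis K0 : 0 <= K.
Hypothesis lB : forall f g, C1c B f -> C1c B g -> l (fun x => f x - g x) = l f - l g.
Hypothesis lK : forall f, C1c B f -> `|l f| `^ p <= K * \int[leb n]_x `|f x| `^ p.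

Let F (f : 'rV[R]_n.+1 -> R) t := l (fun y => f (rV_cons (t, y))).

(** A bounded functional of the slice [f (t, .)] moves little on a short strip of [t], in
    terms of the derivative in the first direction alone. *)
Lemma slice_osc f a b s t : C1c B f -> a < b -> a <= s <= b -> a <= t <= b ->
  `|F f s - F f t| `^ p <= K * ((b - a) `^ (p - 1) * strip_energy f a b).
Proof.
move=> Cf ab sab tab; rewrite /F -lB; [|exact: C1c_slice..].
rewrite (le_trans (lK _)) ?ler_wpM2l//; last exact: slice_diff_le.
by apply: C1cB; exact: C1c_slice.
Qed.

Lemma slice_continuous f : C1c B f -> continuous (F f).
Proof.
move=> Cf t; have [_ Ci] := Cf.2 ord0; have Cip := Cc_abs_powR p0 Ci.
pose E := strip_energy f (t - 1) (t + 1); pose D := \int[leb n.+1]_x `|partial ord0 f x| `^ p.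
have ED a b : strip_energy f a b <= D.
  rewrite /D (Rint_cons_swap B0 Cip).
  apply: (le_Rintegral measurableT (Cc_itg_outer B0 Cip (@measurable_segment _ _ _))
    (Cc_itg_outer B0 Cip (@measurableT _ R))) => y _.
  have [c1 c2] := Cc_consl y Cip.
  have iy := continuous_itgT B0 c1 c2.
  rewrite -lee_fin -(@itg_fin _ _ _ lm _ (measurable_itv _) _ (itg_segment a b c1)).
  rewrite -(@itg_fin _ _ _ lm _ measurableT _ iy).
  by apply: ge0_subset_integral => //; exact: measurable_int iy.
have D0 : 0 <= D by apply: Rintegral_ge0 => x _; exact: powR_ge0.
have key s : `|F f t - F f s| `^ p <= K * D * `|t - s| `^ (p - 1).
  have [->|st] := eqVneq s t.
    by rewrite subrr normr0 powR0 ?gt_eqF// mulr_ge0 ?powR_ge0// mulr_ge0.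
  have [ab sab tab eab] : [/\ Num.min s t < Num.max s t,
     Num.min s t <= s <= Num.max s t, Num.min s t <= t <= Num.max s t &
     Num.max s t - Num.min s t = `|t - s|].
    move: st; rewrite neq_lt => /orP[st|st].
      by rewrite (min_idPl (ltW st)) (max_idPr (ltW st)) st !lexx (ltW st) gtr0_norm ?subr_gt0.
    by rewrite (min_idPr (ltW st)) (max_idPl (ltW st)) st !lexx (ltW st) ltr0_norm ?subr_lt0// opprB.
  apply: (le_trans (slice_osc Cf ab tab sab)); rewrite eab -mulrA ler_wpM2l// mulrC.
  by rewrite ler_wpM2r ?powR_ge0.
apply/cvgrPdist_lt => e e0.
have c0 : (fun s => K * D * `|t - s| `^ (p - 1)) @ t --> (0 : R).
  have c1 : (fun s => K * D * `|t - s| `^ (p - 1)) @ t --> K * D * `|t - t| `^ (p - 1).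
    apply: cvgMr; apply: (@continuous_comp _ _ _ (fun s => t - s) (fun r : R => `|r| `^ (p - 1))).
      by apply: cvgB; [exact: cvg_cst|exact: cvg_id].
    by apply: continuous_normr_powR; rewrite subr_gt0.
  by move: c1; rewrite subrr normr0 powR0 ?gt_eqF ?subr_gt0// mulr0.
have ep : 0 < e `^ p by exact: powR_gt0.
move/cvgrPdist_lt : c0 => /(_ _ ep); apply: filterS => s.
rewrite sub0r normrN ger0_norm; last by rewrite mulr_ge0 ?powR_ge0// mulr_ge0.
move=> h; rewrite ltNge; apply/negP => eF.
have := le_lt_trans (key s) h; rewrite ltNge => /negP; apply.
by rewrite ler_powR2 ?(ltW p0)// ltW.
Qed.

Lemma slice_supp f t : C1c B f -> B <= `|t| -> F f t = 0.
Proof.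
move=> Cf Bt; have := lK (C1c_slice t Cf).
under eq_Rintegral do rewrite (Cc_consr0 _ Cf.1 Bt) normr0 powR0 ?gt_eqF//.
rewrite Rintegral_cst// mul0r mulr0 => h; apply/eqP; rewrite -normr_eq0.
have : `|F f t| `^ p == 0 by rewrite eq_le h powR_ge0.
by rewrite powR_eq0 => /andP[].
Qed.

Lemma slice_lp_le f a b : C1c B f -> a <= b ->
  \int[lm]_(t in `[a, b]) `|F f t| `^ p <= K * \int[leb n.+1]_x `|f x| `^ p.
Proof.
move=> Cf ab; have Cp := Cc_abs_powR p0 Cf.1.
have ii := Cc_itg_inner B0 Cp; have iK := itgZ measurableT K ii.
rewrite (Rint_cons B0 Cp) -(RintegralZl _ measurableT ii).
have cF := continuous_abs_powR p0 (slice_continuous Cf).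
apply: (@le_trans _ _ (\int[lm]_(t in `[a, b]) (K * \int[leb n]_y `|f (rV_cons (t, y))| `^ p))).
  apply: le_Rintegral => //; first exact: itg_segment.
    by apply: integrableS iK.
  by move=> t _; exact: lK (C1c_slice t Cf).
rewrite -lee_fin -(@itg_fin _ _ _ lm _ (measurable_itv `[a, b])); last exact: integrableS iK.
rewrite -(@itg_fin _ _ _ lm _ measurableT _ iK); apply: ge0_subset_integral => //.
  exact: measurable_int iK.
by move=> t _; rewrite lee_fin mulr_ge0// Rintegral_ge0// => y _; exact: powR_ge0.
Qed.

Lemma slice_mean_le f a b : C1c B f -> a < b ->
  `|\int[lm]_(t in `[a, b]) F f t| `^ p <=
  (b - a) `^ (p - 1) * K * \int[leb n.+1]_x `|f x| `^ p.
Proof.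
move=> Cf ab; have cF := slice_continuous Cf.
have cnF := continuous_normf cF; have cpF := continuous_abs_powR p0 cF.
have h1 := @le_normr_Rintegral _ _ _ lm _ (F f) (measurable_itv `[a, b]) (itg_segment a b cF).
apply: le_trans (ler_powR2 (ltW p0) _ h1) _ => //.
have ba0 : 0 < b - a by rewrite subr_gt0.
have := @jensen_powR _ _ _ lm `[a, b]%classic (fun t => `|F f t|) p (b - a)
  (measurable_itv _) (lm_segment (ltW ab)) ba0 p1 (fun _ _ => normr_ge0 _)
  (itg_segment a b cnF) (itg_segment a b cpF).
move=> /le_trans; apply; rewrite -mulrA ler_wpM2l ?powR_ge0//.
by apply: slice_lp_le => //; exact: ltW.
Qed.

(** On each of [m] strips, replace the functional of the slice by its mean over the strip;
    the error carries the factor [dl `^ p] and is absorbed by the derivative when [m] is large. *)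
Lemma slice_subdivision_le f m (dl : R) : C1c B f -> (0 < m)%N -> dl = (B + B) / m%:R ->
  \int[lm]_t `|F f t| `^ p <= 2 `^ p * (K * dl `^ p * \int[leb n.+1]_x `|partial ord0 f x| `^ p
   + dl `^ (1 - p) * \sum_(k < m)
     `|\int[lm]_(t in `[- B + k%:R * dl, - B + k.+1%:R * dl]) F f t| `^ p).
Proof.
move=> Cf m0 dlE; have dl0 : 0 < dl by rewrite dlE divr_gt0 ?addr_gt0 ?ltr0n.
have cF := slice_continuous Cf; have cpF := continuous_abs_powR p0 cF.
rewrite (@continuous_RintT _ _ B); last first.
  by move=> t /(slice_supp Cf) ->; rewrite normr0 powR0 ?gt_eqF.
rewrite -[X in `[- B, X]](_ : - B + m%:R * dl = B); last first.
  by rewrite dlE mulrC divfK ?addKr// pnatr_eq0 -lt0n.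
rewrite Rint_subdivision ?(ltW dl0)// -(strip_energy_sum Cf m0) -dlE.
rewrite !mulr_sumr -big_split/= mulr_sumr; apply: ler_sum => k _.
set a := - B + k%:R * dl; set b := - B + _.
have ba : b - a = dl by rewrite /a /b -natr1 mulrDl mul1r; ring.
have ab : a < b by rewrite -subr_gt0 ba.
have := @oscillation_le R (F f) a b _ p p1 ab cF (fun s t sab tab => slice_osc Cf ab sab tab).
move=> /le_trans; apply; rewrite ba ler_wpM2l ?powR_ge0// lerD2r.
rewrite (powR_pow_pred p1 (ltW dl0)); apply: eq_ler; ring.
Qed.

End slices.

(** Induction on the dimension. Slices satisfy the inequality with functionals [l i], and
    integrating it over the first coordinate leaves [\int |l i (f (t, .))|^p dt]; this is
    controlled by the finitely many means of [l i (f (t, .))] over short strips, which are the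
    functionals in the next dimension. In dimension zero the functional is evaluation. *)
Theorem ehrling_C1c n B : 0 < B -> ehrling n B.
Proof.
move=> B0; elim: n => [|n IH] e e0.
  exists unit, (fun _ f => f 0), 1, 1.
  have i0 (f : 'rV[R]_0 -> R) : C1c B f -> \int[leb 0]_x `|f x| `^ p = `|f 0| `^ p.
    move=> Cf; rewrite /Rintegral integral_dirac//.
      by rewrite diracE in_setT mul1e.
    apply/measurable_EFinP; apply: continuous_measurable_rV.
    exact: (Cc_abs_powR p0 Cf.1).1.
  split => // [_ f Cf|f Cf]; first by rewrite i0// mul1r.
  by rewrite i0// big_ord0 mulr0 add0r mul1r big_const card_unit /= addr0.
have [I [l [K [C [K0 C0 lB lK lE]]]]] := IH e e0.
pose A := C * #|I|%:R * (2 `^ p * K).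
have A0 : 0 <= A by rewrite !mulr_ge0 ?powR_ge0.
have BB : 0 < B + B by rewrite addr_gt0.
(* strips so thin that their total error is at most [e] times the energy of the first derivative *)
have [m [m0 mA]] : exists m, (0 < m)%N /\ A * ((B + B) / m%:R) `^ p <= e.
  pose r := Num.min 1 (e / (A + 1)).
  have r0 : 0 < r by rewrite lt_min ltr01 divr_gt0// ltr_wpDl.
  have [m hm] : exists m : nat, (B + B) / r < m%:R.
    by exists (Num.bound ((B + B) / r)); rewrite archi_boundP// divr_ge0// ltW.
  have m0 : 0 < m%:R :> R by rewrite (le_lt_trans _ hm)// divr_ge0// ltW.
  have dr : (B + B) / m%:R <= r by rewrite ler_pdivrMr// mulrC -ler_pdivrMr// ltW.
  exists m; split; first by rewrite ltr0n in m0.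
  have d0 : 0 < (B + B) / m%:R by rewrite divr_gt0.
  have d1 : ((B + B) / m%:R) `^ p <= e / (A + 1).
    rewrite (le_trans (ge1r_powR _ (ltW p1)))//.
      by rewrite d0 (le_trans dr)// ge_min lexx.
    by rewrite (le_trans dr)// ge_min lexx orbT.
  rewrite (le_trans (ler_wpM2l A0 d1))// mulrCA ler_piMr ?(ltW e0)//.
  by rewrite ler_pdivrMr ?ltr_wpDl// mul1r lerDl.
pose dl := (B + B) / m%:R; have dl0 : 0 < dl by rewrite divr_gt0// ltr0n.
pose a (k : 'I_m) := - B + k%:R * dl; pose b (k : 'I_m) := - B + k.+1%:R * dl.
have ba k : b k - a k = dl by rewrite /a /b -natr1 mulrDl mul1r; ring.
have ab k : a k < b k by rewrite -subr_gt0 ba.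
exists ('I_m * I)%type, (fun ki f => \int[lm]_(t in `[a ki.1, b ki.1])
  l ki.2 (fun y => f (rV_cons (t, y)))), (dl `^ (p - 1) * K), (C * (2 `^ p * dl `^ (1 - p))).
have cont i f : C1c B f -> continuous (fun t => l i (fun y => f (rV_cons (t, y)))).
  by move=> Cf; exact: (slice_continuous B0 K0 (lB i) (lK i) Cf).
split.
- by rewrite mulr_ge0 ?powR_ge0.
- by rewrite !mulr_ge0 ?powR_ge0.
- move=> [k i] f g Cf Cg /=; rewrite -RintegralB//; last 2 first.
  + by apply: itg_segment; exact: cont.
  + by apply: itg_segment; exact: cont.
  by apply: eq_Rintegral => t _; rewrite lB//; exact: C1c_slice.
- move=> [k i] f Cf /=; rewrite -(ba k).
  exact: (slice_mean_le B0 K0 (lB i) (lK i) Cf (ab k)).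
move=> f Cf; have Cp := Cc_abs_powR p0 Cf.1.
have Cip i := Cc_abs_powR p0 (Cf.2 i).2.
have ii := Cc_itg_inner B0 Cp; have iip i := Cc_itg_inner B0 (Cip i).
have iF i : lm.-integrable setT (EFin \o (fun t => `|l i (fun y => f (rV_cons (t, y)))| `^ p)).
  apply: (@continuous_itgT _ _ B) => //; first exact: continuous_abs_powR (cont _ _ Cf).
  by move=> t /(slice_supp (lK i) Cf) ->; rewrite normr0 powR0 ?gt_eqF.
have ineq t : \int[leb n]_y `|f (rV_cons (t, y))| `^ p <=
    e * (\sum_(j < n) \int[leb n]_y `|partial (lift ord0 j) f (rV_cons (t, y))| `^ p) +
    C * (\sum_i `|l i (fun y => f (rV_cons (t, y)))| `^ p).
  have h := lE _ (C1c_slice t Cf).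
  have E (j : 'I_n) : \int[leb n]_y `|partial j (fun y => f (rV_cons (t, y))) y| `^ p =
      \int[leb n]_y `|partial (lift ord0 j) f (rV_cons (t, y))| `^ p.
    by rewrite partial_slice.
  have ES : \sum_(j < n) \int[leb n]_y `|partial j (fun y => f (rV_cons (t, y))) y| `^ p =
      \sum_(j < n) \int[leb n]_y `|partial (lift ord0 j) f (rV_cons (t, y))| `^ p.
    exact: (eq_bigr _ (fun j _ => E j)).
  apply: (le_trans h).
  apply: lerD; last exact: lexx.
  apply: ler_wpM2l; first exact: ltW.
  by apply: eq_ler; exact: ES.
have := Int_le_lincomb measurableT ii (fun j => iip (lift ord0 j)) iF (fun t _ => ineq t).
rewrite -(Rint_cons B0 Cp) => /le_trans; apply.
have RC j : \int[lm]_t \int[leb n]_y `|partial (lift ord0 j) f (rV_cons (t, y))| `^ p =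
    \int[leb n.+1]_x `|partial (lift ord0 j) f x| `^ p.
  by rewrite (Rint_cons B0 (Cip (lift ord0 j))).
rewrite (eq_bigr _ (fun j _ => RC j)) big_ord_recl.
rewrite mulrDr [e * _ + e * _]addrC -addrA lerD2l.
set G := \int[_]_x `|partial ord0 f x| `^ p.
have G0 : 0 <= G by apply: Rintegral_ge0 => x _; exact: powR_ge0.
pose h (k : 'I_m) i := `|\int[lm]_(t in `[a k, b k]) l i (fun y => f (rV_cons (t, y)))| `^ p.
apply: (@le_trans _ _ (C * \sum_i (2 `^ p * (K * dl `^ p * G + dl `^ (1 - p) * \sum_k h k i)))).
  rewrite ler_wpM2l//; apply: ler_sum => i _.
  exact: (slice_subdivision_le B0 K0 (lB i) (lK i) Cf m0 erefl).
rewrite -mulr_sumr big_split/= -[X in _ + X]mulr_sumr exchange_big pair_bigA/=.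
have -> : \sum_(i : I) K * dl `^ p * G = K * dl `^ p * G * #|I|%:R.
  by rewrite sumr_const mulr_natr.
set H := \sum_(ki : _ * _) _.
have -> : C * (2 `^ p * (K * dl `^ p * G * #|I|%:R + dl `^ (1 - p) * H)) =
  A * dl `^ p * G + C * (2 `^ p * dl `^ (1 - p)) * H by rewrite /A; ring.
by rewrite lerD2r ler_wpM2r.
Qed.

End ehrling.

(** * Finite measure, restrictions and calculus of C^k functions *)

Section L1_bounds.
Context d (T : measurableType d) (R : realType) (mu : {measure set T -> \bar R}).
Variables (D : set T) (mD : measurable D) (p : R).
Hypotheses (Dfin : (mu D < +oo)%E) (p1 : 1 < p).
Local Notation itg f := (mu.-integrable D (EFin \o f)).
Local Notation Int f := (\int[mu]_(x in D) f x).

Lemma itg_bounded (f : T -> R) M : measurable_fun D f -> (forall x, D x -> `|f x| <= M) ->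
  itg f.
Proof.
move=> mf fM; apply: measurable_bounded_integrable => //.
by exists M; split; [exact: num_real|] => r Mr x Dx; exact: le_trans (fM x Dx) (ltW Mr).
Qed.

Lemma itg_cst (k : R) : itg (fun=> k).
Proof. by apply: (@itg_bounded _ `|k|). Qed.

(** Distinguish [|t| <= e] from [e < |t|], where [(|t| / e) `^ (p - 1) >= 1]. *)
Lemma normr_le_powR (e t : R) : 0 < e -> `|t| <= e + e `^ (1 - p) * `|t| `^ p.
Proof.
move=> e0; have [te|et] := leP `|t| e.
  by rewrite (le_trans te)// lerDl mulr_ge0 ?powR_ge0.
have t0 : 0 < `|t| by rewrite (lt_trans e0).
rewrite -[leLHS]add0r lerD ?(ltW e0)// (powR_pow_pred p1)// mulrCA ler_peMr//.
rewrite -opprB powRN mulrC ler_pdivlMr ?powR_gt0// mul1r.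
by rewrite ler_powR2 ?(ltW e0) ?(ltW et)// subr_ge0 ltW.
Qed.

Lemma Lp_itg f : Lp mu D p f -> itg f.
Proof.
move=> [mf fi]; apply: itg_le (itgD mD (itg_cst 1) fi) => // x Dx.
by rewrite (le_trans (normr_le_powR _ ltr01))// powR1 mul1r.
Qed.

Lemma Lp_bounded (f : T -> R) M : measurable_fun D f -> (forall x, D x -> `|f x| <= M) -> Lp mu D p f.
Proof.
move=> mf fM; split => //; apply: (@itg_bounded _ (`|M| `^ p)).
  exact: measurable_normr_powR.
move=> x Dx; rewrite ger0_norm ?powR_ge0// ler_powR2 ?(ltW (lt_trans ltr01 p1))//.
by rewrite (le_trans (fM x Dx))// ler_norm.
Qed.

Lemma cvLp_L1 (u_ : nat -> T -> R) u : (forall n, Lp mu D p (u_ n)) -> Lp mu D p u ->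
  cvLp mu D p u_ u -> (fun n => Int (fun x => `|u_ n x - u x|)) @ \oo --> (0 : R).
Proof.
move=> Lu_ Lu cu; apply/cvgrPdist_le => e e0.
have Dm : 0 <= fine (mu D) by rewrite fine_ge0.
pose d' := e / (2 * (fine (mu D) + 1)).
have d0 : 0 < d' by rewrite divr_gt0// mulr_gt0// ltr_wpDl.
have k0 : 0 < d' `^ (1 - p) by exact: powR_gt0.
have /cvLpP/(_ (e / (2 * d' `^ (1 - p))))[|N hN] := cu; first by rewrite divr_gt0// mulr_gt0.
exists N => // n /= Nn; rewrite sub0r normrN ger0_norm; last exact: Rintegral_ge0.
have Ld := LpB mD p1 (Lu_ n) Lu.
have iD := itgZ mD (d' `^ (1 - p)) Ld.2.
apply: (@le_trans _ _ (Int (fun x => d' + d' `^ (1 - p) * `|u_ n x - u x| `^ p))).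
  apply: le_Rintegral => //; [exact: itg_norm (Lp_itg Ld)|exact: itgD (itg_cst d') iD|].
  by move=> x _; exact: normr_le_powR.
rewrite (RintegralD mD (itg_cst d') iD) Rintegral_cst// (RintegralZl _ mD Ld.2).
rewrite [leRHS]splitr lerD//.
  rewrite /d' mulrAC ler_pdivrMr ?mulr_gt0 ?ltr_wpDl//.
  rewrite (_ : e / 2 * _ = e * (fine (mu D) + 1)); first by rewrite ler_pM2l// lerDl.
  by rewrite mulrA divfK.
have := hN n Nn; rewrite -(ler_pM2l k0) => /le_trans; apply.
move: (_ `^ _) k0 => k k0; apply: eq_ler; field.
by rewrite gt_eqF.
Qed.

(** Boundedness of the multiplier lets weak identities pass to strong limits. *)
Lemma cvLp_Int_mul (u_ : nat -> T -> R) u (w : T -> R) M :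
  (forall n, Lp mu D p (u_ n)) -> Lp mu D p u -> cvLp mu D p u_ u ->
  measurable_fun D w -> (forall x, D x -> `|w x| <= M) ->
  (fun n => Int (fun x => u_ n x * w x)) @ \oo --> Int (fun x => u x * w x).
Proof.
move=> Lu_ Lu cu mw wM.
have M0 : 0 <= `|M| by [].
have imul f : itg f -> itg (fun x => f x * w x).
  move=> fi; apply: itg_le (itgZ mD `|M| (itg_norm fi)) => //.
    by apply: measurable_funM => //; exact: itg_meas fi.
  by move=> x Dx; rewrite normrM mulrC ler_wpM2r// (le_trans (wM x Dx))// ler_norm.
have iu n := imul _ (Lp_itg (Lu_ n)); have iu' := imul _ (Lp_itg Lu).
have iB n : itg (fun x => u_ n x - u x) := Lp_itg (LpB mD p1 (Lu_ n) Lu).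
apply/subr_cvg0/norm_cvg0P.
apply: (@squeeze0 _ _ (fun n => `|M| * Int (fun x => `|u_ n x - u x|))) => [n|].
  rewrite normr_ge0/= -(RintegralB mD (iu n) iu').
  rewrite (le_trans (le_normr_Rintegral mD (itgB mD (iu n) iu')))//.
  rewrite -(RintegralZl _ mD (itg_norm (iB n))); apply: le_Rintegral => //.
  - exact: itg_norm (itgB mD (iu n) iu').
  - exact: itgZ (itg_norm (iB n)).
  - move=> x Dx; rewrite -mulrBl normrM mulrC ler_wpM2r//.
    by rewrite (le_trans (wM x Dx))// ler_norm.
by apply: cvgZ0; exact: cvLp_L1.
Qed.

End L1_bounds.

Section restriction.
Context d (T : measurableType d) (R : realType) (mu : {measure set T -> \bar R}).
Variables (D : set T) (mD : measurable D).

(** Functions on a set are treated through integrals over that set; the equivalences of this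
    section translate membership and convergence for the functions extended by zero. *)
Lemma LfunP_p (p : R) (u : T -> R) : 0 < p ->
  ((u \_ D) \in Lfun mu p%:E) <-> Lp mu D p u.
Proof.
move=> p0; have pn0 : p != 0 by rewrite gt_eqF.
have IE : (\int[mu]_x `|(EFin \o (u \_ D)) x| `^ p)%E =
    (\int[mu]_(x in D) `|(`|u x| `^ p)%:E|)%E.
  rewrite [RHS]integral_mkcond; apply: eq_integral => x _; rewrite /= !patchE.
  have -> : (point : R) = 0 by [].
  have -> : (point : \bar R) = 0%E by [].
  by case: ifPn => _ /=; rewrite ?normr0 ?powR0// [in RHS]ger0_norm ?powR_ge0.
split.
  move=> /andP[mu' fu]; have mu1 := set_mem mu'.
  have mu2 : measurable_fun D u by apply/(measurable_restrictT _ mD).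
  split => //; apply/integrableP; split.
    by apply/measurable_EFinP; exact: measurable_normr_powR.
  have : (Lnorm mu p%:E (EFin \o (u \_ D)) < +oo)%E by exact: (set_mem fu).
  rewrite -IE => h; have := poweR_lty p h; by rewrite poweR_Lnorm.
move=> [mu1 iu]; apply/andP; split.
  by apply/mem_set; exact/(measurable_restrictT _ mD).
apply/mem_set; rewrite /= /finite_norm unlock; apply: poweR_lty.
by rewrite IE; case/integrableP: iu.
Qed.

Lemma cvLp_dist (p : R) (u_ : nat -> T -> R) u : 1 < p -> (forall n, Lp mu D p (u_ n)) ->
  Lp mu D p u ->
  ((fun n => Lnorm mu p%:E (EFin \o ((u_ n \- u) \_ D))) @ \oo --> 0%E) <->
  cvLp mu D p u_ u.
Proof.
move=> p1 Lu_ Lu; have p0 : 0 < p by rewrite (lt_trans _ p1).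
have NE n : Lnorm mu p%:E (EFin \o ((u_ n \- u) \_ D)) =
    ((\int[mu]_(x in D) `|u_ n x - u x| `^ p) `^ p^-1)%:E.
  rewrite unlock -poweR_EFin; congr (_ `^ _)%E.
  rewrite -(itg_fin mD (LpB mD p1 (Lu_ n) Lu).2).
  rewrite [RHS]integral_mkcond; apply: eq_integral => x _; rewrite /= !patchE.
  have -> : (point : R) = 0 by [].
  have -> : (point : \bar R) = 0%E by [].
  by case: ifPn => _; rewrite ?normr0 ?powR0 ?gt_eqF.
rewrite (_ : (fun n => _) = (fun n => ((\int[mu]_(x in D) `|u_ n x - u x| `^ p) `^ p^-1)%:E)).
  have pi0 : 0 < p^-1 by rewrite invr_gt0.
  split=> [/fine_cvg h|h].
    have := cvg_normr_powR0 p0 h.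
    by under eq_fun do rewrite /= ger0_norm ?powR_ge0// -powRrM mulVf ?gt_eqF// powRr1 ?Np_ge0//.
  apply: cvg_EFin; first exact: nearW.
  have := cvg_normr_powR0 pi0 h.
  by under eq_fun do rewrite ger0_norm ?Np_ge0//.
by apply/funext => n; rewrite NE.
Qed.

Lemma LfunP_oo (u : T -> R) : ((u \_ D) \in Lfun mu +oo%E) <->
  measurable_fun D u /\ exists M, {ae mu, forall x, D x -> `|u x| <= M}.
Proof.
split.
  move=> /andP[mu' fu]; have mu2 : measurable_fun D u.
    by apply/(measurable_restrictT _ mD); exact: set_mem mu'.
  split => //.
  have : (Lnorm mu +oo (EFin \o (u \_ D)) < +oo)%E by exact: (set_mem fu).
  rewrite unlock; case: ifPn => [_|mu0 _]; last first.
    exists 0; have m0 : mu setT = 0%E by apply/eqP; rewrite eq_le measure_ge0 andbT leNgt.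
    by exists setT; split => //; exact: measurableT.
  have h := ess_sup_ge mu (abse \o (EFin \o (u \_ D))).
  set S := ess_sup _ _ in h *; move=> Soo; exists (fine S).
  apply: filterS h => x /= h Dx; rewrite patchE mem_set// in h.
  have S0 : (0 <= S)%E by exact: le_trans h.
  by rewrite -lee_fin fineK// ge0_fin_numE.
move=> [mu1 [M hM]]; apply/andP; split.
  by apply/mem_set; exact/(measurable_restrictT _ mD).
apply/mem_set; rewrite /= /finite_norm unlock; case: ifPn => // _.
apply: (@le_lt_trans _ _ (`|M|)%:E); last exact: ltry.
apply/ess_supP; apply: filterS hM => x h /=; rewrite patchE lee_fin.
by case: ifPn => [/set_mem Dx|_]; [rewrite (le_trans (h Dx))// ler_norm|rewrite normr0].
Qed.

End restriction.

Section Ck_calculus.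
Context {R : realType} {n : nat}.
Implicit Types (f g : 'rV[R]_n -> R).

Lemma Ck_continuous k f : Ck k f -> continuous f.
Proof. by case: k => [//|k []]. Qed.

Lemma Ck_pred k f : Ck k.+1 f -> Ck k f.
Proof.
elim: k f => [|k IH] f [cf df]; first by [].
by split => // i; have [dfi Cfi] := df i; split => //; exact: IH.
Qed.

Lemma Ck_cst k (a : R) : Ck k (fun _ : 'rV[R]_n => a).
Proof.
elim: k a => [|k IH] a; first exact: cst_continuous.
split => [|i]; first exact: cst_continuous.
split; first by move=> x; exact: derivable_cst.
rewrite (_ : partial i _ = fun=> 0) //.
by apply/funext => x; exact: derive_cst.
Qed.

Lemma CkD k f g : Ck k f -> Ck k g -> Ck k (fun x => f x + g x).
Proof.
elim: k f g => [|k IH] f g.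
  by move=> cf cg x; exact: (cvgD (cf x) (cg x)).
move=> [cf df] [cg dg]; split; first by move=> x; exact: (cvgD (cf x) (cg x)).
move=> i; have [dfi Cfi] := df i; have [dgi Cgi] := dg i.
split; first by move=> x; exact: derivableD.
rewrite (_ : partial i _ = fun x => partial i f x + partial i g x); first exact: IH.
by apply/funext => x; exact: deriveD.
Qed.

Lemma CkM k f g : Ck k f -> Ck k g -> Ck k (fun x => f x * g x).
Proof.
elim: k f g => [|k IH] f g.
  by move=> cf cg x; exact: (cvgM (cf x) (cg x)).
move=> Cf Cg; have [cf df] := Cf; have [cg dg] := Cg.
split; first by move=> x; exact: (cvgM (cf x) (cg x)).
move=> i; have [dfi Cfi] := df i; have [dgi Cgi] := dg i.
split; first by move=> x; exact: derivableM.
rewrite (_ : partial i _ = fun x => f x * partial i g x + g x * partial i f x).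
  by apply: CkD; apply: IH => //; exact: Ck_pred.
by apply/funext => x; rewrite /partial (deriveM (dfi x) (dgi x)).
Qed.

(** Partial derivatives are derivatives of slices, so differentiability of [f] along the
    single direction [v] is enough. *)
Lemma derive_comp_real f (G : R -> R) x v (a : R) : derivable f x v ->
  is_derive (f x) 1 G a ->
  derivable (fun y => G (f y)) x v /\ 'D_v (fun y => G (f y)) x = a * 'D_v f x.
Proof.
move=> df dG; pose h (t : R) := f (t *: v + x).
have h0 : h 0 = f x by rewrite /h scale0r add0r.
have dh : is_derive (0 : R) 1 h ('D_v f x).
  have dh : derivable h 0 1 := (derivable1P f x v).1 df.
  split => //; rewrite /derive.
  suff -> : (fun t : R => t^-1 *: (h (t *: 1 + 0) - h 0)) =
    (fun t => t^-1 *: (f (t *: v + x) - f x)) by [].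
  by apply/funext => t; rewrite addr0 [t *: 1]mulr1 h0.
rewrite -h0 in dG; have [dGh DGh] := is_derive1_comp dG dh.
split; first exact: (derivable1P _ _ _).2 dGh.
rewrite -DGh /derive.
suff -> : (fun t : R => t^-1 *: ((G \o h) (t *: 1 + 0) - (G \o h) 0)) =
  (fun t => t^-1 *: (G (f (t *: v + x)) - G (f x))) by [].
by apply/funext => t /=; rewrite addr0 [t *: 1]mulr1 h0.
Qed.

(** All real exponents are treated at once: the derivative of [f `^ a] involves
    [f `^ (a - 1)]. *)
Lemma Ck_powR k (a : R) f : (forall x, 0 < f x) -> Ck k f -> Ck k (fun x => f x `^ a).
Proof.
move=> f0; elim: k a f f0 => [|k IH] a f f0 Cf.
  move=> x; apply: (@continuous_comp _ _ _ f (@powR R ^~ a)); first exact: Cf.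
  apply: differentiable_continuous; apply/derivable1_diffP.
  by apply: derivable_powR; rewrite in_itv/= f0.
have [cf df] := Cf; have dp x := is_derive1_powR a (f0 x).
split.
  move=> x; apply: (@continuous_comp _ _ _ f (@powR R ^~ a)); first exact: cf.
  apply: differentiable_continuous; apply/derivable1_diffP.
  by apply: derivable_powR; rewrite in_itv/= f0.
move=> i; have [dfi Cfi] := df i.
have dG x := derive_comp_real (dfi x) (dp x).
split; first by move=> x; exact: (dG x).1.
rewrite (_ : partial i _ = fun x => (a * f x `^ (a - 1)) * partial i f x).
  by apply: CkM => //; apply: CkM; [exact: Ck_cst|apply: IH => //; exact: Ck_pred].
by apply/funext => x; exact: (dG x).2.
Qed.

End Ck_calculus.

(** * Test functions *)

Section one_variable.
Context {R : realType}.
Implicit Types (G : R -> R) (a b t s e : R).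

Lemma is_derive_continuous G t (d : R) : is_derive t 1 G d -> {for t, continuous G}.
Proof.
by move=> [dG _]; apply: differentiable_continuous; exact/derivable1_diffP.
Qed.

Lemma lipschitz_derive G (G' : R -> R) a b C :
  (forall t, a <= t <= b -> is_derive t 1 G (G' t)) ->
  (forall t, a <= t <= b -> `|G' t| <= C) ->
  forall s t, a <= s <= b -> a <= t <= b -> `|G s - G t| <= C * `|s - t|.
Proof.
move=> dG G'C.
have main s t : s <= t -> a <= s <= b -> a <= t <= b -> `|G s - G t| <= C * `|s - t|.
  move=> st /andP[as_ sb] /andP[at_ tb].
  have inab r : r \in `[s, t] -> a <= r <= b.
    by rewrite in_itv/= => /andP[sr rt]; rewrite (le_trans as_ sr) (le_trans rt tb).
  have [||c ct E] := @MVT_segment _ G G' _ _ st.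
  - by move=> r rst; apply: dG; apply: inab; exact: subset_itv_oo_cc.
  - apply: continuous_in_subspaceT => r /set_mem rst.
    by apply: is_derive_continuous (dG r _); exact: inab.
  - by rewrite distrC E normrM [`|t - s|]distrC ler_wpM2r// G'C// inab.
move=> s t sab tab; have [st|/ltW ts] := leP s t; first exact: main.
by rewrite distrC [`|s - t|]distrC main.
Qed.

Lemma cvg_eq_ler (f : nat -> R) (l : R) (r : nat -> R) :
  (forall k, `|f k - l| <= r k) -> r @ \oo --> (0 : R) -> f @ \oo --> l.
Proof.
move=> fr r0; apply/subr_cvg0/norm_cvg0P; apply: squeeze0 r0 => k.
by rewrite normr_ge0/=.
Qed.

(** As [e] decreases to zero this smooth function tends to [`|t - a|], with slopes at most one
    in absolute value. *)
Definition sabs a e t : R := ((t - a) ^+ 2 + e ^+ 2) `^ 2^-1.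
Definition dsabs a e t : R := (t - a) * ((t - a) ^+ 2 + e ^+ 2) `^ (- 2^-1).

Lemma sabs_arg_gt0 a e t : 0 < e -> 0 < (t - a) ^+ 2 + e ^+ 2.
Proof. by move=> e0; rewrite ltr_wpDl ?sqr_ge0// exprn_gt0. Qed.

(** The exponent is free, since [sabs] and its derivative are powers of the same quantity. *)
Lemma is_derive_sabs_powR q a e t : 0 < e ->
  is_derive t 1 (fun t : R => ((t - a) ^+ 2 + e ^+ 2) `^ q)
    (q * ((t - a) ^+ 2 + e ^+ 2) `^ (q - 1) * (2 * (t - a))).
Proof.
move=> e0; pose A (t : R) := (t - a) ^+ 2 + e ^+ 2.
have A0 : 0 < A t by exact: sabs_arg_gt0.
have d1 : is_derive t (1 : R) A (2 * (t - a)).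
  by apply: is_derive_eq; rewrite /GRing.scale /=; ring.
have := @is_derive1_comp _ _ _ _ _ _ (is_derive1_powR q A0) d1.
by rewrite /comp /A => h; apply: is_derive_eq.
Qed.

Lemma is_derive_sabs a e t : 0 < e -> is_derive t 1 (sabs a e) (dsabs a e t).
Proof.
move=> e0; have h := is_derive_sabs_powR 2^-1 a t e0.
apply: is_derive_eq; rewrite /dsabs.
have -> : 2^-1 - 1 = - 2^-1 :> R by field.
by move: (_ `^ _) => y; field.
Qed.

Lemma sabs_sqrt a e t : sabs a e t = Num.sqrt ((t - a) ^+ 2 + e ^+ 2).
Proof. by rewrite /sabs powR12_sqrt// addr_ge0 ?sqr_ge0. Qed.

Lemma norm_le_sabs a e t : `|t - a| <= sabs a e t.
Proof. by rewrite sabs_sqrt -sqrtr_sqr ler_wsqrtr// lerDl sqr_ge0. Qed.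

Lemma sabs_le_norm a e t : 0 <= e -> sabs a e t <= `|t - a| + e.
Proof.
move=> e0; rewrite sabs_sqrt -(@ger0_norm _ (`|t - a| + e)) ?addr_ge0// -sqrtr_sqr.
by rewrite ler_wsqrtr// [leRHS]sqrrD -normrX ger0_norm ?sqr_ge0// lerD2r lerDl mulrn_wge0// mulr_ge0.
Qed.

Lemma dsabs_le1 a e t : 0 < e -> `|dsabs a e t| <= 1.
Proof.
move=> e0; have A0 := sabs_arg_gt0 a t e0.
rewrite /dsabs powRN normrM normfV [X in _ / X]ger0_norm ?powR_ge0//.
by rewrite ler_pdivrMr ?powR_gt0// mul1r norm_le_sabs.
Qed.

Lemma sabs_lip a e s t : 0 < e -> `|sabs a e s - sabs a e t| <= `|s - t|.
Proof.
move=> e0; rewrite -[leRHS]mul1r.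
apply: (@lipschitz_derive _ (dsabs a e) (Num.min s t) (Num.max s t)).
- by move=> r _; exact: is_derive_sabs.
- by move=> r _; exact: dsabs_le1.
- by rewrite ge_min le_max !lexx.
- by rewrite ge_min le_max !lexx !orbT.
Qed.

Lemma continuous_dsabs a e : 0 < e -> continuous (dsabs a e).
Proof.
move=> e0 t; have dA := is_derive_sabs_powR (- 2^-1) a t e0.
apply: cvgM; last exact: is_derive_continuous dA.
by apply: cvgB; [exact: cvg_id|exact: cvg_cst].
Qed.

Lemma cvg_sabs a t : sabs a k.+1%:R^-1 t @[k --> \oo] --> `|t - a|.
Proof.
apply: (@cvg_eq_ler _ _ (fun k : nat => k.+1%:R^-1)); last exact: cvg_harmonic.
move=> k; have k0 : 0 <= (k.+1%:R^-1 : R) by [].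
rewrite ger0_norm ?subr_ge0 ?norm_le_sabs// lerBlDl.
exact: sabs_le_norm.
Qed.

Lemma cvg_dsabs a t : dsabs a k.+1%:R^-1 t @[k --> \oo] --> Num.sg (t - a).
Proof.
have [E|ta] := eqVneq (t - a) 0.
  rewrite E sgr0 (_ : (fun k => _) = fun=> 0); first exact: cvg_cst.
  by apply/funext => k; rewrite /dsabs E mul0r.
have n0 : 0 < `|t - a| by rewrite normr_gt0.
rewrite [X in _ --> X](_ : _ = (t - a) * `|t - a|^-1); last first.
  by rewrite {2}[t - a]numEsg mulfK// gt_eqF.
rewrite (_ : (fun k => _) = fun k : nat => (t - a) * (sabs a k.+1%:R^-1 t)^-1).
  apply: cvgMr; apply: cvgV; first by rewrite gt_eqF.
  exact: cvg_sabs.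
by apply/funext => k; rewrite /dsabs powRN.
Qed.

End one_variable.

Section test_functions.
Context {R : realType} {n : nat}.
Variable Omega : set 'rV[R]_n.
Implicit Types (f g : 'rV[R]_n -> R).

Definition supp f := closure [set x | f x != 0].

Lemma notin_supp f x : ~ supp f x -> f x = 0.
Proof.
by move=> xs; apply: contrapT => fx; apply: xs; apply: subset_closure; exact/eqP.
Qed.

Lemma partial_notin_supp f x i : ~ supp f x -> partial i f x = 0.
Proof.
move=> xs; have fn : \forall y \near x, f y = (fun=> 0 : R) y.
  have : open (~` supp f) by apply: closed_openC; exact: closed_closure.
  rewrite openE => /(_ x xs); rewrite /interior; apply: filterS => y; exact: notin_supp.
by rewrite /partial (near_eq_derive _ fn) derive_cst.
Qed.

Lemma test_functionP K f : compact K -> K `<=` Omega -> smooth f ->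
  (forall x, ~ K x -> f x = 0) -> test_function Omega f.
Proof.
move=> cK KO sf fK.
have sub : supp f `<=` K.
  have /closure_id -> : closed K by exact: compact_closed cK.
  apply: closure_subset => x /= fx; apply: contrapT => /fK f0.
  by rewrite f0 eqxx in fx.
split => //; last exact: subset_trans KO.
exact: subclosed_compact (@closed_closure _ _) cK sub.
Qed.

Lemma test_function_comp f (G : R -> R) : test_function Omega f -> G 0 = 0 ->
  smooth (fun x => G (f x)) -> test_function Omega (fun x => G (f x)).
Proof.
move=> [sf cf fO] G0 sG; apply: (test_functionP cf fO sG) => x xs.
by rewrite (notin_supp xs).
Qed.

Lemma smoothZ k f : smooth f -> smooth (fun x => k * f x).
Proof. by move=> sf j; apply: CkM => //; exact: Ck_cst. Qed.

Lemma test_functionZ k f : test_function Omega f ->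
  test_function Omega (fun x => k * f x).
Proof.
move=> tf; apply: (@test_function_comp _ ( *%R k)) => //; first exact: mulr0.
by case: tf => sf _ _; exact: smoothZ.
Qed.

Lemma test_functionD f g : test_function Omega f -> test_function Omega g ->
  test_function Omega (fun x => f x + g x).
Proof.
move=> [sf cf fO] [sg cg gO].
apply: (@test_functionP (supp f `|` supp g)).
- exact: compactU.
- by rewrite subUset.
- by move=> k; exact: CkD.
- by move=> x /not_orP[xf xg]; rewrite !notin_supp ?addr0.
Qed.

Lemma test_function0 : test_function Omega (fun=> 0).
Proof.
apply: (@test_functionP set0) => //; first exact: compact0.
by move=> k; exact: Ck_cst.
Qed.

Lemma test_derivable f x i : test_function Omega f -> derivable f x (delta_mx ord0 i).
Proof. by case=> /(_ 1%N)[_ /(_ i)[]]. Qed.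

Lemma partial_test_continuous f i : test_function Omega f -> continuous (partial i f).
Proof. by case=> /(_ 1%N)[_ /(_ i)[]]. Qed.

Lemma test_continuous f : test_function Omega f -> continuous f.
Proof. by case=> /(_ 0%N). Qed.

Hypotheses (oO : open Omega) (bO : bounded_set Omega).

Lemma bounded_domain : exists2 B : R, 0 < B & forall x, Omega x -> `|x| < B.
Proof.
have [M [_ hM]] := bO; exists (`|M| + 2); first by rewrite ltr_wpDl.
move=> x Ox; apply: (@le_lt_trans _ _ (`|M| + 1)); last by rewrite ltrD2l ltr1n.
by apply: hM => //; rewrite (le_lt_trans (ler_norm M))// ltrDl.
Qed.

Lemma measure_domain_lty : (lebesgue_rV n Omega < +oo)%E.
Proof.
have [B B0 OB] := bounded_domain.
pose J := `[- B, B]%classic : set R.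
have mJ : measurable J by exact: measurable_itv.
pose Q := [set v : 'rV[R]_n | forall i, J (v ord0 i)].
have mQ : measurable Q by exact: (@measurable_box _ n (fun=> J)).
apply: (@le_lt_trans _ _ (lebesgue_rV n Q)).
  apply: le_measure; rewrite ?inE//; first exact: open_measurable_rV.
  move=> x Ox i; rewrite /J/= in_itv/= -ler_norml.
  by rewrite (le_trans (norm_coord _ _))// ltW// OB.
have -> : lebesgue_rV n Q = (\prod_(i < n) lebesgue_measure J)%E.
  exact: (@lebesgue_rV_box R n (fun=> J)).
rewrite (eq_bigr (fun=> (B + B)%:E)); first by rewrite prodEFin ltry.
by move=> i _; rewrite /J lebesgue_measure_itv/= lte_fin gtrN// -EFinB opprK.
Qed.

(** The supports lie in a bounded set, so one box serves all test functions. *)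
Lemma test_C1c : exists2 B : R, 0 < B & forall f, test_function Omega f -> C1c B f.
Proof.
have [B B0 OB] := bounded_domain; exists B => // f tf.
have [sf cf fO] := tf; have far x : B <= `|x| -> ~ supp f x.
  by move=> Bx /fO /OB; rewrite ltNge Bx.
split.
  by split; [exact: test_continuous tf|move=> x /far; exact: notin_supp].
move=> i; split; first by move=> x; exact: test_derivable tf.
split; first exact: partial_test_continuous tf.
by move=> x /far; exact: partial_notin_supp.
Qed.

End test_functions.

(** * The space W_0^{1,p} *)

Section sobolev_space.
Context {R : realType} {n : nat}.
Variables (Omega : set 'rV[R]_n) (p : R).
Hypotheses (oO : open Omega) (bO : bounded_set Omega) (p1 : 1 < p).
Local Notation leb := (lebesgue_rV n).
Local Notation mO := (open_measurable_rV oO).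
Local Notation Lpo := (Lp leb Omega p).
Local Notation cv := (cvLp leb Omega p).
Local Notation W := (W01p Omega p).
Implicit Types (u v f : 'rV[R]_n -> R) (g : 'rV[R]_n -> 'rV[R]_n).

Lemma Rintegral_zero_outside f : (forall x, ~ Omega x -> f x = 0) ->
  \int[leb]_(x in Omega) f x = \int[leb]_x f x.
Proof.
move=> f0; rewrite Rintegral_mkcond; congr Rintegral.
apply/funext => x; rewrite patchE; case: ifPn => // /negP xO.
by rewrite f0// => Ox; apply: xO; exact/mem_set.
Qed.

Lemma continuous_measurable_in f : continuous f -> measurable_fun Omega f.
Proof. by move=> cf; apply: measurable_funTS; exact: continuous_measurable_rV. Qed.

Lemma Cc_Lp B f : 0 < B -> Cc B f -> Lpo f.
Proof.
move=> B0 Cf; have [M _ fM] := Cc_bounded B0 Cf.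
apply: (@Lp_bounded _ _ _ _ _ mO _ (measure_domain_lty oO bO) p1 _ M) => //.
by apply: continuous_measurable_in; case: Cf.
Qed.

Lemma test_Lp f : test_function Omega f -> Lpo f /\ forall i, Lpo (partial i f).
Proof.
have [B B0 tB] := test_C1c bO; move=> /tB[Cf Cdf].
by split=> [|i]; [exact: Cc_Lp Cf|exact: Cc_Lp (Cdf i).2].
Qed.

Lemma test_functionM f1 f2 : test_function Omega f1 -> test_function Omega f2 ->
  test_function Omega (fun x => f1 x * f2 x).
Proof.
move=> [s1 c1 O1] [s2 c2 O2]; apply: (test_functionP c1 O1) => [k|x xs].
  exact: CkM.
by rewrite (notin_supp xs) mul0r.
Qed.

Lemma test_zero_outside f x : test_function Omega f -> ~ Omega x -> f x = 0.
Proof. by move=> [_ _ fO] xO; apply: notin_supp => /fO. Qed.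

(** The partial derivative of the product of two test functions has integral zero. *)
Lemma test_integration_by_parts f1 f2 i :
  test_function Omega f1 -> test_function Omega f2 ->
  \int[leb]_(x in Omega) (f1 x * partial i f2 x) =
  - \int[leb]_(x in Omega) (partial i f1 x * f2 x).
Proof.
move=> t1 t2; have [B B0 tB] := test_C1c bO.
have t12 := test_functionM t1 t2; have C12 := tB _ t12.
have := Rint_partial_eq0 i B0 C12.
have E : partial i (fun x => f1 x * f2 x) =
    fun x => f1 x * partial i f2 x + partial i f1 x * f2 x.
  apply/funext => x; rewrite [in RHS]mulrC [in RHS]addrC /partial.
  have := deriveM (test_derivable (x:=x) (i:=i) t1) (test_derivable (x:=x) (i:=i) t2).
  by rewrite [in RHS]addrC [_ * f2 x]mulrC [_ * f1 x]mulrC => ->.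
have [t1p t1i] := test_Lp t1; have [t2p t2i] := test_Lp t2.
have itgM h1 h2 : Cc B h1 -> Cc B h2 -> leb.-integrable Omega (EFin \o (fun x => h1 x * h2 x)).
  move=> Ch1 Ch2; have C : Cc B (fun x => h1 x * h2 x).
    split; first by move=> x; exact: (cvgM (Ch1.1 x) (Ch2.1 x)).
    by move=> x Bx; rewrite Ch1.2// mul0r.
  exact: integrableS measurableT mO (@subsetT _ _) (Cc_itg B0 C).
rewrite E -Rintegral_zero_outside; last first.
  by move=> x xO; rewrite (test_zero_outside t1 xO) (test_zero_outside t2 xO) mul0r mulr0 addr0.
have [Cf1 D1] := tB _ t1; have [Cf2 D2] := tB _ t2.
rewrite (RintegralD mO (itgM _ _ Cf1 (D2 i).2) (itgM _ _ (D1 i).2 Cf2)).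
by move/eqP; rewrite addr_eq0 => /eqP.
Qed.

(** Integration by parts passes to the limit, so that the approximating sequence
    alone characterises [W_0^{1,p}] together with its gradient. *)
Lemma W01pP u g : W u g <->
  [/\ Lpo u, forall i, Lpo (fun x => g x ord0 i) &
    exists phi : nat -> 'rV[R]_n -> R, [/\ forall k, test_function Omega (phi k),
      cv phi u & forall i, cv (fun k => partial i (phi k)) (fun x => g x ord0 i)]].
Proof.
have p0 : 0 < p := lt_trans ltr01 p1.
have dE := @cvLp_dist _ _ _ leb _ mO p.
split.
  move=> [[/(LfunP_p _ mO _ p0) Lu Lg _] [phi [tphi cu cg]]].
  have Lg' i : Lpo (fun x => g x ord0 i) by apply/(LfunP_p _ mO _ p0); exact: Lg.
  split=> [//|//|]; exists phi; split=> [//||i].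
    exact: (dE _ _ p1 (fun k => (test_Lp (tphi k)).1) Lu).1 cu.
  exact: (dE _ _ p1 (fun k => (test_Lp (tphi k)).2 i) (Lg' i)).1 (cg i).
move=> [Lu Lg [phi [tphi cu cg]]]; split; last first.
  exists phi; split=> [//||i].
    exact: (dE _ _ p1 (fun k => (test_Lp (tphi k)).1) Lu).2 cu.
  exact: (dE _ _ p1 (fun k => (test_Lp (tphi k)).2 i) (Lg i)).2 (cg i).
split; [exact/(LfunP_p _ mO _ p0)|by move=> i; exact/(LfunP_p _ mO _ p0)|].
move=> psi tpsi i; have [B B0 tB] := test_C1c bO.
have [Cpsi Dpsi] := tB _ tpsi.
have [M1 _ hM1] := Cc_bounded B0 Cpsi; have [M2 _ hM2] := Cc_bounded B0 (Dpsi i).2.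
have fin := measure_domain_lty oO bO.
have h1 := @cvLp_Int_mul _ _ _ _ _ mO _ fin p1 _ _ (partial i psi) M2
  (fun k => (test_Lp (tphi k)).1) Lu cu (continuous_measurable_in (Dpsi i).2.1) (fun x _ => hM2 x).
have h2 := @cvLp_Int_mul _ _ _ _ _ mO _ fin p1 _ _ psi M1
  (fun k => (test_Lp (tphi k)).2 i) (Lg i) (cg i) (continuous_measurable_in Cpsi.1) (fun x _ => hM1 x).
have E : (fun k => \int[leb]_(x in Omega) (phi k x * partial i psi x)) =
    (fun k => - \int[leb]_(x in Omega) (partial i (phi k) x * psi x)).
  by apply/funext => k; exact: test_integration_by_parts.
rewrite E in h1; have := cvg_unique _ h1 (cvgN h2); apply.
exact: norm_hausdorff.
Qed.

Lemma W_Lp u g : W u g -> Lpo u.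
Proof. by case/W01pP. Qed.

Lemma W_Lp_grad u g i : W u g -> Lpo (fun x => g x ord0 i).
Proof. by case/W01pP. Qed.

Lemma W_test f : test_function Omega f -> W f (fun x => \row_i partial i f x).
Proof.
move=> tf; have [L1 L2] := test_Lp tf; apply/W01pP.
have E i : (fun x => (\row_j partial j f x) ord0 i) = partial i f.
  by apply/funext => x; rewrite mxE.
have c0 w : cv (fun=> w) w.
  rewrite /cvLp (_ : (fun k => _) = fun=> 0); first exact: cvg_cst.
  apply/funext => _; under eq_Rintegral do rewrite subrr normr0 powR0 ?gt_eqF ?(lt_trans _ p1)//.
  by rewrite Rintegral_cst ?mul0r//; exact: mO.
split=> // [i|]; first by rewrite E.
by exists (fun=> f); split => // i; rewrite E.
Qed.

Lemma W_ae_eq u g u' g' : W u g -> measurable_fun Omega u' ->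
  (forall i, measurable_fun Omega (fun x => g' x ord0 i)) ->
  {ae leb, forall x, Omega x -> u x = u' x} ->
  {ae leb, forall x, Omega x -> g x = g' x} -> W u' g'.
Proof.
move=> /W01pP[Lu Lg [phi [tphi cu cg]]] mu' mg' uu' gg'; apply/W01pP.
have gg'i i : {ae leb, forall x, Omega x -> g x ord0 i = g' x ord0 i}.
  by apply: filterS gg' => x /[apply] ->.
have Lu' := Lp_ae_eq mO p1 mu' uu' Lu.
have Lg' i := Lp_ae_eq mO p1 (mg' i) (gg'i i) (Lg i).
have cvE w w' (w_ : nat -> _) : (forall k, Lpo (w_ k)) -> Lpo w -> Lpo w' ->
    {ae leb, forall x, Omega x -> w x = w' x} -> cv w_ w -> cv w_ w'.
  move=> Lw_ Lw Lw' ww'; rewrite /cvLp => h.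
  suff E : (fun k => \int[leb]_(x in Omega) `|w_ k x - w' x| `^ p) =
    (fun k => \int[leb]_(x in Omega) `|w_ k x - w x| `^ p) by rewrite E; exact: h.
  apply/funext => k; apply: Int_ae_eq.
  - exact: mO.
  - exact: itg_meas (LpB mO p1 (Lw_ k) Lw').2.
  - exact: itg_meas (LpB mO p1 (Lw_ k) Lw).2.
  - by apply: filterS ww' => x /[apply] ->.
split=> [//|//|]; exists phi; split=> [//||i].
  exact: cvE (fun k => (test_Lp (tphi k)).1) Lu Lu' uu' cu.
exact: cvE (fun k => (test_Lp (tphi k)).2 i) (Lg i) (Lg' i) (gg'i i) (cg i).
Qed.

(** A diagonal sequence: approximate each [u_ k] within [1 / (k + 1)] by a test function. *)
Lemma W_lim (u_ : nat -> 'rV[R]_n -> R) (g_ : nat -> 'rV[R]_n -> 'rV[R]_n) u g :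
  (forall k, W (u_ k) (g_ k)) -> Lpo u -> (forall i, Lpo (fun x => g x ord0 i)) ->
  cv u_ u -> (forall i, cv (fun k x => g_ k x ord0 i) (fun x => g x ord0 i)) -> W u g.
Proof.
move=> Wk Lu Lg cu cg; apply/W01pP; split => //.
have /choice[phi hphi] k : exists f, [/\ test_function Omega f,
    \int[leb]_(x in Omega) `|f x - u_ k x| `^ p <= k.+1%:R^-1 &
    forall i, \int[leb]_(x in Omega) `|partial i f x - g_ k x ord0 i| `^ p <= k.+1%:R^-1].
  have /W01pP[_ _ [psi [tpsi cpu cpg]]] := Wk k.
  have k0 : 0 < k.+1%:R^-1 :> R by [].
  have /cvLpP/(_ _ k0)[N1 hN1] := cpu.
  have /choice[N2 hN2] i : exists N2 : nat, forall m, (N2 <= m)%N ->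
      \int[leb]_(x in Omega) `|partial i (psi m) x - g_ k x ord0 i| `^ p <= k.+1%:R^-1.
    by have /cvLpP/(_ _ k0) := cpg i.
  pose N := maxn N1 (\max_i N2 i); exists (psi N); split => //.
    by apply: hN1; exact: leq_maxl.
  by move=> i; apply: hN2; rewrite (leq_trans (leq_bigmax i))// leq_maxr.
have tphi k : test_function Omega (phi k) by case: (hphi k).
have key (w_ f_ : nat -> 'rV[R]_n -> R) w : (forall k, Lpo (w_ k)) -> (forall k, Lpo (f_ k)) ->
    Lpo w -> cv w_ w ->
    (forall k, \int[leb]_(x in Omega) `|f_ k x - w_ k x| `^ p <= k.+1%:R^-1) -> cv f_ w.
  move=> Lw_ Lf_ Lw cw fw; rewrite /cvLp.
  apply: (@squeeze0 _ _ (fun k => 2 `^ p * (k.+1%:R^-1 + \int[leb]_(x in Omega) `|w_ k x - w x| `^ p))).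
    move=> k; rewrite Np_ge0/=; apply: le_trans (Np_triangle mO p1 (Lf_ k) (Lw_ k) Lw) _.
    by rewrite ler_pM2l ?powR_gt0// lerD2r.
  by apply: cvgZ0; apply: cvgD0 => //; exact: cvg_harmonic.
exists phi; split=> [//||i].
  apply: (key u_ phi u (fun k => W_Lp (Wk k)) (fun k => (test_Lp (tphi k)).1) Lu cu) => k.
  case: (hphi k) => _ h _; exact: h.
apply: (key _ _ _ (fun k => W_Lp_grad i (Wk k)) (fun k => (test_Lp (tphi k)).2 i) (Lg i) (cg i)) => k.
case: (hphi k) => _ _ h; exact: h.
Qed.

Lemma W_D u g v gv : W u g -> W v gv -> W (fun x => u x + v x) (fun x => g x + gv x).
Proof.
move=> /W01pP[Lu Lg [phi [tphi cu cg]]] /W01pP[Lv Lgv [psi [tpsi cv_ cgv]]].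
have E i : (fun x => (g x + gv x) ord0 i) = fun x => g x ord0 i + gv x ord0 i.
  by apply/funext => x; rewrite mxE.
apply/W01pP; split=> [|i|]; first exact: (LpD mO p1 Lu Lv).
  by rewrite E; exact: (LpD mO p1 (Lg i) (Lgv i)).
exists (fun k x => phi k x + psi k x); split=> [k||i].
- exact: test_functionD.
- exact: (cvLpD mO p1 (fun k => (test_Lp (tphi k)).1) Lu (fun k => (test_Lp (tpsi k)).1) Lv cu cv_).
- rewrite E (_ : (fun k => _) = fun k x => partial i (phi k) x + partial i (psi k) x).
    have := @cvLpD _ _ _ _ _ mO _ p1 _ _ _ _ (fun k => (test_Lp (tphi k)).2 i) (Lg i)
      (fun k => (test_Lp (tpsi k)).2 i) (Lgv i) (cg i) (cgv i).
    exact.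
  apply/funext => k; apply/funext => x.
  exact: deriveD (test_derivable (x:=x) (i:=i) (tphi k)) (test_derivable (x:=x) (i:=i) (tpsi k)).
Qed.

Lemma W_Z a u g : W u g -> W (fun x => a * u x) (fun x => a *: g x).
Proof.
move=> /W01pP[Lu Lg [phi [tphi cu cg]]].
have E i : (fun x => (a *: g x) ord0 i) = fun x => a * g x ord0 i.
  by apply/funext => x; rewrite mxE.
apply/W01pP; split=> [|i|]; first exact: (LpZ mO a Lu).
  by rewrite E; exact: (LpZ mO a (Lg i)).
exists (fun k x => a * phi k x); split=> [k||i].
- exact: test_functionZ.
- exact: (cvLpZ mO p1 a (fun k => (test_Lp (tphi k)).1) Lu cu).
- rewrite E (_ : (fun k => _) = fun k x => a * partial i (phi k) x).
    by have := @cvLpZ _ _ _ _ _ mO _ p1 a _ _ (fun k => (test_Lp (tphi k)).2 i) (Lg i) (cg i).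
  apply/funext => k; apply/funext => x.
  exact: deriveZ (test_derivable (x:=x) (i:=i) (tphi k)).
Qed.

Lemma W_B u g v gv : W u g -> W v gv -> W (fun x => u x - v x) (fun x => g x - gv x).
Proof.
move=> Wu Wv; have := W_D Wu (W_Z (-1) Wv).
rewrite (_ : (fun x => u x + _) = fun x => u x - v x); last by apply/funext => x; rewrite mulN1r.
by rewrite (_ : (fun x => g x + _) = fun x => g x - gv x)//; apply/funext => x; rewrite scaleN1r.
Qed.

Lemma W_0 : W (fun=> 0) (fun=> 0).
Proof.
have := W_test (test_function0 Omega).
rewrite (_ : (fun x => \row_i _) = fun=> 0)//; apply/funext => x; apply/rowP => i.
by rewrite !mxE; exact: derive_cst.
Qed.

End sobolev_space.

(** * Chain rules *)

Section smooth_one_variable.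
Context {R : realType} {n : nat}.
Implicit Types f : 'rV[R]_n -> R.

Lemma smooth_sabs a e f : 0 < e -> smooth f -> smooth (fun x => sabs a e (f x)).
Proof.
move=> e0 sf k; have s1 : Ck k (fun x => f x + - a) by apply: CkD; [exact: sf|exact: Ck_cst].
apply: (@Ck_powR _ _ k 2^-1 (fun x => (f x - a) ^+ 2 + e ^+ 2)) => [x|].
  exact: sabs_arg_gt0.
by apply: CkD; [exact: CkM|exact: Ck_cst].
Qed.

Lemma Ck_expR k f : Ck k f -> Ck k (fun x => expR (f x)).
Proof.
elim: k f => [|k IH] f Cf.
  by move=> x; apply: (@continuous_comp _ _ _ f expR); [exact: Cf|exact: continuous_expR].
have [cf df] := Cf; split.
  by move=> x; apply: (@continuous_comp _ _ _ f expR); [exact: cf|exact: continuous_expR].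
move=> i; have [dfi Cfi] := df i.
have dG x := derive_comp_real (dfi x) (is_derive_expR (f x)).
split; first by move=> x; exact: (dG x).1.
rewrite (_ : partial i _ = fun x => expR (f x) * partial i f x).
  by apply: CkM => //; apply: IH; exact: Ck_pred.
by apply/funext => x; exact: (dG x).2.
Qed.

Lemma Ck_ln k f : (forall x, 0 < f x) -> Ck k f -> Ck k (fun x => ln (f x)).
Proof.
move=> f0 Cf; have cl x : {for x, continuous (fun x => ln (f x))}.
  by apply: (@continuous_comp _ _ _ f (@ln R)); [exact: Ck_continuous Cf _|exact: continuous_ln].
case: k Cf => [//|k] Cf; have [cf df] := Cf; split => //.
move=> i; have [dfi Cfi] := df i.
have dG x := derive_comp_real (dfi x) (is_derive1_ln (f0 x)).
split; first by move=> x; exact: (dG x).1.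
rewrite (_ : partial i _ = fun x => f x `^ (-1) * partial i f x).
  by apply: CkM => //; apply: Ck_powR => //; exact: Ck_pred.
by apply/funext => x; rewrite powR_inv1 ?(ltW (f0 x))//; exact: (dG x).2.
Qed.

End smooth_one_variable.

Section clamp.
Context {R : realType}.
Implicit Types a b t e : R.

Definition clamp a b t : R := (a + b) / 2 + (`|t - a| - `|t - b|) / 2.

(** [sclamp a b e] is smooth and takes its values in the open interval, so it can
    be followed by any function that is smooth there. *)
Definition sclamp a b e t : R := (a + b) / 2 + (sabs a e t - sabs b e t) / 2.

Lemma clampE a b t : a <= t <= b -> clamp a b t = t.
Proof.
move=> /andP[at_ tb]; rewrite /clamp ger0_norm ?subr_ge0// ler0_norm ?subr_le0//.
by field.
Qed.

Lemma clamp_in a b t : a <= b -> a <= clamp a b t <= b.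
Proof.
move=> ab; have h1 : `|t - a| <= `|t - b| + (b - a).
  have -> : b - a = `|b - a| by rewrite ger0_norm ?subr_ge0.
  by rewrite (_ : t - a = (t - b) + (b - a)) ?ler_normD//; ring.
have h2 : `|t - b| <= `|t - a| + (b - a).
  have -> : b - a = `|a - b| by rewrite distrC ger0_norm ?subr_ge0.
  by rewrite (_ : t - b = (t - a) + (a - b)) ?ler_normD//; ring.
by rewrite /clamp; apply/andP; split; lra.
Qed.

(** [A - B = ((t - a)^2 - (t - b)^2) / (A + B)], and [A + B] exceeds [|t - a| + |t - b|]. *)
Lemma sabs_dist_lt a b e t : 0 < e -> a < b -> `|sabs a e t - sabs b e t| < b - a.
Proof.
move=> e0 ab; set A := sabs a e t; set B := sabs b e t.
have sq c : sabs c e t ^+ 2 = (t - c) ^+ 2 + e ^+ 2.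
  by rewrite sabs_sqrt sqr_sqrtr// ltW// sabs_arg_gt0.
have gt c : `|t - c| < sabs c e t.
  have s0 : 0 <= sabs c e t by rewrite sabs_sqrt sqrtr_ge0.
  rewrite -(ger0_norm s0) -ltr_sqr ?nnegrE// -!normrX sq.
  by rewrite !ger0_norm ?sqr_ge0 ?addr_ge0 ?sqr_ge0// ltrDl exprn_gt0.
have AB0 : 0 < A + B by rewrite addr_gt0// (le_lt_trans _ (gt _)).
rewrite -(ltr_pM2r AB0) -{1}(ger0_norm (ltW AB0)) -normrM.
rewrite (_ : (A - B) * (A + B) = (b - a) * ((t - a) + (t - b))); last first.
  by rewrite -subr_sqr !sq; ring.
rewrite normrM gtr0_norm ?subr_gt0// ltr_pM2l ?subr_gt0//.
by rewrite (le_lt_trans (ler_normD _ _))// ltrD.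
Qed.

Lemma sclamp_in a b e t : 0 < e -> a < b -> a < sclamp a b e t < b.
Proof.
move=> e0 ab; have := sabs_dist_lt t e0 ab; rewrite ltr_norml /sclamp => /andP[].
by move=> h1 h2; apply/andP; split; lra.
Qed.

Lemma is_derive_sclamp a b e t : 0 < e ->
  is_derive t 1 (sclamp a b e) ((dsabs a e t - dsabs b e t) / 2).
Proof.
move=> e0; have da := is_derive_sabs a t e0; have db := is_derive_sabs b t e0.
rewrite /sclamp; apply: is_derive_eq.
rewrite /GRing.scale /=; ring.
Qed.

Lemma cvg_sclamp a b t : sclamp a b k.+1%:R^-1 t @[k --> \oo] --> clamp a b t.
Proof.
apply: cvgD; first exact: cvg_cst.
by apply: cvgMl; apply: cvgB; exact: cvg_sabs.
Qed.

End clamp.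

Section chain_rule.
Context {R : realType} {n : nat}.
Variables (Omega : set 'rV[R]_n) (p : R).
Hypotheses (oO : open Omega) (bO : bounded_set Omega) (p1 : 1 < p).
Local Notation leb := (lebesgue_rV n).
Local Notation mO := (open_measurable_rV oO).
Local Notation Lpo := (Lp leb Omega p).
Local Notation cv := (cvLp leb Omega p).
Local Notation W := (W01p Omega p).
Implicit Types (a b t s C M : R) (u v f : 'rV[R]_n -> R) (g : 'rV[R]_n -> 'rV[R]_n).

Lemma cvLp_lip (u_ v_ : nat -> 'rV[R]_n -> R) u v C :
  (forall k, Lpo (v_ k)) -> Lpo v -> (forall k, measurable_fun Omega (u_ k)) ->
  measurable_fun Omega u ->
  (forall k x, Omega x -> `|u_ k x - u x| <= C * `|v_ k x - v x|) -> cv v_ v -> cv u_ u.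
Proof.
move=> Lv_ Lv mu_ mu h cv_; rewrite /cvLp.
have LB k := LpZ mO C (LpB mO p1 (Lv_ k) Lv).
apply: (@squeeze0 _ _ (fun k => `|C| `^ p * \int[leb]_(x in Omega) `|v_ k x - v x| `^ p)).
  move=> k; rewrite Np_ge0/= -(NpZ mO _ (LpB mO p1 (Lv_ k) Lv)).
  have le x : Omega x -> `|u_ k x - u x| <= `|C * (v_ k x - v x)|.
    by move=> Ox; rewrite (le_trans (h k x Ox))// normrM ler_wpM2r// ler_norm.
  have Lu : Lpo (fun x => u_ k x - u x).
    by apply: (Lp_le mO p1 _ le (LB k)); exact: measurable_funB.
  apply: le_Rintegral; [exact: mO|exact: Lu.2|exact: (LB k).2|].
  by move=> x Ox; rewrite ler_powR2 ?le// ltW// (lt_trans _ p1).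
exact: cvgZ0.
Qed.

Lemma cvLp_subsequence (u_ : nat -> 'rV[R]_n -> R) u (s : nat -> nat) :
  (forall k, (k <= s k)%N) -> cv u_ u -> cv (fun k => u_ (s k)) u.
Proof.
move=> sk /cvLpP cu; apply/cvLpP => e /cu[K hK]; exists K => k Kk.
by apply: hK; rewrite (leq_trans Kk).
Qed.

(** The functions that preserve [W_0^{1,p}] with the expected gradient. Closure under sums,
    multiples and dominated pointwise limits carries the property from smooth functions to
    truncations. *)
Definition chain (G G' : R -> R) :=
  [/\ measurable_fun setT G, measurable_fun setT G' &
  forall u g, W u g -> W (fun x => G (u x)) (fun x => G' (u x) *: g x)].

(** For test functions [phi k] tending to [u], the gradient of [G (phi k)] differs from
    [G'(phi k) g], whose limit follows by domination along an almost everywhere convergent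
    subsequence, by [G'(phi k) (grad (phi k) - g)], which tends to zero as [G'] is bounded. *)
Lemma chain_smooth (G G' : R -> R) C : G 0 = 0 -> (forall t, is_derive t 1 G (G' t)) ->
  continuous G' -> (forall t, `|G' t| <= C) ->
  (forall f, smooth f -> smooth (fun x : 'rV[R]_n => G (f x))) -> chain G G'.
Proof.
move=> G0 dG cG' G'C sG.
have cG : continuous G by move=> t; exact: is_derive_continuous (dG t).
have mG : measurable_fun setT G := continuous_measurable_fun cG.
have mG' : measurable_fun setT G' := continuous_measurable_fun cG'.
have lipG s t : `|G s - G t| <= C * `|s - t|.
  apply: (@lipschitz_derive _ _ G' (Num.min s t) (Num.max s t)) => //.
  - by rewrite ge_min le_max !lexx.
  - by rewrite ge_min le_max !lexx !orbT.
have C0 : 0 <= C := le_trans (normr_ge0 _) (G'C 0).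
split => // u g Wu; have /(W01pP oO bO p1)[Lu Lg [phi0 [tphi0 cu0 cg0]]] := Wu.
have Lphi0 k := (test_Lp oO bO p1 (tphi0 k)).1.
have [s sk ae_u] := cvLp_subseq mO p1 Lphi0 Lu cu0.
pose phi k := phi0 (s k).
have tphi k : test_function Omega (phi k) by exact: tphi0.
have cu : cv phi u := cvLp_subsequence sk cu0.
have cg i : cv (fun k => partial i (phi k)) (fun x => g x ord0 i) := cvLp_subsequence sk (cg0 i).
have Lphi k := (test_Lp oO bO p1 (tphi k)).1.
have Ldphi i k := (test_Lp oO bO p1 (tphi k)).2 i.
have mu : measurable_fun Omega u := Lu.1.
have mGu : measurable_fun Omega (fun x => G (u x)) := measurableT_comp mG mu.
have mG'u : measurable_fun Omega (fun x => G' (u x)) := measurableT_comp mG' mu.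
have mG'phi k : measurable_fun Omega (fun x => G' (phi k x)) := measurableT_comp mG' (Lphi k).1.
have tG k : test_function Omega (fun x => G (phi k x)).
  by apply: test_function_comp => //; apply: sG; case: (tphi k).
have LCg i := LpZ mO C (Lg i).
have G'le i x t : `|G' t * g x ord0 i| <= `|C * g x ord0 i|.
  by rewrite !normrM ler_wpM2r// (le_trans (G'C t))// ler_norm.
have LGg i : Lpo (fun x => G' (u x) * g x ord0 i).
  by apply: (Lp_le mO p1 _ _ (LCg i)) => //; apply: measurable_funM => //; exact: (Lg i).1.
apply: (W_lim oO bO p1 (fun k => W_test oO bO p1 (tG k))).
- apply: (Lp_le mO p1 mGu _ (LpZ mO C Lu)) => x _.
  by rewrite normrM (ger0_norm C0); have := lipG (u x) 0; rewrite G0 !subr0.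
- move=> i; rewrite (_ : (fun x => _) = fun x => G' (u x) * g x ord0 i)//.
  by apply/funext => x; rewrite mxE.
- apply: (cvLp_lip Lphi Lu _ mGu _ cu) => [k|k x _]; last exact: lipG.
  exact: (test_Lp oO bO p1 (tG k)).1.1.
move=> i.
have -> : (fun x => (G' (u x) *: g x) ord0 i) = fun x => 0 + G' (u x) * g x ord0 i.
  by apply/funext => x; rewrite mxE add0r.
have -> : (fun k x => (\row_j partial j (fun y => G (phi k y)) x) ord0 i) =
    fun k x => G' (phi k x) * (partial i (phi k) x - g x ord0 i) + G' (phi k x) * g x ord0 i.
  apply/funext => k; apply/funext => x; rewrite mxE -mulrDr subrK.
  exact: (derive_comp_real (test_derivable (x:=x) (i:=i) (tphi k)) (dG _)).2.
have mA k : measurable_fun Omega (fun x => G' (phi k x) * (partial i (phi k) x - g x ord0 i)).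
  by apply: measurable_funM => //; exact: (LpB mO p1 (Ldphi i k) (Lg i)).1.
have A_le k x : Omega x -> `|G' (phi k x) * (partial i (phi k) x - g x ord0 i)| <=
    `|C * (partial i (phi k) x - g x ord0 i)|.
  by move=> _; rewrite !normrM ler_wpM2r// (le_trans (G'C _))// ler_norm.
have LA k : Lpo (fun x => G' (phi k x) * (partial i (phi k) x - g x ord0 i)).
  exact: (Lp_le mO p1 (mA k) (A_le k) (LpZ mO C (LpB mO p1 (Ldphi i k) (Lg i)))).
have mB k : measurable_fun Omega (fun x => G' (phi k x) * g x ord0 i).
  by apply: measurable_funM => //; exact: (Lg i).1.
have LB k : Lpo (fun x => G' (phi k x) * g x ord0 i).
  exact: (Lp_le mO p1 (mB k) (fun x _ => G'le i x _) (LCg i)).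
have L0 : Lpo (fun=> 0) by exact: Lp0.
have cA : cv (fun k x => G' (phi k x) * (partial i (phi k) x - g x ord0 i)) (fun=> 0).
  apply: (cvLp_lip (Ldphi i) (Lg i) mA L0.1 (C := C) _ (cg i)) => k x Ox.
  by rewrite subr0 (le_trans (A_le k x Ox))// normrM ger0_norm.
suff [_ cB] : Lpo (fun x => G' (u x) * g x ord0 i) /\
    cv (fun k x => G' (phi k x) * g x ord0 i) (fun x => G' (u x) * g x ord0 i).
  exact: (cvLpD mO p1 LA L0 LB (LGg i) cA cB).
apply: (Lp_dct mO p1 mB (LGg i).1 _ (LCg i) (fun k x _ => G'le i x _)).
apply: filterS ae_u => x h Ox; apply: cvgMl.
by apply: cvg_comp (h Ox) _; exact: cG'.
Qed.

(** Both [C |u|] and [C |g|] dominate, so pointwise convergence becomes convergence in L^p. *)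
Lemma chain_lim (G_ G'_ : nat -> R -> R) (G G' : R -> R) C :
  (forall k, chain (G_ k) (G'_ k)) -> (forall k t, `|G_ k t| <= C * `|t|) ->
  (forall k t, `|G'_ k t| <= C) -> (forall t, G_ ^~ t @ \oo --> G t) ->
  (forall t, G'_ ^~ t @ \oo --> G' t) -> chain G G'.
Proof.
move=> ch GC G'C cG cG'.
have mG : measurable_fun setT G.
  by apply: (@measurable_fun_cvg _ _ _ _ G_) => [k|x _]; [case: (ch k)|exact: cG].
have mG' : measurable_fun setT G'.
  by apply: (@measurable_fun_cvg _ _ _ _ G'_) => [k|x _]; [case: (ch k)|exact: cG'].
split => // u g Wu; have Lu := W_Lp oO bO p1 Wu; have Lg i := W_Lp_grad oO bO p1 i Wu.
have mu := Lu.1; have LCu := LpZ mO C Lu; have LCg i := LpZ mO C (Lg i).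
have mGk k : measurable_fun Omega (fun x => G_ k (u x)).
  by case: (ch k) => m _ _; exact: measurableT_comp m mu.
have mG'k k i : measurable_fun Omega (fun x => G'_ k (u x) * g x ord0 i).
  case: (ch k) => _ m _; apply: measurable_funM; last exact: (Lg i).1.
  exact: measurableT_comp m mu.
have mGu : measurable_fun Omega (fun x => G (u x)) := measurableT_comp mG mu.
have mG'u i : measurable_fun Omega (fun x => G' (u x) * g x ord0 i).
  by apply: measurable_funM; [exact: measurableT_comp mG' mu|exact: (Lg i).1].
have le1 k x : Omega x -> `|G_ k (u x)| <= `|C * u x|.
  by move=> _; rewrite (le_trans (GC k _))// normrM ler_wpM2r// ler_norm.
have le2 i k x : Omega x -> `|G'_ k (u x) * g x ord0 i| <= `|C * g x ord0 i|.
  by move=> _; rewrite !normrM ler_wpM2r// (le_trans (G'C k _))// ler_norm.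
have [|LG cvG] := Lp_dct mO p1 mGk mGu _ LCu le1.
  by apply: aeW => x _; exact: cG.
have cvG' i : Lpo (fun x => G' (u x) * g x ord0 i) /\
    cv (fun k x => G'_ k (u x) * g x ord0 i) (fun x => G' (u x) * g x ord0 i).
  apply: (Lp_dct mO p1 (fun k => mG'k k i) (mG'u i) _ (LCg i) (le2 i)).
  by apply: aeW => x _; apply: cvgMl; exact: cG'.
have E (G0 : R -> R) i : (fun x => (G0 (u x) *: g x) ord0 i) = fun x => G0 (u x) * g x ord0 i.
  by apply/funext => x; rewrite mxE.
have Wk k : W (fun x => G_ k (u x)) (fun x => G'_ k (u x) *: g x) by case: (ch k) => _ _; exact.
apply: (W_lim oO bO p1 Wk LG _ cvG) => i; first by rewrite E; exact: (cvG' i).1.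
rewrite E; suff -> : (fun k x => (G'_ k (u x) *: g x) ord0 i) = fun k x => G'_ k (u x) * g x ord0 i.
  exact: (cvG' i).2.
by apply/funext => k; exact: E.
Qed.

Lemma chainD (G G' F F' : R -> R) : chain G G' -> chain F F' ->
  chain (fun t => G t + F t) (fun t => G' t + F' t).
Proof.
move=> [mG mG' cG] [mF mF' cF]; split; [exact: measurable_funD|exact: measurable_funD|].
move=> u g Wu; have := W_D oO bO p1 (cG _ _ Wu) (cF _ _ Wu).
rewrite (_ : (fun x => _ *: g x + _) = fun x => (G' (u x) + F' (u x)) *: g x)//.
by apply/funext => x; rewrite scalerDl.
Qed.

Lemma chainZ (G G' : R -> R) a : chain G G' ->
  chain (fun t => a * G t) (fun t => a * G' t).
Proof.
move=> [mG mG' cG]; split; [exact: measurable_funM|exact: measurable_funM|].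
move=> u g Wu; have := W_Z oO bO p1 a (cG _ _ Wu).
rewrite (_ : (fun x => a *: _) = fun x => (a * G' (u x)) *: g x)//.
by apply/funext => x; rewrite scalerA.
Qed.

Lemma chain_id : chain id (fun=> 1).
Proof.
split=> // u g Wu; rewrite (_ : (fun x => 1 *: g x) = g)//.
by apply/funext => x; rewrite scale1r.
Qed.

(** The limit of [sabs a e - sabs a e 0] as [e] tends to zero. At [t = a] the derivatives
    are zero, which is the value [Num.sg 0]. *)
Lemma chain_abs a : chain (fun t => `|t - a| - `|a|) (fun t => Num.sg (t - a)).
Proof.
pose e (k : nat) : R := k.+1%:R^-1; have e0 k : 0 < e k by rewrite invr_gt0 ltr0n.
apply: (@chain_lim (fun k t => sabs a (e k) t - sabs a (e k) 0) (fun k => dsabs a (e k)) _ _ 1).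
- move=> k; apply: (@chain_smooth _ _ 1).
  + by rewrite subrr.
  + move=> t; have d := is_derive_sabs a t (e0 k).
    by apply: is_derive_eq; rewrite subr0.
  + exact: continuous_dsabs.
  + by move=> t; exact: dsabs_le1.
  + move=> f sf j; apply: CkD; first exact: smooth_sabs.
    exact: Ck_cst.
- by move=> k t; rewrite mul1r (le_trans (sabs_lip _ _ _ (e0 k)))// subr0.
- by move=> k t; exact: dsabs_le1.
- move=> t; have -> : `|a| = `|0 - a| by rewrite sub0r normrN.
  by apply: cvgB; exact: cvg_sabs.
- by move=> t; exact: cvg_dsabs.
Qed.

Definition posp (t : R) : R := (t + `|t|) / 2.
Definition heaviside (t : R) : R := (1 + Num.sg t) / 2.

Lemma chain_pos a : chain (fun t => posp (t - a) - posp (- a)) (fun t => heaviside (t - a)).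
Proof.
have := chainZ 2^-1 (chainD chain_id (chain_abs a)).
rewrite (_ : (fun t => 2^-1 * _) = fun t => posp (t - a) - posp (- a)).
  rewrite (_ : (fun t => 2^-1 * _) = fun t => heaviside (t - a))//.
  by apply/funext => t; rewrite mulrC.
by apply/funext => t; rewrite /posp normrN /=; field.
Qed.

(** Precompose with [sclamp a b e], which is globally smooth with values in the segment, and
    let [e] tend to zero. *)
Lemma chain_clamp (G G' : R -> R) a b C : a < b ->
  (forall t, a <= t <= b -> is_derive t 1 G (G' t)) ->
  (forall t, a <= t <= b -> {for t, continuous G'}) ->
  (forall t, a <= t <= b -> `|G' t| <= C) ->
  (forall f, smooth f -> (forall x, a < f x < b) -> smooth (fun x : 'rV[R]_n => G (f x))) ->
  chain (fun t => G (clamp a b t) - G (clamp a b 0))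
        (fun t => G' (clamp a b t) * ((Num.sg (t - a) - Num.sg (t - b)) / 2)).
Proof.
move=> ab dG cG' G'C sG.
pose e (k : nat) : R := k.+1%:R^-1; have e0 k : 0 < e k by rewrite invr_gt0 ltr0n.
pose S k t := sclamp a b (e k) t; pose S' k t := (dsabs a (e k) t - dsabs b (e k) t) / 2.
have Sab k t : a <= S k t <= b.
  by have /andP[h1 h2] := sclamp_in t (e0 k) ab; rewrite !ltW.
have dS k t : is_derive t 1 (S k) (S' k t) by exact: is_derive_sclamp.
have S'1 k t : `|S' k t| <= 1.
  rewrite /S' normrM [`|2^-1|]ger0_norm// ler_pdivrMr// mul1r.
  by rewrite (le_trans (ler_normB _ _))// -[2]/(1 + 1) lerD// dsabs_le1.
have dGS k t : is_derive t 1 (fun t => G (S k t)) (G' (S k t) * S' k t).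
  exact: (is_derive1_comp (dG _ (Sab k t)) (dS k t)).
have GS'C k t : `|G' (S k t) * S' k t| <= C.
  by rewrite normrM -[leRHS]mulr1 ler_pM// G'C.
apply: (@chain_lim (fun k t => G (S k t) - G (S k 0)) (fun k t => G' (S k t) * S' k t) _ _ C).
- move=> k; apply: (@chain_smooth _ _ C).
  + by rewrite subrr.
  + by move=> t; have d := dGS k t; apply: is_derive_eq; rewrite subr0.
  + move=> t; apply: cvgM.
      apply: (@continuous_comp _ _ _ (S k) G'); first exact: is_derive_continuous (dS k t).
      exact: cG'.
    by apply: cvgMl; apply: cvgB; exact: continuous_dsabs.
  + exact: GS'C.
  + move=> f sf j; apply: CkD; last exact: Ck_cst.
    apply: sG => [i|x]; last exact: sclamp_in.
    apply: CkD; first exact: Ck_cst.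
    apply: CkM; last exact: Ck_cst.
    apply: CkD; first exact: smooth_sabs.
    rewrite (_ : (fun x => - _) = fun x => -1 * sabs b (e k) (f x)).
      by apply: CkM; [exact: Ck_cst|exact: smooth_sabs].
    by apply/funext => x; rewrite mulN1r.
- move=> k t; rewrite -[in leRHS](subr0 t).
  apply: (@lipschitz_derive _ (fun t => G (S k t)) (fun t => G' (S k t) * S' k t)
    (Num.min t 0) (Num.max t 0)) => //.
  + by rewrite ge_min le_max !lexx.
  + by rewrite ge_min le_max !lexx !orbT.
- exact: GS'C.
- have cl t : G (S k t) @[k --> \oo] --> G (clamp a b t).
    apply: cvg_comp (@cvg_sclamp R a b t) _.
    by apply: (is_derive_continuous (dG _ _)); exact: clamp_in (ltW ab).
  by move=> t; apply: cvgB.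
- move=> t; apply: cvgM.
    by apply: cvg_comp (@cvg_sclamp R a b t) _; apply: cG'; exact: clamp_in (ltW ab).
  by apply: cvgMl; apply: cvgB; exact: cvg_dsabs.
Qed.

(** On the range of [u] the truncation is the identity with derivative one. *)
Lemma W_comp (G G' : R -> R) a b C u g : a < 0 < b ->
  (forall t, a <= t <= b -> is_derive t 1 G (G' t)) ->
  (forall t, a <= t <= b -> {for t, continuous G'}) ->
  (forall t, a <= t <= b -> `|G' t| <= C) ->
  (forall f, smooth f -> (forall x, a < f x < b) -> smooth (fun x : 'rV[R]_n => G (f x))) ->
  W u g -> (forall x, a < u x < b) ->
  W (fun x => G (u x) - G 0) (fun x => G' (u x) *: g x).
Proof.
move=> /andP[a0 b0] dG cG' G'C sG Wu uab.
have [_ _ /(_ _ _ Wu)] := chain_clamp (lt_trans a0 b0) dG cG' G'C sG.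
have E1 : (fun x => G (clamp a b (u x)) - G (clamp a b 0)) = fun x => G (u x) - G 0.
  by apply/funext => x; have /andP[h1 h2] := uab x; rewrite !clampE ?ltW.
have E2 : (fun x => (G' (clamp a b (u x)) * ((Num.sg (u x - a) - Num.sg (u x - b)) / 2)) *: g x) =
    fun x => G' (u x) *: g x.
  apply/funext => x; have /andP[h1 h2] := uab x; rewrite clampE ?ltW//.
  rewrite gtr0_sg ?subr_gt0// ltr0_sg ?subr_lt0// opprK divff// mulr1.
  by [].
by rewrite E1 E2.
Qed.

Lemma W_expR (k : R) M u g : W u g -> (forall x, `|u x| <= M) ->
  W (fun x => expR (k * u x) - 1) (fun x => (k * expR (k * u x)) *: g x).
Proof.
move=> Wu uM; have M0 : 0 <= M := le_trans (normr_ge0 _) (uM 0).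
have uab x : - (M + 1) < u x < M + 1.
  by rewrite -ltr_norml (le_lt_trans (uM x))// ltrDl.
have dk (t : R) : is_derive t 1 (fun t : R => k * t) k.
  by apply: is_derive_eq; rewrite [_ *: _]mulr1.
have dE t : is_derive t (1 : R) (fun t => expR (k * t)) (k * expR (k * t)).
  by have := is_derive1_comp (is_derive_expR (k * t)) (dk t); rewrite mulrC.
have := @W_comp (fun t => expR (k * t)) (fun t => k * expR (k * t)) (- (M + 1)) (M + 1)
  (`|k| * expR (`|k| * (M + 1))) u g.
rewrite mulr0 expR0; apply => //.
- by rewrite oppr_lt0 andbb ltr_wpDl.
- by move=> t _; apply: cvgMr; exact: is_derive_continuous (dE t).
- move=> t tM; rewrite normrM ler_wpM2l// [leLHS]ger0_norm ?expR_ge0// ler_expR.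
  by rewrite (le_trans (ler_norm _))// normrM ler_wpM2l// ler_norml.
- by move=> f sf _ j; apply: Ck_expR; exact: smoothZ.
Qed.

Lemma W_ln M u g : W u g -> (forall x, 0 <= u x <= M) ->
  W (fun x => ln (1 + u x)) (fun x => (1 + u x)^-1 *: g x).
Proof.
move=> Wu uM; have M0 : 0 <= M by case/andP: (uM 0) => /le_trans; apply.
have a0 : - 2^-1 < 0 :> R by rewrite oppr_lt0.
have pos t : - 2^-1 <= t -> 2^-1 <= 1 + t by move=> h; lra.
have uab x : - 2^-1 < u x < M + 1.
  by have /andP[h1 h2] := uM x; rewrite (lt_le_trans a0 h1) (le_lt_trans h2)// ltrDl.
have dL t : - 2^-1 <= t -> is_derive t (1 : R) (fun t => ln (1 + t)) (1 + t)^-1.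
  move=> /pos t0; have t1 : 0 < 1 + t by apply: lt_le_trans t0.
  have d1 : is_derive t (1 : R) ((cst 1 : R -> R) + id) (0 + 1) by exact: is_deriveD.
  have t1' : 0 < ((cst 1 : R -> R) + id) t by [].
  have := is_derive1_comp (is_derive1_ln t1') d1.
  by rewrite add0r mulr1.
have := @W_comp (fun t => ln (1 + t)) (fun t => (1 + t)^-1) (- 2^-1) (M + 1) 2 u g.
rewrite addr0 ln1 (_ : (fun x => ln (1 + u x) - 0) = fun x => ln (1 + u x)); last first.
  by apply/funext => x; rewrite subr0.
apply => //.
- by rewrite a0 ltr_wpDl.
- by move=> t /andP[h _]; exact: dL.
- move=> t /andP[/pos h _]; apply: cvgV; first by rewrite gt_eqF// (lt_le_trans _ h).
  by apply: cvgD; [exact: cvg_cst|exact: cvg_id].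
- move=> t /andP[/pos h _]; have h0 : 0 < 1 + t by apply: lt_le_trans h.
  by rewrite ger0_norm ?invr_ge0 ?(ltW h0)// -[leRHS]invrK lef_pV2 ?posrE ?invr_gt0.
- move=> f sf fab j; apply: Ck_ln => [x|].
    by have /andP[/ltW/pos h _] := fab x; apply: lt_le_trans h.
  by apply: CkD; [exact: Ck_cst|exact: sf].
Qed.

Lemma W_sqr M u g : W u g -> (forall x, `|u x| <= M) ->
  W (fun x => u x * u x) (fun x => (2 * u x) *: g x).
Proof.
move=> Wu uM; have M0 : 0 <= M := le_trans (normr_ge0 _) (uM 0).
have uab x : - (M + 1) < u x < M + 1.
  by rewrite -ltr_norml (le_lt_trans (uM x))// ltrDl.
have := @W_comp (fun t => t * t) (fun t => 2 * t) (- (M + 1)) (M + 1) (2 * (M + 1)) u g.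
rewrite mulr0 (_ : (fun x => _ - 0) = fun x => u x * u x); last by apply/funext => x; rewrite subr0.
apply => //.
- by rewrite oppr_lt0 andbb ltr_wpDl.
- by move=> t _; apply: is_derive_eq; rewrite /GRing.scale /=; ring.
- by move=> t _; apply: cvgMr; exact: cvg_id.
- by move=> t tM; rewrite normrM ger0_norm// ler_pM2l// ler_norml.
- by move=> f sf _ j; exact: CkM.
Qed.

(** Polarisation of the chain rule for the square. *)
Lemma W_mul M u g v gv : W u g -> W v gv -> (forall x, `|u x| <= M) ->
  (forall x, `|v x| <= M) ->
  W (fun x => u x * v x) (fun x => v x *: g x + u x *: gv x).
Proof.
move=> Wu Wv uM vM.
have uvM x : `|u x + v x| <= M + M by rewrite (le_trans (ler_normD _ _))// lerD.
have := W_Z oO bO p1 2^-1 (W_B oO bO p1 (W_B oO bO p1 (W_sqr (W_D oO bO p1 Wu Wv) uvM)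
  (W_sqr Wu uM)) (W_sqr Wv vM)).
have E1 : (fun x => 2^-1 * ((u x + v x) * (u x + v x) - u x * u x - v x * v x)) =
  fun x => u x * v x by apply/funext => x; field.
have E2 : (fun x => 2^-1 *: ((2 * (u x + v x)) *: (g x + gv x) - (2 * u x) *: g x -
    (2 * v x) *: gv x)) = fun x => v x *: g x + u x *: gv x.
  by apply/funext => x; apply/rowP => i; rewrite !mxE; field.
by rewrite E1 E2.
Qed.

End chain_rule.

(** * Poincare and Rellich *)

Lemma mul_half_le (R : realType) (e S X : R) : 0 <= e -> 0 <= S -> X <= S ->
  e / (2 * (S + 1)) * X <= e / 2.
Proof.
move=> e0 S0 XS; have S1 : 0 < S + 1 by rewrite ltr_wpDl.
rewrite (_ : e / _ * X = e / 2 * (X / (S + 1))); last by field; rewrite gt_eqF.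
rewrite -[leRHS]mulr1 ler_wpM2l ?divr_ge0// ler_pdivrMr// mul1r (le_trans XS)//.
by rewrite lerDl.
Qed.

Section vector_fields.
Context {R : realType} {n : nat}.
Variables (Omega : set 'rV[R]_n) (p : R).
Hypotheses (oO : open Omega) (bO : bounded_set Omega) (p1 : 1 < p).
Local Notation leb := (lebesgue_rV n).
Local Notation mO := (open_measurable_rV oO).
Local Notation Lpo := (Lp leb Omega p).
Local Notation W := (W01p Omega p).
Implicit Types (u v f : 'rV[R]_n -> R) (g : 'rV[R]_n -> 'rV[R]_n).

Lemma measurable_dotrV g1 g2 : (forall i, measurable_fun Omega (fun x => g1 x ord0 i)) ->
  (forall i, measurable_fun Omega (fun x => g2 x ord0 i)) ->
  measurable_fun Omega (fun x => dotrV (g1 x) (g2 x)).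
Proof.
move=> m1 m2; rewrite /dotrV; apply: measurable_sum => i.
by apply: measurable_funM.
Qed.

Lemma measurable_enorm g : (forall i, measurable_fun Omega (fun x => g x ord0 i)) ->
  measurable_fun Omega (fun x => enorm (g x)).
Proof.
move=> mg; have ms : measurable_fun setT (@Num.sqrt R).
  by apply: continuous_measurable_fun; exact: sqrt_continuous.
exact: measurableT_comp ms (measurable_dotrV mg mg).
Qed.

Lemma Lp_enorm g : (forall i, Lpo (fun x => g x ord0 i)) -> Lpo (fun x => enorm (g x)).
Proof.
move=> Lg; apply: (@Lp_le _ _ _ _ _ mO _ p1 _ (fun x => \sum_i `|g x ord0 i|)).
- by apply: measurable_enorm => i; exact: (Lg i).1.
- move=> x _; rewrite ger0_norm ?enorm_ge0// (le_trans (enorm_le_sum _))//.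
  exact: ler_norm.
- have LN i : Lpo (fun x => `|g x ord0 i|) := Lp_norm mO p1 (Lg i).
  by apply: (Lp_sum mO p1) => i _; exact: LN.
Qed.

Lemma W_enorm u g : W u g -> Lpo (fun x => enorm (g x)).
Proof. by move=> Wu; apply: Lp_enorm => i; exact: (W_Lp_grad oO bO p1 i Wu). Qed.

Lemma enorm_powR_itg g : Lpo (fun x => enorm (g x)) ->
  leb.-integrable Omega (EFin \o (fun x => enorm (g x) `^ p)).
Proof.
by case=> _; rewrite (_ : (fun x => `|_| `^ p) = fun x => enorm (g x) `^ p)//;
  apply/funext => x; rewrite ger0_norm ?enorm_ge0.
Qed.

(** The tangent inequality at the larger of [|s|] and [|t|] bounds the left-hand side by
    [p |s|^(p-1) |s - t|], and Young's inequality with scaled factors splits the product. *)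
Lemma powR_dist_young (e : R) : 0 < e -> exists2 C, 0 <= C & forall s t : R,
  `| `|s| `^ p - `|t| `^ p | <= e * (`|s| `^ p + `|t| `^ p) + C * `|s - t| `^ p.
Proof.
move=> e0; have p0 : 0 < p := lt_trans ltr01 p1.
(* scales the first factor of the product so that its power gets the coefficient [e] *)
pose d := (e / p) `^ p^-1.
have d0 : 0 < d by rewrite powR_gt0// divr_gt0.
have dp : d `^ p = e / p by rewrite /d -powRrM mulVf ?gt_eqF// powRr1// ltW// divr_gt0.
pose C := p * (d `^ (p - 1))^-1 `^ p.
have young (a b : R) : 0 <= a -> 0 <= b -> p * (a `^ (p - 1) * b) <= e * a `^ p + C * b `^ p.
  move=> a0 b0; have dn0 : 0 < d `^ (p - 1) by exact: powR_gt0.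
  set d1 := (d `^ (p - 1))^-1; have d10 : 0 < d1 by rewrite invr_gt0.
  have := powR_mixed p1 (mulr_ge0 (ltW d0) a0) (mulr_ge0 (ltW d10) b0).
  rewrite (powRM (p - 1) (ltW d0) a0) (powRM p (ltW d0) a0) (powRM p (ltW d10) b0) dp => h.
  rewrite (_ : a `^ (p - 1) * b = d `^ (p - 1) * a `^ (p - 1) * (d1 * b)); last first.
    by rewrite /d1; move: (d `^ _) dn0 => k k0; field; rewrite gt_eqF.
  have := h; rewrite -(ler_pM2l p0) => /le_trans; apply; rewrite mulrDr /C -/d1.
  by apply: eq_ler; field; rewrite gt_eqF.
have half (s t : R) : 0 <= s -> 0 <= t -> t <= s ->
    s `^ p - t `^ p <= e * (s `^ p + t `^ p) + C * (s - t) `^ p.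
  move=> s0 t0 ts; have := powR_tangent p1 s0 t0 => h.
  have := young s (s - t) s0; rewrite subr_ge0 => /(_ ts) h2.
  apply: (@le_trans _ _ (p * (s `^ (p - 1) * (s - t)))).
    by rewrite lerBlDr -lerBlDl; move: h; rewrite -mulrA -(opprB s t) mulrN mulrN; lra.
  apply: le_trans h2 _; rewrite lerD2r mulrDr lerDl mulr_ge0 ?powR_ge0// ltW//.
exists C; first by rewrite mulr_ge0 ?powR_ge0// ltW.
have main (s t : R) : `|t| <= `|s| ->
   `| `|s| `^ p - `|t| `^ p | <= e * (`|s| `^ p + `|t| `^ p) + C * `|s - t| `^ p.
  move=> ts; rewrite ger0_norm; last by rewrite subr_ge0 ler_powR2// ltW.
  apply: le_trans (half _ _ (normr_ge0 s) (normr_ge0 t) ts) _; rewrite lerD2l ler_wpM2l//.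
    by rewrite mulr_ge0 ?powR_ge0// ltW.
  by rewrite ler_powR2 ?(ltW p0) ?subr_ge0//; exact: lerB_dist.
move=> s t; have [ts|/ltW st] := leP `|t| `|s|; first exact: main.
by rewrite distrC [`|s - t|]distrC [X in e * X]addrC main.
Qed.

Lemma Np_split u v : Lpo u -> Lpo v -> \int[leb]_(x in Omega) `|u x| `^ p <=
  2 `^ p * (\int[leb]_(x in Omega) `|u x - v x| `^ p + \int[leb]_(x in Omega) `|v x| `^ p).
Proof.
move=> Lu Lv; have := NpD mO p1 (LpB mO p1 Lu Lv) Lv.
have -> : (fun x => `|u x - v x + v x| `^ p) = fun x => `|u x| `^ p; last by [].
by apply/funext => x; rewrite subrK.
Qed.

(** Continuity of [u |-> |u|^p] from L^p to L^1, which makes energies and weighted masses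
    pass to strong limits. *)
Lemma Np_continuous u : Lpo u -> forall e, 0 < e -> exists2 d, 0 < d & forall v, Lpo v ->
  \int[leb]_(x in Omega) `|v x - u x| `^ p <= d ->
  \int[leb]_(x in Omega) `| `|v x| `^ p - `|u x| `^ p | <= e.
Proof.
move=> Lu e e0; set U := \int[leb]_(x in Omega) `|u x| `^ p.
have U0 : 0 <= U by exact: Np_ge0.
have K0 : 0 < 2 `^ p :> R by exact: powR_gt0.
pose S := 2 `^ p * (1 + U) + U.
have S0 : 0 <= S by rewrite addr_ge0// mulr_ge0 ?powR_ge0// addr_ge0.
have eS0 : 0 < e / (2 * (S + 1)) by rewrite divr_gt0// mulr_gt0// ltr_wpDl.
have [C C0 hC] := powR_dist_young eS0.
exists (Num.min 1 (e / (2 * (C + 1)))).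
  by rewrite lt_min ltr01/= divr_gt0// mulr_gt0// ltr_wpDl.
move=> v Lv; rewrite le_min => /andP[d1 d2].
have Vle : \int[leb]_(x in Omega) `|v x| `^ p <= 2 `^ p * (1 + U).
  by apply: le_trans (Np_split Lv Lu) _; rewrite ler_pM2l// lerD2r.
have iv := Lv.2; have iu := Lu.2; have id_ := (LpB mO p1 Lv Lu).2.
apply: (@le_trans _ _ (\int[leb]_(x in Omega) (e / (2 * (S + 1)) * (`|v x| `^ p + `|u x| `^ p) +
   C * `|v x - u x| `^ p))).
  apply: le_Rintegral; [exact: mO|exact: itg_norm (itgB mO iv iu)| |].
    have i1 := itgZ mO (e / (2 * (S + 1))) (itgD mO iv iu).
    have i2 := itgZ mO C id_.
    exact: (itgD mO i1 i2).
  by move=> x _; exact: hC.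
rewrite (RintegralD mO (itgZ mO _ (itgD mO iv iu)) (itgZ mO C id_)).
rewrite (RintegralZl _ mO (itgD mO iv iu)) (RintegralZl _ mO id_) (RintegralD mO iv iu).
rewrite [leRHS]splitr lerD//.
  by apply: mul_half_le; rewrite ?(ltW e0)// /S lerD2r.
apply: (@le_trans _ _ (C * (e / (2 * (C + 1))))); first by rewrite ler_wpM2l.
by rewrite mulrC; apply: mul_half_le => //; exact: ltW.
Qed.

Lemma partial_zero_outside f x i : test_function Omega f -> ~ Omega x -> partial i f x = 0.
Proof. by move=> [_ _ fO] xO; apply: partial_notin_supp => /fO. Qed.

Lemma test_integral_full f : test_function Omega f ->
  \int[leb]_(x in Omega) `|f x| `^ p = \int[leb]_x `|f x| `^ p /\
  forall i, \int[leb]_(x in Omega) `|partial i f x| `^ p = \int[leb]_x `|partial i f x| `^ p.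
Proof.
have pn0 : p != 0 by rewrite gt_eqF// (lt_trans ltr01 p1).
move=> tf; split=> [|i]; apply: Rintegral_zero_outside => // x xO.
  by rewrite (test_zero_outside tf xO) normr0 powR0.
by rewrite (partial_zero_outside i tf xO) normr0 powR0.
Qed.

Lemma W_approx u g e : W u g -> 0 < e -> exists f, [/\ test_function Omega f,
  \int[leb]_(x in Omega) `|f x - u x| `^ p <= e &
  forall i, \int[leb]_(x in Omega) `|partial i f x - g x ord0 i| `^ p <= e].
Proof.
move=> /(W01pP oO bO p1)[Lu Lg [phi [tphi /cvLpP cu cg]]] e0.
have [N1 hN1] := cu e e0.
have /choice[N2 hN2] i : exists N2 : nat, forall m, (N2 <= m)%N ->
    \int[leb]_(x in Omega) `|partial i (phi m) x - g x ord0 i| `^ p <= e.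
  by have /cvLpP/(_ _ e0) := cg i.
exists (phi (maxn N1 (\max_i N2 i))); split; first exact: tphi.
  by apply: hN1; exact: leq_maxl.
by move=> i; apply: hN2; rewrite (leq_trans (leq_bigmax i))// leq_maxr.
Qed.

Lemma Int_coord_le_enorm u g i : W u g ->
  \int[leb]_(x in Omega) `|g x ord0 i| `^ p <= \int[leb]_(x in Omega) enorm (g x) `^ p.
Proof.
move=> Wu; apply: le_Rintegral; [exact: mO|exact: (W_Lp_grad oO bO p1 i Wu).2| |].
  exact: enorm_powR_itg (W_enorm Wu).
move=> x _; rewrite ler_powR2 ?coord_le_enorm//.
exact: ltW (lt_trans ltr01 p1).
Qed.

End vector_fields.

Section rellich.
Context {R : realType} {n : nat}.
Variables (Omega : set 'rV[R]_n.+1) (p : R).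
Hypotheses (oO : open Omega) (bO : bounded_set Omega) (p1 : 1 < p).
Local Notation leb := (lebesgue_rV n.+1).
Local Notation mO := (open_measurable_rV oO).
Local Notation Lpo := (Lp leb Omega p).
Local Notation cv := (cvLp leb Omega p).
Local Notation W := (W01p Omega p).
Implicit Types (u v f : 'rV[R]_n.+1 -> R) (g : 'rV[R]_n.+1 -> 'rV[R]_n.+1).

(** The inequality for test functions passes to the limit. *)
Lemma poincare_W : exists2 K, 0 < K & forall u g, W u g ->
  \int[leb]_(x in Omega) `|u x| `^ p <= K * \int[leb]_(x in Omega) enorm (g x) `^ p.
Proof.
have [B B0 tB] := test_C1c bO; pose b : R := (B + B) `^ p; pose k : R := 2 `^ p.
have b0 : 0 < b by rewrite powR_gt0// addr_gt0.
have k0 : 0 < k by exact: powR_gt0.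
exists (k * (b * k)); first by rewrite !mulr_gt0.
move=> u g Wu; apply/ler_addgt0Pl => e e0.
pose d := e / (k * (1 + b * k)).
have d0 : 0 < d by rewrite divr_gt0// mulr_gt0// addr_gt0// mulr_gt0.
have [f [tf fu fg]] := W_approx oO bO p1 Wu d0.
have Lu := W_Lp oO bO p1 Wu; have [Lf Ldf] := test_Lp oO bO p1 tf.
have Lg i := W_Lp_grad oO bO p1 i Wu.
have h1 := Np_split oO p1 Lu Lf.
have h2 := Np_split oO p1 (Ldf ord0) (Lg ord0).
have h3 := poincare_C1c p1 B0 (tB _ tf).
have [F1 F2] := test_integral_full p1 tf.
rewrite -F1 -F2 in h3.
have h4 := Int_coord_le_enorm oO bO p1 ord0 Wu.
have h5 := fu; rewrite Np_distC in h5.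
have h6 := fg ord0.
have arith (x1 x2 x3 x4 x5 x6 x7 : R) : x1 <= k * (x2 + x3) -> x3 <= b * x4 ->
    x4 <= k * (x5 + x6) -> x6 <= x7 -> x2 <= d -> x5 <= d -> x1 <= k * (d + b * (k * (d + x7))).
  move=> i1 i2 i3 i4 i5 i6; apply: le_trans i1 _; rewrite ler_pM2l// lerD//.
  apply: le_trans i2 _; rewrite ler_pM2l//; apply: le_trans i3 _.
  by rewrite ler_pM2l// lerD.
apply: (le_trans (arith _ _ _ _ _ _ _ h1 h3 h2 h4 h5 h6)).
apply: eq_ler; rewrite /d; field.
by rewrite gt_eqF// ?addr_gt0 ?mulr_gt0//= gt_eqF.
Qed.

(** Compactness of a segment; an ultrafilter spares the successive extraction of
    subsequences for the functionals of each Ehrling inequality. *)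
Lemma ultra_cvg_bounded (U : set_system nat) (f : nat -> R) M : UltraFilter U ->
  (forall k, `|f k| <= M) -> exists c : R, forall e, 0 < e -> U [set k | `|f k - c| <= e].
Proof.
move=> UU fM; have PF : ProperFilter U := ultra_proper.
have fU : (f @ U) `[- M, M]%classic.
  by apply: (@filterS _ U _ setT) => [k _|]; [rewrite /= in_itv/= -ler_norml|exact: filterT].
have [c [_ cc]] := @segment_compact R (- M) M (f @ U) _ fU.
exists c => e e0; have [//|Un] := in_ultra_setVsetC [set k | `|f k - c| <= e] UU.
have Fe : (f @ U) [set y | ~ (`|y - c| <= e)] by exact: Un.
have [y [/= yc]] := cc _ _ Fe (nbhsx_ballx c e e0).
by rewrite /ball /= => cy; exfalso; apply: yc; rewrite distrC ltW.
Qed.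

(** A bounded sequence of test functions is Cauchy along an ultrafilter, since the
    finitely many functionals of each Ehrling inequality converge along it. *)
Lemma rellich_test (phi : nat -> 'rV[R]_n.+1 -> R) M :
  (forall k, test_function Omega (phi k)) ->
  (forall k, \int[leb]_(x in Omega) `|phi k x| `^ p <= M) ->
  (forall k i, \int[leb]_(x in Omega) `|partial i (phi k) x| `^ p <= M) ->
  exists2 s : nat -> nat, (forall k, (k <= s k)%N) &
    forall e, 0 < e -> exists N, forall j k, (N <= j)%N -> (N <= k)%N ->
      \int[leb]_(x in Omega) `|phi (s j) x - phi (s k) x| `^ p <= e.
Proof.
move=> tphi uM gM; have p0 : 0 < p := lt_trans ltr01 p1.
have [B B0 tB] := test_C1c bO.
have M0 : 0 <= M := le_trans (Np_ge0 _ _ _ _) (uM 0%N).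
have [U [UU Uoo]] := @ultraFilterLemma _ \oo _.
have PF : ProperFilter U := ultra_proper.
have FU : Filter U := filter_filter.
have tB' j k : test_function Omega (fun x => phi j x - phi k x).
  have := test_functionD (tphi j) (test_functionZ (-1) (tphi k)).
  by rewrite (_ : (fun x => _ + _) = fun x => phi j x - phi k x)//; apply/funext => x; rewrite mulN1r.
have dB j k i : partial i (fun x => phi j x - phi k x) = fun x => partial i (phi j) x - partial i (phi k) x.
  apply/funext => x.
  exact: deriveB (test_derivable (x:=x) (i:=i) (tphi j)) (test_derivable (x:=x) (i:=i) (tphi k)).
have key (e : R) : 0 < e -> exists2 A, U A & forall j k, A j -> A k ->
    \int[leb]_(x in Omega) `|phi j x - phi k x| `^ p <= e.
  move=> e0; pose S : R := n.+1%:R * (2 `^ p * (M + M)).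
  have S0 : 0 <= S by rewrite mulr_ge0// mulr_ge0 ?powR_ge0// addr_ge0.
  have e'0 : 0 < e / (2 * (S + 1)) by rewrite divr_gt0// mulr_gt0// ltr_wpDl.
  have [I [l [K [C [K0 C0 lB lK hE]]]]] := ehrling_C1c p1 n.+1 B0 e'0.
  pose I' : R := #|I|%:R; have I'0 : 0 <= I' by [].
  pose q := e / (2 * (C * I' + 1)).
  have q0 : 0 < q by rewrite divr_gt0// mulr_gt0// ltr_wpDl// mulr_ge0.
  pose dl := q `^ p^-1 / 2; have dl0 : 0 < dl by rewrite divr_gt0// powR_gt0.
  have /choice[c hc] i : exists c : R, forall e, 0 < e -> U [set k | `|l i (phi k) - c| <= e].
    apply: (@ultra_cvg_bounded _ _ ((K * M) `^ p^-1)) => // k.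
    have h : `|l i (phi k)| `^ p <= K * M.
      apply: le_trans (lK i _ (tB _ (tphi k))) _; rewrite ler_wpM2l//.
      by rewrite -(test_integral_full p1 (tphi k)).1.
    have pi0 : 0 <= p^-1 by rewrite invr_ge0 ltW.
    have := ler_powR2 pi0 (powR_ge0 _ _) h.
    by rewrite -powRrM divff ?gt_eqF// powRr1.
  exists [set k | forall i, `|l i (phi k) - c i| <= dl].
    by apply: filter_forall => i; exact: hc.
  move=> j k Aj Ak; have tjk := tB' j k.
  have [F1 F2] := test_integral_full p1 tjk.
  rewrite F1; apply: le_trans (hE _ (tB _ tjk)) _; rewrite [leRHS]splitr lerD//.
    apply: (@le_trans _ _ (e / (2 * (S + 1)) * S)).
      rewrite ler_pM2l// /S -[X in X%:R * _](card_ord n.+1) mulr_natl -sumr_const.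
      apply: ler_sum => i _; rewrite -F2 dB.
      have := NpD mO p1 ((test_Lp oO bO p1 (tphi j)).2 i) (LpZ mO (-1) ((test_Lp oO bO p1 (tphi k)).2 i)).
      have -> : (fun x => `|partial i (phi j) x + -1 * partial i (phi k) x| `^ p) =
        fun x => `|partial i (phi j) x - partial i (phi k) x| `^ p.
        by apply/funext => x; rewrite mulN1r.
      have -> : (fun x => `|-1 * partial i (phi k) x| `^ p) = fun x => `|partial i (phi k) x| `^ p.
        by apply/funext => x; rewrite mulN1r normrN.
      by move=> /le_trans; apply; rewrite ler_pM2l ?powR_gt0// lerD.
    by apply: mul_half_le => //; exact: ltW.
  apply: (@le_trans _ _ (C * (I' * q))).
    rewrite ler_wpM2l// /I' mulr_natl -sumr_const; apply: ler_sum => i _.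
    rewrite (lB i _ _ (tB _ (tphi j)) (tB _ (tphi k))).
    have h : `|l i (phi j) - l i (phi k)| <= q `^ p^-1.
      rewrite [leRHS]splitr; apply: le_trans (ler_distD (c i) _ _) _.
      by apply: lerD; [exact: (Aj i)|rewrite distrC; exact: (Ak i)].
    have := ler_powR2 (ltW p0) (normr_ge0 _) h.
    by rewrite -powRrM mulVf ?gt_eqF// powRr1 ?(ltW q0).
  rewrite mulrA mulrC; apply: mul_half_le; rewrite ?(ltW e0)//.
  exact: mulr_ge0.
(* one member of the ultrafilter for each precision; [s m] is taken in the first [m + 1] of them *)
have /choice[A hA] m : exists A, U A /\ forall j k, A j -> A k ->
    \int[leb]_(x in Omega) `|phi j x - phi k x| `^ p <= m.+1%:R^-1.
  have [|A UA hA] := key m.+1%:R^-1; first by rewrite invr_gt0 ltr0n.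
  by exists A.
have /choice[s hs] m : exists k, (m <= k)%N /\ forall l : 'I_m.+1, A l k.
  have UA : U [set k | forall l : 'I_m.+1, A l k].
    by apply: filter_forall => l; exact: (hA l).1.
  have Um : U [set k | (m <= k)%N] by apply: Uoo; exists m.
  by have [k [mk Ak]] := filter_ex (filterI Um UA); exists k.
exists s; first by move=> k; case: (hs k).
move=> e e0; have [m me] : exists m : nat, m.+1%:R^-1 <= e.
  have /cvgrPdist_le/(_ e e0)[m _ hm] := @cvg_harmonic R.
  by exists m; have := hm m (leqnn m); rewrite /= sub0r normrN ger0_norm.
exists m => j k mj mk; apply: le_trans me.
have inA r : (m <= r)%N -> A m (s r).
  by rewrite -ltnS => mr; exact: ((hs r).2 (Ordinal mr)).
by apply: (hA m).2; exact: inA.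
Qed.

(** Replace each [u_ k] by a test function within [1 / (k + 1)], then use compactness for
    test functions and completeness of L^p. *)
Theorem rellich_W (u_ : nat -> 'rV[R]_n.+1 -> R) (g_ : nat -> 'rV[R]_n.+1 -> 'rV[R]_n.+1) M :
  (forall k, W (u_ k) (g_ k)) ->
  (forall k, \int[leb]_(x in Omega) enorm (g_ k x) `^ p <= M) ->
  exists2 s : nat -> nat, (forall k, (k <= s k)%N) &
    exists2 u, Lpo u & cv (fun k => u_ (s k)) u.
Proof.
move=> Wk gM; pose K : R := 2 `^ p; have K0 : 0 < K by exact: powR_gt0.
have [P P0 hP] := poincare_W.
have e0 k : 0 < (k.+1%:R^-1 : R) by rewrite invr_gt0 ltr0n.
have /choice[phi hphi] := fun k => W_approx oO bO p1 (Wk k) (e0 k).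
have e1 k : (k.+1%:R^-1 : R) <= 1 by rewrite invf_le1 ?ltr0n// ler1n.
have tphi k : test_function Omega (phi k) by case: (hphi k).
have Lphi k := (test_Lp oO bO p1 (tphi k)).1.
have Lk k := W_Lp oO bO p1 (Wk k).
have phiu k : \int[leb]_(x in Omega) `|phi k x - u_ k x| `^ p <= k.+1%:R^-1 by case: (hphi k).
have gM0 : 0 <= M by apply: le_trans (gM 0%N); apply: Rintegral_ge0 => x _; exact: powR_ge0.
have uM k : \int[leb]_(x in Omega) `|phi k x| `^ p <= K * (1 + (P * M + M)).
  apply: le_trans (Np_split oO p1 (Lphi k) (Lk k)) _; rewrite ler_pM2l// lerD//.
    exact: le_trans (phiu k) (e1 k).
  apply: le_trans (hP _ _ (Wk k)) _; apply: (@le_trans _ _ (P * M)); last by rewrite lerDl.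
  by rewrite ler_pM2l.
have gM' k i : \int[leb]_(x in Omega) `|partial i (phi k) x| `^ p <= K * (1 + (P * M + M)).
  apply: le_trans (Np_split oO p1 ((test_Lp oO bO p1 (tphi k)).2 i) (W_Lp_grad oO bO p1 i (Wk k))) _.
  rewrite ler_pM2l// lerD//.
    by apply: le_trans (e1 k); case: (hphi k) => _ _; exact.
  apply: le_trans (Int_coord_le_enorm oO bO p1 i (Wk k)) _; apply: le_trans (gM k) _.
  by rewrite lerDr mulr_ge0// ltW.
have [s sk cauchy] := rellich_test tphi uM gM'.
have [u Lu cu] := Lp_complete mO p1 (fun k => Lphi (s k)) cauchy.
exists s; [exact: sk|exists u; [exact: Lu|]].
rewrite /cvLp.
apply: (@squeeze0 _ _ (fun k => K * (k.+1%:R^-1 + \int[leb]_(x in Omega) `|phi (s k) x - u x| `^ p))).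
  move=> k; rewrite Np_ge0/=; apply: le_trans (Np_triangle mO p1 (Lk (s k)) (Lphi (s k)) Lu) _.
  rewrite ler_pM2l// lerD2r Np_distC (le_trans (phiu (s k)))//.
  by rewrite lef_pV2 ?posrE ?ltr0n// ler_nat ltnS.
by apply: cvgZ0; apply: cvgD0 => //; exact: cvg_harmonic.
Qed.

End rellich.

(** * Minimisation of the energy *)

Section euclidean_convexity.
Context {R : realType} {n : nat}.
Variable p : R.
Hypothesis p1 : 1 < p.
Implicit Types a b z : 'rV[R]_n.

Definition midpoint_gap a b : R :=
  (enorm a `^ p + enorm b `^ p) / 2 - enorm (2^-1 *: (a + b)) `^ p.

Lemma midpoint_gap_ge a b : 0 <= midpoint_gap a b /\ (midpoint_gap a b = 0 -> a = b).
Proof.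
rewrite /midpoint_gap; set m := 2^-1 *: (a + b).
have am : a - m = 2^-1 *: (a - b) by apply/rowP => i; rewrite !mxE; field.
have bm : b - m = - (2^-1 *: (a - b)) by apply/rowP => i; rewrite !mxE; field.
have ta := plap_tangent m a p1; have tb := plap_tangent m b p1.
rewrite am in ta; rewrite bm dotrVNr mulrN in tb.
set D := enorm m `^ (p - 2) * _ in ta tb.
split.
  move: ta tb; clearbody D; rewrite !mulrN.
  move: (enorm m `^ p) (enorm a `^ p) (enorm b `^ p) (p * D) => x y z d; lra.
move=> E; apply/eqP; apply: contraT => ab.
have ma : m != a.
  apply: contra_neq ab => ma; apply/eqP; rewrite -subr_eq0.
  have : 2^-1 *: (a - b) == 0 by rewrite -am ma subrr.
  by rewrite scaler_eq0 invr_eq0 pnatr_eq0.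
have := plap_tangent_lt p1 ma; rewrite am -/D.
move: tb E; clearbody D; rewrite !mulrN.
move: (enorm m `^ p) (enorm a `^ p) (enorm b `^ p) (p * D) => x y z d; lra.
Qed.

Lemma enorm_powR_continuous : continuous (fun z => enorm z `^ p).
Proof.
have -> : (fun z => enorm z `^ p) = fun z => `|enorm z| `^ p.
  by apply/funext => z; rewrite ger0_norm ?enorm_ge0.
by apply: continuous_abs_powR; [exact: lt_trans ltr01 p1|exact: enorm_continuous].
Qed.

Lemma enormZ_powR t z : 0 <= t -> enorm (t *: z) `^ p = t `^ p * enorm z `^ p.
Proof. by move=> t0; rewrite enormZ powRM ?enorm_ge0// ger0_norm. Qed.

Lemma enorm_dist_le a b : `|enorm a - enorm b| <= enorm (a - b).
Proof.
have h1 := enormD (a - b) b; have h2 := enormD (b - a) a.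
rewrite subrK in h1; rewrite subrK -(opprB a b) enormN in h2.
by rewrite ler_norml; lra.
Qed.

Lemma enorm_powR_le z : enorm z `^ p <= n%:R `^ p * \sum_i `|z ord0 i| `^ p.
Proof.
have p0 : 0 < p := lt_trans ltr01 p1; set S := \sum_i _.
have S0 : 0 <= S by apply: sumr_ge0 => i _; exact: powR_ge0.
have zS i : `|z ord0 i| <= S `^ p^-1.
  have pi0 : 0 <= p^-1 by rewrite invr_ge0 ltW.
  have h : `|z ord0 i| `^ p <= S.
    by rewrite /S (bigD1 i)//= lerDl; apply: sumr_ge0 => j _; exact: powR_ge0.
  by have := ler_powR2 pi0 (powR_ge0 _ _) h; rewrite -powRrM divff ?gt_eqF// powRr1.
have h : enorm z <= n%:R * S `^ p^-1.
  apply: le_trans (enorm_le_sum z) _.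
  rewrite -[X in X%:R * _](card_ord n) mulr_natl -sumr_const.
  by apply: ler_sum => i _; exact: zS.
have := ler_powR2 (ltW p0) (enorm_ge0 z) h.
by rewrite powRM ?powR_ge0// -powRrM mulVf ?gt_eqF// powRr1.
Qed.

End euclidean_convexity.

(** Uniform convexity of [|.|^p], obtained by compactness of the unit sphere from
    strict convexity; it upgrades convergence of the energies of a minimising
    sequence to strong convergence of the gradients. *)
Lemma uniform_convexity (R : realType) (n : nat) (p e : R) : 1 < p -> 0 < e ->
  exists2 C : R, 0 <= C & forall a b : 'rV[R]_n,
  enorm (a - b) `^ p <= e * (enorm a `^ p + enorm b `^ p) + C * midpoint_gap p a b.
Proof.
move=> p1 e0; have p0 : 0 < p := lt_trans ltr01 p1.
pose l (z : 'rV[R]_(n + n)) : 'rV[R]_n := lsubmx z.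
pose r (z : 'rV[R]_(n + n)) : 'rV[R]_n := rsubmx z.
have cl : continuous l.
  move=> z; apply: cvg_rV => i; rewrite (_ : (fun z => _) = fun z : 'rV[R]_(n + n) => z ord0 (lshift n i)).
    exact: coord_continuous.
  by apply/funext => y; rewrite /l mxE.
have cr : continuous r.
  move=> z; apply: cvg_rV => i; rewrite (_ : (fun z => _) = fun z : 'rV[R]_(n + n) => z ord0 (rshift n i)).
    exact: coord_continuous.
  by apply/funext => y; rewrite /r mxE.
have cE (f : 'rV[R]_(n + n) -> 'rV[R]_n) : continuous f -> continuous (fun z => enorm (f z) `^ p).
  move=> cf z; apply: (@continuous_comp _ _ _ f (fun y => enorm y `^ p)); first exact: cf.
  exact: enorm_powR_continuous.
have lZ t z : l (t *: z) = t *: l z by apply/rowP => i; rewrite !mxE.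
have rZ t z : r (t *: z) = t *: r z by apply/rowP => i; rewrite !mxE.
have cP : continuous (fun z => enorm (l z - r z) `^ p).
  by apply: (cE (fun z => l z - r z)) => z; exact: (cvgB (cl z) (cr z)).
have comb (f h : 'rV[R]_(n + n) -> R) (a b : R) : continuous f -> continuous h ->
    continuous (fun z => f z * a - b * h z).
  by move=> cf ch z; exact: (cvgB (cvgM (cf z) (cvg_cst a)) (cvgM (cvg_cst b) (ch z))).
have cQ : continuous (fun z => midpoint_gap p (l z) (r z)).
  rewrite (_ : (fun z => _) = fun z => (enorm (l z) `^ p + enorm (r z) `^ p) / 2 -
      2^-1 `^ p * enorm (l z + r z) `^ p).
    apply: (comb (fun z => enorm (l z) `^ p + enorm (r z) `^ p) (fun z => enorm (l z + r z) `^ p)).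
      by move=> z; exact: (cvgD (cE l cl z) (cE r cr z)).
    by apply: (cE (fun z => l z + r z)) => y; exact: (cvgD (cl y) (cr y)).
  by apply/funext => z; rewrite /midpoint_gap enormZ_powR.
have hP t z : 0 <= t -> enorm (l (t *: z) - r (t *: z)) `^ p = t `^ p * enorm (l z - r z) `^ p.
  by move=> t0; rewrite lZ rZ -scalerBr enormZ_powR.
have hQ t z : 0 <= t -> midpoint_gap p (l (t *: z)) (r (t *: z)) = t `^ p * midpoint_gap p (l z) (r z).
  move=> t0; rewrite /midpoint_gap lZ rZ -scalerDr scalerA mulrC -scalerA !enormZ_powR//.
  move: (t `^ p) (enorm (l z) `^ p) (enorm (r z) `^ p) (2^-1 `^ p) (enorm _ `^ p) => x1 x2 x3 x4 x5.
  by field.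
have Q0 z : midpoint_gap p (l z) (r z) = 0 -> enorm (l z - r z) `^ p <= 0.
  by move=> /(midpoint_gap_ge p1 _ _).2 ->; rewrite subrr enorm0 powR0// gt_eqF.
have [C C0 hC] := homogeneous_le p0 cP cQ hP hQ (fun z => (midpoint_gap_ge p1 _ _).1) Q0 e0.
exists C => // a b; have := hC (row_mx a b).
have -> : l (row_mx a b) = a by exact: row_mxKl.
have -> : r (row_mx a b) = b by exact: row_mxKr.
move=> /le_trans; apply; rewrite lerD2r ler_pM2l//.
have h : `|row_mx a b| <= Num.max (enorm a) (enorm b).
  apply: norm_rV_le => [|i]; first by rewrite le_max enorm_ge0.
  rewrite mxE; case: splitP => j _; rewrite le_max coord_le_enorm ?orbT//.
apply: le_trans (ler_powR2 (ltW p0) (normr_ge0 _) h) _.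
by rewrite /Num.max; case: ifP => _; rewrite ?lerDl ?lerDr powR_ge0.
Qed.

Section minimisation.
Context {R : realType} {n : nat}.
Variables (Omega : set 'rV[R]_n.+1) (p : R).
Hypotheses (oO : open Omega) (bO : bounded_set Omega) (p1 : 1 < p).
Local Notation leb := (lebesgue_rV n.+1).
Local Notation mO := (open_measurable_rV oO).
Local Notation Lpo := (Lp leb Omega p).
Local Notation cv := (cvLp leb Omega p).
Local Notation W := (W01p Omega p).
Local Notation E g := (\int[leb]_(x in Omega) enorm (g x) `^ p).
Implicit Types (u v f psi : 'rV[R]_n.+1 -> R) (g gpsi : 'rV[R]_n.+1 -> 'rV[R]_n.+1).

Definition Lp_continuous (Phi : ('rV[R]_n.+1 -> R) -> R) := forall u, Lpo u ->
  forall e, 0 < e -> exists2 d, 0 < d & forall v, Lpo v ->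
  \int[leb]_(x in Omega) `|v x - u x| `^ p <= d -> `|Phi v - Phi u| <= e.

Lemma vLp_B g1 g2 : (forall i, Lpo (fun x => g1 x ord0 i)) ->
  (forall i, Lpo (fun x => g2 x ord0 i)) -> forall i, Lpo (fun x => (g1 x - g2 x) ord0 i).
Proof.
move=> L1 L2 i; rewrite (_ : (fun x => _) = fun x => g1 x ord0 i - g2 x ord0 i).
  exact: (LpB mO p1 (L1 i) (L2 i)).
by apply/funext => x; rewrite !mxE.
Qed.

Lemma mean_scaled (x y z : R) : (x + y) / 2 - z = p * ((x / p + y / p) / 2 - z / p).
Proof. by field; rewrite gt_eqF// (lt_trans ltr01 p1). Qed.

(** [x1], [x2] and [x3] stand for the energies, divided by [p], of two late terms of a minimising
    sequence and of their midpoint, [pj], [pk] and [pw] for the values of the functional there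
    and [pu] for its value at the limit. *)
Lemma gap_arith (m eta x1 x2 x3 pu pw pj pk ej ek : R) : m <= x3 - pw ->
  x1 - pj <= m + ej -> x2 - pk <= m + ek -> ej <= eta -> ek <= eta ->
  `|pj - pu| <= eta -> `|pk - pu| <= eta -> `|pw - pu| <= eta ->
  (x1 + x2) / 2 - x3 <= 3 * eta.
Proof.
rewrite !ler_norml => h1 h2 h3 h4 h5 /andP[h6 h7] /andP[h8 h9] /andP[h10 h11]; lra.
Qed.

(** The same bookkeeping at the limit itself, [xk] and [x] being energies. *)
Lemma lsc_arith (m e xk x pk pu ek : R) : `|xk - x| <= p * (e / 3) -> xk / p - pk <= m + ek ->
  ek <= e / 3 -> `|pk - pu| <= e / 3 -> x / p - pu <= e + m.
Proof.
have p0 : 0 < p := lt_trans ltr01 p1.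
rewrite !ler_norml => /andP[h1 _] h2 h3 /andP[_ h4].
have h : x / p <= xk / p + e / 3.
  by rewrite ler_pdivrMr// mulrDl divfK ?gt_eqF// [e / 3 * p]mulrC; clear -h1; lra.
clear -h h2 h3 h4; lra.
Qed.

Lemma mul_quarters (d k : R) : 0 < k -> k * (d / (k * 2) + d / (k * 2)) = d.
Proof. by move=> k0; field; rewrite gt_eqF. Qed.

Lemma Np_midpoint u v1 v2 : Lpo v1 -> Lpo v2 -> Lpo u ->
  \int[leb]_(x in Omega) `|2^-1 * (v1 x + v2 x) - u x| `^ p <= 2 `^ p *
  (\int[leb]_(x in Omega) `|v1 x - u x| `^ p + \int[leb]_(x in Omega) `|v2 x - u x| `^ p).
Proof.
move=> L1 L2 Lu; have p0 : 0 < p := lt_trans ltr01 p1.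
have LA := LpB mO p1 L1 Lu; have LB := LpB mO p1 L2 Lu.
have := NpD mO p1 (LpZ mO 2^-1 LA) (LpZ mO 2^-1 LB).
have -> : (fun x => `|2^-1 * (v1 x - u x) + 2^-1 * (v2 x - u x)| `^ p) =
    fun x => `|2^-1 * (v1 x + v2 x) - u x| `^ p.
  by apply/funext => x; congr (`| _ | `^ p); field.
move=> /le_trans; apply; rewrite (NpZ mO _ LA) (NpZ mO _ LB).
have h1 : `|2^-1 : R| `^ p <= 1.
  have E1 : (1 : R) `^ p = 1 by rewrite powR1.
  have i0 : 0 <= 2^-1 :> R by [].
  have i1 : 2^-1 <= 1 :> R by rewrite invf_le1 ?ltr0n// ler1n.
  by rewrite ger0_norm// -[leRHS]E1; exact: ler_powR2 (ltW p0) i0 i1.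
have hh y : 0 <= y -> `|2^-1 : R| `^ p * y <= y.
  by move=> y0; rewrite -[leRHS]mul1r; exact: ler_wpM2r.
apply: ler_wpM2l; first exact: powR_ge0.
by apply: lerD; apply: hh; exact: Np_ge0.
Qed.

Lemma energy_cvg (g_ : nat -> 'rV[R]_n.+1 -> 'rV[R]_n.+1) g :
  (forall k i, Lpo (fun x => g_ k x ord0 i)) -> (forall i, Lpo (fun x => g x ord0 i)) ->
  (forall i, cv (fun k x => g_ k x ord0 i) (fun x => g x ord0 i)) ->
  forall e, 0 < e -> exists K, forall k, (K <= k)%N -> `|E (g_ k) - E g| <= e.
Proof.
move=> Lg_ Lg cg e e0; have p0 : 0 < p := lt_trans ltr01 p1.
have Lek k := Lp_enorm oO p1 (Lg_ k); have Le := Lp_enorm oO p1 Lg.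
have cE : cv (fun k x => enorm (g_ k x)) (fun x => enorm (g x)).
  rewrite /cvLp; apply: (@squeeze0 _ _ (fun k => n.+1%:R `^ p *
    \sum_i \int[leb]_(x in Omega) `|g_ k x ord0 i - g x ord0 i| `^ p)) => [k|].
    have iD i := (LpB mO p1 (Lg_ k i) (Lg i)).2.
    rewrite Np_ge0/= -(Int_sum mO _ (fun i _ => iD i)).
    have iS := itg_sum mO (index_enum 'I_n.+1) (P := xpredT) (fun i _ => iD i).
    rewrite -(RintegralZl _ mO iS).
    apply: le_Rintegral; [exact: mO|exact: (LpB mO p1 (Lek k) Le).2|exact: (itgZ mO _ iS)|].
    move=> x _; apply: (@le_trans _ _ (enorm (g_ k x - g x) `^ p)).
      by rewrite ler_powR2 ?(ltW p0)// enorm_dist_le.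
    apply: le_trans (enorm_powR_le p1 _) _; rewrite ler_pM2l ?powR_gt0 ?ltr0n//.
    by apply: ler_sum => i _; rewrite !mxE.
  apply: cvgZ0; rewrite [X in _ --> X](_ : _ = \sum_(i < n.+1) (0 : R)); last by rewrite sumr_const mul0rn.
  by apply: cvg_big => [|i _]; [exact: add_continuous|exact: cg].
have [d d0 hd] := Np_continuous oO p1 Le e0.
have /cvLpP/(_ d d0)[K hK] := cE; exists K => k Kk.
have iE k' := (Lek k').2.
have EE g' : E g' = \int[leb]_(x in Omega) `|enorm (g' x)| `^ p.
  by congr Rintegral; apply/funext => x; rewrite ger0_norm ?enorm_ge0.
rewrite !EE -(RintegralB mO (iE k) Le.2).
apply: le_trans (le_normr_Rintegral mO (itgB mO (iE k) Le.2)) _.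
exact: hd (Lek k) (hK k Kk).
Qed.

(** Direct method. Coercivity bounds the gradients of a minimising sequence, so Rellich's
    theorem yields a limit in L^p of a subsequence; since midpoints are competitors, the
    integrals of the midpoint gaps tend to zero, and by uniform convexity the gradients are
    Cauchy. Strong convergence makes the energy continuous along the sequence. *)
Theorem minimiser (Phi : ('rV[R]_n.+1 -> R) -> R) a b : 0 < a -> Lp_continuous Phi ->
  (forall u g, W u g -> a * E g - b <= E g / p - Phi u) ->
  exists u g, W u g /\ forall v gv, W v gv -> E g / p - Phi u <= E gv / p - Phi v.
Proof.
move=> a0 cPhi coer; have p0 : 0 < p := lt_trans ltr01 p1.
have E0 g : 0 <= E g by apply: Rintegral_ge0 => x _; exact: powR_ge0.
pose S := [set r | exists v gv, W v gv /\ r = E gv / p - Phi v].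
have infS : has_inf S.
  split.
    exists (E (fun=> 0 : 'rV[R]_n.+1) / p - Phi (fun=> 0)), (fun=> 0), (fun=> 0).
    by split; [exact: W_0|].
  exists (- b) => r [v [gv [Wv ->]]]; apply: le_trans (coer _ _ Wv).
  by rewrite lerDr mulr_ge0// ltW.
pose m := inf S.
have mS v gv : W v gv -> m <= E gv / p - Phi v.
  by move=> Wv; apply: ge_inf infS.2 _ _; exists v, gv.
have e0 k : 0 < (k.+1%:R^-1 : R) by rewrite invr_gt0 ltr0n.
have e1 k : (k.+1%:R^-1 : R) <= 1 by rewrite invf_le1 ?ltr0n// ler1n.
have /choice[ug hug] k : exists ug, W ug.1 ug.2 /\ E ug.2 / p - Phi ug.1 <= m + k.+1%:R^-1.
  have [r [v [gv [Wv ->]]] /ltW h] := inf_adherent (e0 k) infS.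
  by exists (v, gv).
pose M := (m + 1 + b) / a.
have EM k : E (ug k).2 <= M.
  rewrite /M ler_pdivlMr// mulrC; have [Wk hk] := hug k.
  have h1 := coer _ _ Wk; have h2 := e1 k.
  move: hk h1 h2; move: (_ / p - _) (a * _) (k.+1%:R^-1 : R) => x y z; lra.
have [s sk [u Lu cu]] := rellich_W oO bO p1 (fun k => (hug k).1) EM.
pose v k := (ug (s k)).1; pose h k := (ug (s k)).2.
have Wk k : W (v k) (h k) := (hug (s k)).1.
have Jk k : E (h k) / p - Phi (v k) <= m + k.+1%:R^-1.
  by apply: le_trans (hug (s k)).2 _; rewrite lerD2l lef_pV2 ?posrE ?ltr0n// ler_nat ltnS.
have EhM k : E (h k) <= M := EM (s k).
have Lv k := W_Lp oO bO p1 (Wk k).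
have Lh k i := W_Lp_grad oO bO p1 i (Wk k).
have M0 : 0 <= M := le_trans (E0 (h 0%N)) (EhM 0%N).
have small (e : R) : 0 < e -> exists K : nat, forall k, (K <= k)%N -> (k.+1%:R^-1 : R) <= e.
  move=> ee; have /cvgrPdist_le/(_ e ee)[K _ hK] := @cvg_harmonic R.
  by exists K => k Kk; have := hK k Kk; rewrite /= sub0r normrN ger0_norm// ltW.
have cauchy (e : R) : 0 < e -> exists K, forall j k, (K <= j)%N -> (K <= k)%N ->
    E (fun x => h j x - h k x) <= e.
  move=> ee; have MM0 : 0 <= M + M by exact: addr_ge0.
  have e10 : 0 < e / (2 * (M + M + 1)) by rewrite divr_gt0// mulr_gt0// ltr_wpDl.
  have [C C0 hC] := uniform_convexity n.+1 p1 e10.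
  pose X := C * (3 * p); have X0 : 0 <= X by rewrite mulr_ge0// mulr_ge0// ltW.
  pose eta := e / (2 * (X + 1)).
  have eta0 : 0 < eta by rewrite divr_gt0// mulr_gt0// ltr_wpDl.
  have [d d0 hd] := cPhi u Lu _ eta0.
  pose k2 : R := 2 `^ p; have k20 : 0 < k2 by exact: powR_gt0.
  have dd0 : 0 < Num.min d (d / (k2 * 2)) by rewrite lt_min d0 divr_gt0// mulr_gt0.
  have /cvLpP/(_ _ dd0)[K1 hK1] := cu; have [K2 hK2] := small _ eta0.
  exists (maxn K1 K2) => j k; rewrite !geq_max => /andP[j1 j2] /andP[k1' k2'].
  have /andP[vj1 vj2] : (\int[leb]_(x in Omega) `|v j x - u x| `^ p <= d) &&
      (\int[leb]_(x in Omega) `|v j x - u x| `^ p <= d / (k2 * 2)).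
    by rewrite -le_min; exact: hK1.
  have /andP[vk1 vk2] : (\int[leb]_(x in Omega) `|v k x - u x| `^ p <= d) &&
      (\int[leb]_(x in Omega) `|v k x - u x| `^ p <= d / (k2 * 2)).
    by rewrite -le_min; exact: hK1.
  (* the midpoint of two late terms is a competitor, so its value is at least the infimum *)
  have Wm := W_Z oO bO p1 2^-1 (W_D oO bO p1 (Wk j) (Wk k)).
  set w := (fun x => 2^-1 * _) in Wm; set gw := (fun x => 2^-1 *: _) in Wm.
  have wu : \int[leb]_(x in Omega) `|w x - u x| `^ p <= d.
    apply: le_trans (Np_midpoint (Lv j) (Lv k) Lu) _.
    rewrite -(mul_quarters d k20); apply: ler_wpM2l; first exact: ltW.
    by apply: lerD; [exact: vj2|exact: vk2].
  have Pj := hd _ (Lv j) vj1; have Pk := hd _ (Lv k) vk1.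
  have Pw := hd _ (W_Lp oO bO p1 Wm) wu.
  have Jm := mS _ _ Wm; have Jj := Jk j; have Jkk := Jk k; have ej := hK2 j j2; have ek := hK2 k k2'.
  have iE g' : (forall i, Lpo (fun x => g' x ord0 i)) ->
      leb.-integrable Omega (EFin \o (fun x => enorm (g' x) `^ p)).
    by move=> L'; exact: enorm_powR_itg (Lp_enorm oO p1 L').
  have ij := iE _ (Lh j); have ik := iE _ (Lh k).
  have iw := iE _ (fun i => W_Lp_grad oO bO p1 i Wm).
  have ijk := itgD mO ij ik.
  have gapE : \int[leb]_(x in Omega) midpoint_gap p (h j x) (h k x) = (E (h j) + E (h k)) / 2 - E gw.
    have -> : (fun x => midpoint_gap p (h j x) (h k x)) = fun x =>
      2^-1 * (enorm (h j x) `^ p + enorm (h k x) `^ p) - enorm (gw x) `^ p.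
      by apply/funext => x; rewrite /midpoint_gap mulrC.
    rewrite (RintegralB mO (itgZ mO 2^-1 ijk) iw) (RintegralZl _ mO ijk) (RintegralD mO ij ik).
    by rewrite mulrC.
  have igap : leb.-integrable Omega (EFin \o (fun x => midpoint_gap p (h j x) (h k x))).
    rewrite (_ : (fun x => _) = fun x => 2^-1 * (enorm (h j x) `^ p + enorm (h k x) `^ p) - enorm (gw x) `^ p).
      exact: (itgB mO (itgZ mO 2^-1 ijk) iw).
    by apply/funext => x; rewrite /midpoint_gap mulrC.
  have gap_le : \int[leb]_(x in Omega) midpoint_gap p (h j x) (h k x) <= 3 * p * eta.
    rewrite gapE mean_scaled [3 * p]mulrC -mulrA; apply: ler_wpM2l; first exact: ltW.
    exact: (gap_arith Jm Jj Jkk ej ek Pj Pk Pw).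
  apply: (@le_trans _ _ (\int[leb]_(x in Omega) (e / (2 * (M + M + 1)) *
     (enorm (h j x) `^ p + enorm (h k x) `^ p) + C * midpoint_gap p (h j x) (h k x)))).
    apply: le_Rintegral; [exact: mO|exact: (iE _ (vLp_B (Lh j) (Lh k)))| |].
      exact: (itgD mO (itgZ mO _ ijk) (itgZ mO C igap)).
    by move=> x _; exact: hC.
  rewrite (RintegralD mO (itgZ mO _ ijk) (itgZ mO C igap)) (RintegralZl _ mO ijk).
  rewrite (RintegralZl _ mO igap) (RintegralD mO ij ik) [leRHS]splitr lerD//.
    by apply: mul_half_le; [exact: ltW|exact: MM0|rewrite lerD].
  apply: (@le_trans _ _ (C * (3 * p * eta))); first by rewrite ler_wpM2l.
  by rewrite mulrA -/X mulrC; apply: mul_half_le => //; exact: ltW.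
have /choice[G hG] i : exists G, Lpo G /\ cv (fun k x => h k x ord0 i) G.
  have ci e : 0 < e -> exists K, forall j k, (K <= j)%N -> (K <= k)%N ->
      \int[leb]_(x in Omega) `|h j x ord0 i - h k x ord0 i| `^ p <= e.
    move=> /cauchy[K hK]; exists K => j k jK kK; apply: le_trans (hK j k jK kK).
    have Wjk := W_B oO bO p1 (Wk j) (Wk k).
    have := Int_coord_le_enorm oO bO p1 i Wjk.
    have -> // : (fun x => `|(h j x - h k x) ord0 i| `^ p) = fun x => `|h j x ord0 i - h k x ord0 i| `^ p.
    by apply/funext => x; rewrite !mxE.
  by have [G LG cG] := Lp_complete mO p1 (fun k => Lh k i) ci; exists G.
pose g x : 'rV[R]_n.+1 := \row_i G i x.
have gE i : (fun x => g x ord0 i) = G i by apply/funext => x; rewrite mxE.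
have Lg i : Lpo (fun x => g x ord0 i) by rewrite gE; case: (hG i).
have cg i : cv (fun k x => h k x ord0 i) (fun x => g x ord0 i) by rewrite gE; case: (hG i).
have Wu : W u g := W_lim oO bO p1 Wk Lu Lg cu cg.
exists u, g; split; [exact: Wu|move=> w gw Ww; apply: le_trans (mS _ _ Ww)].
apply/ler_addgt0Pl => e ee.
have e3 : 0 < e / 3 by rewrite divr_gt0.
have e3p : 0 < p * (e / 3) by rewrite mulr_gt0.
have [K1 hK1] := energy_cvg Lh Lg cg e3p; have [K2 hK2] := small _ e3.
have [d d0 hd] := cPhi u Lu _ e3; have /cvLpP/(_ _ d0)[K3 hK3] := cu.
pose k := maxn K1 (maxn K2 K3).
have k1 : (K1 <= k)%N by exact: leq_maxl.
have k2 : (K2 <= k)%N by rewrite (leq_trans _ (leq_maxr _ _))// leq_maxl.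
have k3 : (K3 <= k)%N by rewrite (leq_trans _ (leq_maxr _ _))// leq_maxr.
exact: (lsc_arith (hK1 k k1) (Jk k) (hK2 k k2) (hd _ (Lv k) (hK3 k k3))).
Qed.

(** At [a = 0] the exponent [p - 2] may be negative and the expression is computed: it is a
    multiple of [t `^ (p - 1)]. *)
Lemma plap_along_cvg (a b : 'rV[R]_n.+1) :
  enorm (a + (k.+1%:R^-1 : R) *: b) `^ (p - 2) * dotrV (a + (k.+1%:R^-1 : R) *: b) b @[k --> \oo] -->
  enorm a `^ (p - 2) * dotrV a b.
Proof.
have t0 : (fun k : nat => (k.+1%:R^-1 : R)) @ \oo --> (0 : R) by exact: cvg_harmonic.
have [->|an0] := eqVneq a 0.
  have -> : dotrV (0 : 'rV[R]_n.+1) b = 0 by rewrite -(scale0r b) dotrVZl mul0r.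
  rewrite mulr0 (_ : (fun k => _) = fun k : nat => enorm b `^ p * `|k.+1%:R^-1 : R| `^ (p - 1)).
    by apply: cvgZ0; apply: cvg_normr_powR0 t0; rewrite subr_gt0.
  apply/funext => k; rewrite add0r; set t : R := k.+1%:R^-1.
  have tp : 0 < t by rewrite invr_gt0 ltr0n.
  rewrite enormZ gtr0_norm// dotrVZl powRM ?enorm_ge0 ?ltW//.
  rewrite mulrACA (plap_self b p1) mulrC; congr (_ * _).
  have -> : p - 1 = (p - 2) + 1 by ring.
  rewrite [RHS]powRD; last by rewrite (gt_eqF tp) implybT.
  by rewrite powRr1 ?(ltW tp).
have cz : a + (k.+1%:R^-1 : R) *: b @[k --> \oo] --> a.
  rewrite -[X in _ --> X]addr0; apply: cvgD; first exact: cvg_cst.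
  by rewrite -(scale0r b); apply: cvgZr_tmp; exact: t0.
have en0 : 0 < enorm a by rewrite lt_neqAle enorm_ge0 eq_sym andbT; apply: contra_neq an0; exact: enorm_eq0.
apply: cvgM.
  have c := is_derive_continuous (is_derive1_powR (p - 2) en0).
  apply: (@cvg_comp _ _ _ (fun k : nat => enorm (a + (k.+1%:R^-1 : R) *: b)) (fun y => y `^ (p - 2)) _ _ _ _ c).
  by apply: cvg_comp cz _; exact: enorm_continuous.
have h : (fun k : nat => dotrV a b + dotrV b b * k.+1%:R^-1) @ \oo --> dotrV a b + 0.
  by apply: cvgD; [exact: cvg_cst|exact: cvgZ0].
rewrite addr0 in h; rewrite (_ : (fun k => _) = fun k : nat => dotrV a b + dotrV b b * k.+1%:R^-1)//.
by apply/funext => k; rewrite dotrVDl dotrVZl mulrC.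
Qed.

Lemma plap_itg g gpsi : (forall i, Lpo (fun x => g x ord0 i)) ->
  (forall i, Lpo (fun x => gpsi x ord0 i)) ->
  measurable_fun Omega (fun x => enorm (g x) `^ (p - 2) * dotrV (g x) (gpsi x)) /\
  leb.-integrable Omega (EFin \o (fun x => enorm (g x) `^ (p - 2) * dotrV (g x) (gpsi x))).
Proof.
move=> Lg Lpsi; have mg i := (Lg i).1; have mpsi i := (Lpsi i).1.
have mp : measurable_fun setT (fun y : R => y `^ (p - 2)) by exact: measurable_powR.
have m : measurable_fun Omega (fun x => enorm (g x) `^ (p - 2) * dotrV (g x) (gpsi x)).
  apply: measurable_funM; last exact: measurable_dotrV.
  by have := measurableT_comp mp (measurable_enorm mg).
split => //; have i1 := enorm_powR_itg (Lp_enorm oO p1 Lg).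
have i2 := enorm_powR_itg (Lp_enorm oO p1 Lpsi).
by apply: (itg_le mO m _ (itgD mO i1 i2)) => x _; exact: plap_mixed.
Qed.

(** Minimality bounds the difference quotient of [Phi] at [u + t psi] by that of the energy,
    which by the tangent inequality at [u + t psi] is at most the p-Laplacian form there; let
    [t] tend to zero by dominated convergence. *)
Theorem euler_lagrange_le (Phi : ('rV[R]_n.+1 -> R) -> R) u g psi gpsi L :
  W u g -> (forall v gv, W v gv -> E g / p - Phi u <= E gv / p - Phi v) -> W psi gpsi ->
  (Phi (fun x => u x + (k.+1%:R^-1 : R) * psi x) - Phi u) / (k.+1%:R^-1 : R) @[k --> \oo] --> L ->
  L <= plap_form Omega p g gpsi.
Proof.
move=> Wu umin Wpsi cPhi; have p0 : 0 < p := lt_trans ltr01 p1.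
pose t (k : nat) : R := k.+1%:R^-1; have t0 k : 0 < t k by rewrite invr_gt0 ltr0n.
have t1 k : t k <= 1 by rewrite invf_le1 ?ltr0n// ler1n.
have Lg i := W_Lp_grad oO bO p1 i Wu; have Lpsi i := W_Lp_grad oO bO p1 i Wpsi.
have Wt k := W_D oO bO p1 Wu (W_Z oO bO p1 (t k) Wpsi).
have Lt k i := W_Lp_grad oO bO p1 i (Wt k).
pose F k x := enorm (g x + t k *: gpsi x) `^ (p - 2) * dotrV (g x + t k *: gpsi x) (gpsi x).
have F_itg k := (plap_itg (Lt k) Lpsi).2; have F_meas k := (plap_itg (Lt k) Lpsi).1.
have ineq k : (Phi (fun x => u x + t k * psi x) - Phi u) / t k <= \int[leb]_(x in Omega) F k x.
  have h1 := umin _ _ (Wt k).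
  have iE g' : (forall i, Lpo (fun x => g' x ord0 i)) ->
      leb.-integrable Omega (EFin \o (fun x => enorm (g' x) `^ p)).
    by move=> L'; exact: enorm_powR_itg (Lp_enorm oO p1 L').
  have h2 : E (fun x => g x + t k *: gpsi x) - E g <= p * (t k * \int[leb]_(x in Omega) F k x).
    rewrite -(RintegralB mO (iE _ (Lt k)) (iE _ Lg)) -(RintegralZl _ mO (F_itg k)).
    rewrite -(RintegralZl _ mO (itgZ mO (t k) (F_itg k))).
    apply: le_Rintegral; [exact: mO|exact: (itgB mO (iE _ (Lt k)) (iE _ Lg))|exact: (itgZ mO p (itgZ mO (t k) (F_itg k)))|].
    move=> x _; have := plap_tangent (g x + t k *: gpsi x) (g x) p1.
    have -> : g x - (g x + t k *: gpsi x) = (- t k) *: gpsi x.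
      by rewrite opprD addrA subrr sub0r scaleNr.
    rewrite dotrVZr /F.
    move: (enorm (g x) `^ p) (enorm (_ + _) `^ p) (enorm _ `^ (p - 2)) (dotrV _ _) => A B C D.
    by move=> h; rewrite lerBlDr -lerBlDl; apply: le_trans h; apply: eq_ler; ring.
  move: h1 h2; move: (E g) (E (fun x => g x + t k *: gpsi x)) (Phi u)
    (Phi (fun x => u x + t k * psi x)) (\int[leb]_(x in Omega) F k x) => e1 e2 f1 f2 I h1 h2.
  have h3 : f2 - f1 <= (e2 - e1) / p by rewrite mulrBl; clear -h1; lra.
  rewrite ler_pdivrMr ?t0//; apply: le_trans h3 _; rewrite ler_pdivrMr ?p0//.
  by rewrite mulrC [I * _]mulrC.
have [|||_ _ cF] := @dct _ _ _ leb _ mO F (fun x => enorm (g x) `^ (p - 2) * dotrV (g x) (gpsi x))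
  (fun x => 2 `^ p * (enorm (g x) `^ p + enorm (gpsi x) `^ p) + enorm (gpsi x) `^ p)
  F_meas (plap_itg Lg Lpsi).1 _ _ _.
- by apply: aeW => x _; exact: plap_along_cvg.
- have i1 := enorm_powR_itg (Lp_enorm oO p1 Lg); have i2 := enorm_powR_itg (Lp_enorm oO p1 Lpsi).
  exact: (itgD mO (itgZ mO _ (itgD mO i1 i2)) i2).
- apply: aeW => x k _; apply: le_trans (plap_mixed _ _ p1) _; rewrite lerD2r.
  have h : enorm (g x + t k *: gpsi x) <= enorm (g x) + enorm (gpsi x).
    apply: le_trans (enormD _ _) _; rewrite lerD2l enormZ gtr0_norm//.
    by rewrite ler_piMl ?enorm_ge0.
  apply: le_trans (ler_powR2 (ltW p0) (enorm_ge0 _) h) _.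
  have := powR_add_le (enorm (g x)) (enorm (gpsi x)) p1.
  by rewrite !ger0_norm ?addr_ge0 ?enorm_ge0.
apply: (ler_cvg_to cPhi cF); apply: nearW => k; exact: ineq.
Qed.

End minimisation.

(** * The Rayleigh quotient *)

Section scalar_power.
Context {R : realType}.
Variable p : R.
Hypothesis p1 : 1 < p.
Implicit Types s r a b : R.

Let emb (s : R) : 'rV[R]_1 := const_mx s.

Let emb_dot s r : dotrV (emb s) (emb r) = s * r.
Proof. by rewrite /dotrV big_ord1 !mxE. Qed.

Let emb_norm s : enorm (emb s) = `|s|.
Proof. by rewrite /enorm emb_dot -expr2 sqrtr_sqr. Qed.

(** Reals are one-dimensional vectors, for which [ppow] is the p-Laplacian flux; the facts
    below are read off from the vector case. *)
Lemma ppow_tangent s r : `|s| `^ p + p * (ppow p s * (r - s)) <= `|r| `^ p.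
Proof.
have := plap_tangent (emb s) (emb r) p1.
have -> : emb r - emb s = emb (r - s) by apply/rowP => i; rewrite !mxE.
by rewrite !emb_norm emb_dot mulrA.
Qed.

Lemma ppow_mixed s r : `|ppow p s * r| <= `|s| `^ p + `|r| `^ p.
Proof.
by have := plap_mixed (emb s) (emb r) p1; rewrite !emb_norm emb_dot mulrA.
Qed.

Lemma ppow_along_cvg a b :
  ppow p (a + (k.+1%:R^-1 : R) * b) * b @[k --> \oo] --> ppow p a * b.
Proof.
have := @plap_along_cvg _ _ _ p1 (emb a) (emb b).
rewrite !emb_norm emb_dot mulrA.
rewrite (_ : (fun k => _) = fun k : nat => ppow p (a + (k.+1%:R^-1 : R) * b) * b)//.
apply/funext => k; have -> : emb a + (k.+1%:R^-1 : R) *: emb b = emb (a + (k.+1%:R^-1 : R) * b).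
  by apply/rowP => i; rewrite !mxE.
by rewrite emb_norm emb_dot mulrA.
Qed.

Lemma normr_powR_quotient_cvg a b :
  (`|a + (k.+1%:R^-1 : R) * b| `^ p - `|a| `^ p) / (k.+1%:R^-1 : R) @[k --> \oo] -->
  p * (ppow p a * b).
Proof.
have t0 (k : nat) : 0 < (k.+1%:R^-1 : R) by rewrite invr_gt0 ltr0n.
apply: (@squeeze_cvgr _ _ _ _ (fun=> p * (ppow p a * b))
  (fun k : nat => p * (ppow p (a + (k.+1%:R^-1 : R) * b) * b))).
- apply: nearW => k; move: (k.+1%:R^-1 : R) (t0 k) => t tp.
  have h1 := ppow_tangent a (a + t * b); have h2 := ppow_tangent (a + t * b) a.
  have E1 : a + t * b - a = t * b by ring.
  have E2 : a - (a + t * b) = - (t * b) by ring.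
  rewrite E1 in h1; rewrite E2 in h2.
  rewrite ler_pdivlMr// ler_pdivrMr//; apply/andP; split.
    rewrite lerBrDl; apply: le_trans h1; apply: eq_ler; ring.
  rewrite lerBlDr -lerBlDl; apply: le_trans h2; apply: eq_ler; ring.
- exact: cvg_cst.
- by apply: cvgMr; exact: ppow_along_cvg.
Qed.

Lemma normr_powR_quotient_le a b (t : R) : 0 < t <= 1 ->
  `|(`|a + t * b| `^ p - `|a| `^ p) / t| <=
  p * (2 `^ p * (`|a| `^ p + `|b| `^ p) + `|b| `^ p).
Proof.
move=> /andP[t0 t1]; have p0 : 0 < p := lt_trans ltr01 p1.
have K1 : 1 <= 2 `^ p :> R.
  have E1 : (1 : R) `^ p = 1 by rewrite powR1.
  by rewrite -{1}E1 ler_powR2 ?(ltW p0)// ler1n.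
have h1 := ppow_tangent a (a + t * b); have h2 := ppow_tangent (a + t * b) a.
have E1 : a + t * b - a = t * b by ring.
have E2 : a - (a + t * b) = - (t * b) by ring.
rewrite E1 in h1; rewrite E2 in h2.
have m1 := ppow_mixed a b; have m2 := ppow_mixed (a + t * b) b.
have tb : `|t * b| `^ p <= `|b| `^ p.
  by rewrite ler_powR2 ?(ltW p0)// normrM gtr0_norm// ler_piMl.
have A0 : 0 <= `|a| `^ p by exact: powR_ge0.
have B0 : 0 <= `|b| `^ p by exact: powR_ge0.
have s1 : `|a + t * b| `^ p <= 2 `^ p * (`|a| `^ p + `|b| `^ p).
  apply: le_trans (powR_add_le a (t * b) p1) _.
  by rewrite ler_pM2l ?powR_gt0// lerD2l.
have AK : `|a| `^ p <= 2 `^ p * (`|a| `^ p + `|b| `^ p).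
  apply: (@le_trans _ _ (1 * (`|a| `^ p + `|b| `^ p))); first by rewrite mul1r lerDl.
  by rewrite ler_wpM2r// addr_ge0.
rewrite ler_norml -mulNr ler_pdivlMr// ler_pdivrMr//.
set K := 2 `^ p * _ in s1 AK *.
apply/andP; split.
  have hb : - (K + `|b| `^ p) <= ppow p a * b.
    rewrite lerNl (le_trans (ler_norm _))// normrN (le_trans m1)// lerD2r//.
  have := ler_wpM2r (ltW (mulr_gt0 p0 t0)) hb; move: h1.
  move: (ppow p _) (K + _) (`|a + t * b| `^ p) (`|a| `^ p) => y z x1 x2; lra.
have hb : ppow p (a + t * b) * b <= K + `|b| `^ p.
  by rewrite (le_trans (ler_norm _))// (le_trans m2)// lerD2r.
rewrite lerBlDr -lerBlDl.
have := ler_wpM2r (ltW (mulr_gt0 p0 t0)) hb; move: h2.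
move: (ppow p _) (K + _) (`|a + t * b| `^ p) (`|a| `^ p) => y z x1 x2; lra.
Qed.

End scalar_power.

Section saturation.
Context {R : realType}.
Implicit Types l s r t q p : R.

(** The mass [s] is replaced by a bounded increasing function of it, of slope [l] at zero
    and at most [l] elsewhere: boundedness makes the functional coercive, and the slope at the
    minimiser is the eigenvalue. *)
Definition saturation l s : R := l * s / (1 + s).

Lemma mean_between s t : s < t -> s < (s + t) / 2 /\ (s + t) / 2 < t.
Proof. by move=> st; split; lra. Qed.

Lemma one_plus_gt0 s : 0 <= s -> 0 < 1 + s.
Proof. by move=> s0; rewrite ltr_wpDr. Qed.

Lemma saturation_diff l s r : 0 <= s -> 0 <= r ->
  saturation l s - saturation l r = l * (s - r) / ((1 + s) * (1 + r)).
Proof.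
move=> /one_plus_gt0 s1 /one_plus_gt0 r1; rewrite /saturation; field.
by rewrite !gt_eqF.
Qed.

Lemma one_plus_mul_ge1 s r : 0 <= s -> 0 <= r -> 1 <= (1 + s) * (1 + r).
Proof. by move=> s0 r0; rewrite -[leLHS]mulr1 ler_pM// lerDl. Qed.

Lemma saturation_dist l s r : 0 < l -> 0 <= s -> 0 <= r ->
  `|saturation l s - saturation l r| <= l * `|s - r|.
Proof.
move=> l0 s0 r0; have s1 := one_plus_gt0 s0; have r1 := one_plus_gt0 r0.
rewrite saturation_diff// normrM normfV (gtr0_norm (mulr_gt0 s1 r1)).
rewrite ler_pdivrMr ?mulr_gt0// normrM (gtr0_norm l0) ler_peMr ?one_plus_mul_ge1//.
by rewrite mulr_ge0// ltW.
Qed.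

Lemma saturation_le l s : 0 < l -> 0 <= s -> saturation l s <= l.
Proof.
move=> l0 s0; rewrite /saturation ler_pdivrMr ?one_plus_gt0// ler_pM2l//.
by rewrite lerDr.
Qed.

Lemma saturation_slope_le l s : 0 < l -> 0 <= s -> l / ((1 + s) * (1 + s)) <= l.
Proof.
move=> l0 s0; have s1 := one_plus_gt0 s0.
by rewrite ler_pdivrMr ?mulr_gt0// ler_peMr ?one_plus_mul_ge1// ltW.
Qed.

Lemma saturation_slope l s p i : 0 < p -> 0 <= s ->
  l / ((1 + s) * (1 + s)) * i = p^-1 * (l / (1 + s)) * (p * i * (1 + s)^-1).
Proof.
by move=> p0 /one_plus_gt0 s1; field; rewrite !gt_eqF.
Qed.

Lemma saturation_quotient l s r t : 0 <= s -> 0 <= r -> t != 0 ->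
  (saturation l s - saturation l r) / t = l / (1 + r) * ((s - r) / t * (1 + s)^-1).
Proof.
move=> s0 r0 t0; rewrite saturation_diff//.
have s1 := one_plus_gt0 s0; have r1 := one_plus_gt0 r0.
by field; rewrite t0 !gt_eqF.
Qed.

Lemma saturation_derivative l s p i (sk t : nat -> R) : 0 < p -> 0 <= s ->
  (forall k, 0 <= sk k) -> (forall k, t k != 0) -> t @ \oo --> (0 : R) ->
  (sk k - s) / t k @[k --> \oo] --> p * i ->
  (p^-1 * saturation l (sk k) - p^-1 * saturation l s) / t k @[k --> \oo] -->
  l / ((1 + s) * (1 + s)) * i.
Proof.
move=> p0 s0 sk0 tn0 t0 Q.
have cS : sk @ \oo --> s.
  have h : (fun k => s + (sk k - s) / t k * t k) @ \oo --> s + (p * i) * 0.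
    by apply: cvgD; [exact: cvg_cst|exact: cvgM].
  rewrite mulr0 addr0 in h; suff -> : sk = fun k => s + (sk k - s) / t k * t k by exact: h.
  by apply/funext => k; rewrite divfK// addrC subrK.
have c2 : (fun k => (1 + sk k)^-1) @ \oo --> (1 + s)^-1.
  apply: cvgV; first by rewrite gt_eqF// one_plus_gt0.
  by apply: cvgD; [exact: cvg_cst|exact: cS].
rewrite (saturation_slope _ _ p0 s0).
have h : (fun k => p^-1 * (l / (1 + s)) * (((sk k - s) / t k) * (1 + sk k)^-1)) @ \oo -->
    p^-1 * (l / (1 + s)) * ((p * i) * (1 + s)^-1).
  by apply: cvgMr; apply: cvgM; [exact: Q|exact: c2].
suff -> : (fun k => (p^-1 * saturation l (sk k) - p^-1 * saturation l s) / t k) =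
  fun k => p^-1 * (l / (1 + s)) * (((sk k - s) / t k) * (1 + sk k)^-1) by exact: h.
apply/funext => k; rewrite -mulrBr -[LHS]mulrA.
by rewrite (saturation_quotient l (sk0 k) s0 (tn0 k)); exact: mulrA.
Qed.

(** To first order in [q] the left-hand side is [q (e - l s) / p], and [e <= m s < l s]. *)
Lemma saturation_trial m l s e p : 0 < m -> m < l -> 0 < s -> e <= m * s -> 0 < p ->
  exists2 q, 0 < q & q * e / p - p^-1 * saturation l (q * s) < 0.
Proof.
move=> m0 ml s0 es p0; have l0 := lt_trans m0 ml.
(* chosen so that [1 + q s] is less than [l / m] *)
pose q := (l - m) / (2 * m * s).
have q0 : 0 < q by rewrite divr_gt0 ?subr_gt0// !mulr_gt0.
exists q => //; have qs0 : 0 < q * s by exact: mulr_gt0.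
have D0 := one_plus_gt0 (ltW qs0).
rewrite mulrC -mulrBr pmulr_rlt0 ?invr_gt0// subr_lt0 /saturation ltr_pdivlMr//.
apply: (@le_lt_trans _ _ (q * (m * s) * (1 + q * s))).
  by rewrite ler_pM2r// ler_pM2l.
rewrite (_ : q * (m * s) * _ = (m * (1 + q * s)) * (q * s)); last by ring.
rewrite ltr_pM2r// (_ : m * _ = (m + l) / 2); last by rewrite /q; field; rewrite !gt_eqF.
lra.
Qed.

End saturation.

Section rayleigh.
Context {R : realType} {n : nat}.
Variables (Omega : set 'rV[R]_n.+1) (p : R).
Hypotheses (oO : open Omega) (bO : bounded_set Omega) (p1 : 1 < p).
Local Notation leb := (lebesgue_rV n.+1).
Local Notation mO := (open_measurable_rV oO).
Local Notation Lpo := (Lp leb Omega p).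
Local Notation W := (W01p Omega p).
Local Notation E g := (\int[leb]_(x in Omega) enorm (g x) `^ p).
Implicit Types (u v f psi : 'rV[R]_n.+1 -> R) (g gpsi : 'rV[R]_n.+1 -> 'rV[R]_n.+1).

(** Apply the one-sided inequality to [psi] and to [- psi]. *)
Lemma euler_lagrange (Phi L : ('rV[R]_n.+1 -> R) -> R) u g :
  W u g -> (forall v gv, W v gv -> E g / p - Phi u <= E gv / p - Phi v) ->
  (forall psi gpsi, W psi gpsi ->
    (Phi (fun x => u x + (k.+1%:R^-1 : R) * psi x) - Phi u) / (k.+1%:R^-1 : R) @[k --> \oo] --> L psi) ->
  (forall psi gpsi, W psi gpsi -> L (fun x => -1 * psi x) = - L psi) ->
  forall psi gpsi, W psi gpsi -> plap_form Omega p g gpsi = L psi.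
Proof.
move=> Wu umin dPhi LN psi gpsi Wpsi; apply/eqP; rewrite eq_le; apply/andP; split; last first.
  exact: (euler_lagrange_le oO bO p1 Wu umin Wpsi (dPhi _ _ Wpsi)).
have WN := W_Z oO bO p1 (-1) Wpsi.
have := euler_lagrange_le oO bO p1 Wu umin WN (dPhi _ _ WN).
rewrite (LN _ _ Wpsi); have -> : plap_form Omega p g (fun x => -1 *: gpsi x) = - plap_form Omega p g gpsi.
  have i1 := (plap_itg oO p1 (fun i => W_Lp_grad oO bO p1 i Wu) (fun i => W_Lp_grad oO bO p1 i Wpsi)).2.
  have := RintegralZl (-1) mO i1; rewrite mulN1r => <-; rewrite /plap_form.
  by congr Rintegral; apply/funext => x; rewrite dotrVZr mulrCA.
by rewrite lerN2.
Qed.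

Variables (c : 'rV[R]_n.+1 -> R) (M : R).
Hypotheses (mc : measurable_fun Omega c) (cM : forall x, 0 <= c x <= M).

Definition weighted_mass v := \int[leb]_(x in Omega) (c x * `|v x| `^ p).
Local Notation S := weighted_mass.

Lemma c_itg f : leb.-integrable Omega (EFin \o f) ->
  leb.-integrable Omega (EFin \o (fun x => c x * f x)).
Proof.
move=> fi; apply: (itg_le mO _ _ (itgZ mO M (itg_norm fi))).
  by apply: measurable_funM => //; exact: itg_meas fi.
move=> x _; have /andP[c0 c1] := cM x.
by rewrite normrM ger0_norm// ler_wpM2r.
Qed.

Lemma weighted_mass_ge0 v : 0 <= S v.
Proof.
by apply: Rintegral_ge0 => x _; have /andP[c0 _] := cM x; rewrite mulr_ge0 ?powR_ge0.
Qed.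

Lemma weighted_mass_continuous : Lp_continuous Omega p S.
Proof.
move=> u Lu e e0; have M0 : 0 <= M by have /andP[h1 h2] := cM 0; exact: le_trans h2.
have e'0 : 0 < e / (M + 1) by rewrite divr_gt0// ltr_wpDl.
have [d d0 hd] := Np_continuous oO p1 Lu e'0; exists d => // v Lv /(hd v Lv) h.
have iv := c_itg Lv.2; have iu := c_itg Lu.2; have id_ := itgB mO Lv.2 Lu.2.
rewrite /S -(RintegralB mO iv iu).
apply: le_trans (le_normr_Rintegral mO (itgB mO iv iu)) _.
apply: (@le_trans _ _ (M * (e / (M + 1)))); last first.
  by rewrite mulrCA ler_piMr ?(ltW e0)// ler_pdivrMr ?ltr_wpDl// mul1r lerDl.
apply: (@le_trans _ _ (M * \int[leb]_(x in Omega) `| `|v x| `^ p - `|u x| `^ p |)); last exact: ler_wpM2l.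
rewrite -(RintegralZl _ mO (itg_norm id_)); apply: le_Rintegral; [exact: mO| | |].
- exact: itg_norm (itgB mO iv iu).
- exact: (itgZ mO M (itg_norm id_)).
- move=> x _; have /andP[c0 c1] := cM x.
  by rewrite -mulrBr normrM [`|c x|]ger0_norm// ler_wpM2r.
Qed.

Lemma measurable_ppow u : measurable_fun Omega u -> measurable_fun Omega (fun x => ppow p (u x)).
Proof.
move=> mu; rewrite /ppow; apply: measurable_funM => //.
exact: measurable_normr_powR.
Qed.

Lemma ppow_mul_itg u psi : Lpo u -> Lpo psi ->
  leb.-integrable Omega (EFin \o (fun x => ppow p (u x) * psi x)).
Proof.
move=> Lu Lpsi; apply: (itg_le mO _ _ (itgD mO Lu.2 Lpsi.2)).
  by apply: measurable_funM; [exact: measurable_ppow Lu.1|exact: Lpsi.1].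
by move=> x _; exact: ppow_mixed.
Qed.

(** Dominated convergence, the bound being uniform for steps in [(0, 1]]. *)
Lemma weighted_mass_quotient u psi : Lpo u -> Lpo psi ->
  (S (fun x => u x + (k.+1%:R^-1 : R) * psi x) - S u) / (k.+1%:R^-1 : R) @[k --> \oo] -->
  p * \int[leb]_(x in Omega) (c x * (ppow p (u x) * psi x)).
Proof.
move=> Lu Lpsi; pose t (k : nat) : R := k.+1%:R^-1.
have t0 k : 0 < t k by rewrite invr_gt0 ltr0n.
have t1 k : t k <= 1 by rewrite invf_le1 ?ltr0n// ler1n.
have Lt k : Lpo (fun x => u x + t k * psi x) := LpD mO p1 Lu (LpZ mO (t k) Lpsi).
pose F k x := c x * ((`|u x + t k * psi x| `^ p - `|u x| `^ p) / t k).
have iF k : leb.-integrable Omega (EFin \o F k).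
  rewrite /F; apply: c_itg.
  rewrite (_ : (fun x => _) = fun x => (t k)^-1 * (`|u x + t k * psi x| `^ p - `|u x| `^ p)).
    exact: (itgZ mO _ (itgB mO (Lt k).2 Lu.2)).
  by apply/funext => x; rewrite mulrC.
have E1 k : (S (fun x => u x + t k * psi x) - S u) / t k = \int[leb]_(x in Omega) F k x.
  have i1 := c_itg (Lt k).2; have i2 := c_itg Lu.2.
  rewrite /S -(RintegralB mO i1 i2) mulrC -(RintegralZl _ mO (itgB mO i1 i2)).
  congr Rintegral; apply/funext => x; rewrite /F.
  by rewrite -mulrBr mulrCA [_^-1 * _]mulrC.
have il := c_itg (ppow_mul_itg Lu Lpsi).
rewrite -(RintegralZl _ mO il).
rewrite (_ : (fun k => _) = fun k => \int[leb]_(x in Omega) F k x); last by apply/funext => k; exact: E1.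
have iB : leb.-integrable Omega (EFin \o (fun x => M * (p * (2 `^ p * (`|u x| `^ p + `|psi x| `^ p) + `|psi x| `^ p)))).
  apply: (itgZ mO M); apply: (itgZ mO p); apply: (itgD mO _ Lpsi.2).
  exact: (itgZ mO _ (itgD mO Lu.2 Lpsi.2)).
have [|||_ _ //] := @dct _ _ _ leb _ mO F (fun x => p * (c x * (ppow p (u x) * psi x))) _
  (fun k => itg_meas (iF k)) _ _ iB _.
- exact: itg_meas (itgZ mO p il).
- apply: aeW => x _; rewrite mulrCA; apply: cvgMr.
  exact: normr_powR_quotient_cvg.
- apply: aeW => x k _; have /andP[c0 c1] := cM x.
  rewrite /F normrM [`|c x|]ger0_norm//; apply: ler_pM => //.
  by apply: (normr_powR_quotient_le p1); apply/andP; split; [exact: t0|exact: t1].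
Qed.

Lemma norm_eq0_ae v : Lpo v -> \int[leb]_(x in Omega) `|v x| `^ p <= 0 ->
  {ae leb, forall x, Omega x -> v x = 0}.
Proof.
move=> Lv v0; have p0 : 0 < p := lt_trans ltr01 p1.
have h := Int_eq0 mO Lv.2 (aeW leb (fun x _ => powR_ge0 _ _)) v0.
by apply: filterS h => x /[apply] /eqP; rewrite powR_eq0 normr_eq0 => /andP[/eqP].
Qed.

(** Were the Rayleigh quotient of some function below the first eigenvalue, the
    energy with the saturated mass [S / (1 + S)], which is bounded and hence
    coercive, would have a nonzero minimiser; its Euler-Lagrange equation exhibits
    an eigenvalue that is too small. *)
Theorem rayleigh (lambda gamma : R) v gv : 0 < lambda < gamma ->
  (forall gamma', eigenvalue_plap Omega p c gamma' -> gamma <= gamma') ->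
  W v gv -> E gv <= lambda * S v -> {ae leb, forall x, Omega x -> v x = 0}.
Proof.
move=> /andP[l0 lg] first Wv Ev; have p0 : 0 < p := lt_trans ltr01 p1.
apply: contrapT => vn0; have Lv := W_Lp oO bO p1 Wv.
have [P P0 hP] := poincare_W oO bO p1.
have Sv0 : 0 < S v.
  rewrite lt_neqAle weighted_mass_ge0 andbT; apply/eqP => S0; apply: vn0; apply: norm_eq0_ae => //.
  apply: le_trans (hP _ _ Wv) _; rewrite -S0 mulr0 in Ev.
  by rewrite pmulr_rle0.
pose l' := (lambda + gamma) / 2.
have [ll' l'g] : lambda < l' /\ l' < gamma by exact: mean_between.
have l'0 : 0 < l' := lt_trans l0 ll'.
pose Phi w := p^-1 * saturation l' (S w).
have cPhi : Lp_continuous Omega p Phi.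
  move=> u Lu e e0; have e'0 : 0 < e * p / l' by rewrite divr_gt0 ?l'0// mulr_gt0 ?p0.
  have [d d0 hd] := weighted_mass_continuous Lu e'0; exists d; first exact: d0.
  move=> w Lw /(hd w Lw) h; rewrite /Phi -mulrBr normrM gtr0_norm ?invr_gt0 ?p0//.
  rewrite mulrC ler_pdivrMr ?p0//.
  apply: le_trans (saturation_dist l'0 (weighted_mass_ge0 w) (weighted_mass_ge0 u)) _.
  by rewrite mulrC -ler_pdivlMr ?l'0.
have coer u g : W u g -> p^-1 * E g - p^-1 * l' <= E g / p - Phi u.
  move=> _; rewrite [E g / p]mulrC lerD2l lerN2; apply: ler_wpM2l; first by rewrite invr_ge0 ltW.
  exact: saturation_le l'0 (weighted_mass_ge0 u).
have pi0 : 0 < p^-1 by rewrite invr_gt0.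
have [u [g [Wu umin]]] := minimiser oO bO p1 pi0 cPhi coer.
have Lu := W_Lp oO bO p1 Wu.
have s0 := weighted_mass_ge0 u.
have Jneg : E g / p - Phi u < 0.
  have [q q0 hq] := saturation_trial l0 ll' Sv0 Ev p0.
  pose t := q `^ p^-1; have t0 : 0 <= t by exact: powR_ge0.
  have tp : t `^ p = q.
    by rewrite /t -powRrM mulVf ?powRr1 ?(ltW q0)// gt_eqF.
  have Wt := W_Z oO bO p1 t Wv.
  apply: le_lt_trans (umin _ _ Wt) _.
  have Et : E (fun x => t *: gv x) = q * E gv.
    have i1 := enorm_powR_itg (W_enorm oO bO p1 Wv).
    rewrite -tp -(RintegralZl _ mO i1); congr Rintegral; apply/funext => x.
    exact: enormZ_powR.
  have St : S (fun x => t * v x) = q * S v.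
    rewrite /S -tp -(RintegralZl _ mO (c_itg Lv.2)); congr Rintegral; apply/funext => x.
    by rewrite normrM powRM// (ger0_norm t0) mulrCA.
  by rewrite Et /Phi St; exact: hq.
have un0 : ~ {ae leb, forall x, Omega x -> u x = 0}.
  move=> u0; have Su : S u = 0.
    rewrite /S (_ : 0 = \int[leb]_(x in Omega) (0 : R)).
      apply: (Int_ae_eq mO); [exact: itg_meas (c_itg Lu.2)|exact: measurable_cst|].
      by apply: filterS u0 => x /[apply] ->; rewrite normr0 powR0 ?gt_eqF// mulr0.
    by rewrite Rintegral_cst ?mul0r//; exact: mO.
  have Eg0 : 0 <= E g by apply: Rintegral_ge0 => x _; exact: powR_ge0.
  move: Jneg; rewrite /Phi Su /saturation mulr0 mul0r mulr0 subr0 ltNge.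
  by rewrite (divr_ge0 Eg0 (ltW p0)).
pose gam := l' / ((1 + S u) * (1 + S u)).
pose L psi := gam * \int[leb]_(x in Omega) (c x * (ppow p (u x) * psi x)).
have dPhi psi gpsi : W psi gpsi ->
    (Phi (fun x => u x + (k.+1%:R^-1 : R) * psi x) - Phi u) / (k.+1%:R^-1 : R) @[k --> \oo] --> L psi.
  move=> Wpsi; have Lpsi := W_Lp oO bO p1 Wpsi.
  apply: (saturation_derivative (p0 : 0 < p) s0 (fun k => weighted_mass_ge0 _)).
  - by move=> k; rewrite invr_eq0 pnatr_eq0.
  - exact: cvg_harmonic.
  - exact: weighted_mass_quotient Lu Lpsi.
have LN psi gpsi : W psi gpsi -> L (fun x => -1 * psi x) = - L psi.
  move=> Wpsi; have i1 := c_itg (ppow_mul_itg Lu (W_Lp oO bO p1 Wpsi)).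
  have := RintegralZl (-1) mO i1; rewrite mulN1r => h; rewrite /L -mulrN -h.
  by congr (_ * _); congr Rintegral; apply/funext => x; ring.
have EL := euler_lagrange Wu umin dPhi LN.
have gam_le : gam <= l' := saturation_slope_le l'0 s0.
suff : gamma <= gam by rewrite leNgt (le_lt_trans gam_le l'g).
apply: first; exists u, g; split => // psi gpsi Wpsi.
rewrite (EL _ _ Wpsi) /L -(RintegralZl _ mO (c_itg (ppow_mul_itg Lu (W_Lp oO bO p1 Wpsi)))).
by congr Rintegral; apply/funext => x; ring.
Qed.

End rayleigh.

(** * Semilinear problems and truncated powers *)

(** The weight [(2 p K P + 1)^-1] lets the inequality of Poincare, of constant [P], absorb a source
    bounded by [K] into half of the energy. *)
Lemma coercive_arith (R : realType) (p K P e2 N2 : R) : 1 < p -> 0 <= K -> 0 < P -> 0 <= e2 ->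
  N2 <= P * e2 -> K * ((2 * p * (K * P) + 1)^-1 * N2) <= (2 * p)^-1 * e2.
Proof.
move=> p1 K0 P0 e0 h; have p0 : 0 < p := lt_trans ltr01 p1.
have q0 : 0 < 2 * p * (K * P) + 1 by rewrite ltr_wpDl// !mulr_ge0// ltW.
apply: (@le_trans _ _ (K * ((2 * p * (K * P) + 1)^-1 * (P * e2)))).
  by rewrite ler_wpM2l// ler_wpM2l// invr_ge0 ltW.
rewrite (_ : K * _ = K * P / (2 * p * (K * P) + 1) * e2); last by ring.
apply: ler_wpM2r => //; rewrite ler_pdivrMr//.
rewrite (_ : (2 * p)^-1 * _ = K * P + (2 * p)^-1); last by field; rewrite gt_eqF.
by rewrite lerDl invr_ge0 mulr_ge0// ltW.
Qed.

Section semilinear.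
Context {R : realType} {n : nat}.
Variables (Omega : set 'rV[R]_n.+1) (p : R).
Hypotheses (oO : open Omega) (bO : bounded_set Omega) (p1 : 1 < p).
Local Notation leb := (lebesgue_rV n.+1).
Local Notation mO := (open_measurable_rV oO).
Local Notation Ofin := (measure_domain_lty oO bO).
Local Notation Lpo := (Lp leb Omega p).
Local Notation W := (W01p Omega p).
Local Notation E g := (\int[leb]_(x in Omega) enorm (g x) `^ p).
Implicit Types (u v w psi : 'rV[R]_n.+1 -> R) (g gpsi : 'rV[R]_n.+1 -> 'rV[R]_n.+1).

Lemma itg_bounded_mul w f (C : R) : measurable_fun Omega w -> (forall x, `|w x| <= C) ->
  leb.-integrable Omega (EFin \o f) -> leb.-integrable Omega (EFin \o (fun x => w x * f x)).
Proof.
move=> mw wC fi; apply: (itg_le mO _ _ (itgZ mO C (itg_norm fi))).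
  by apply: measurable_funM => //; exact: itg_meas fi.
by move=> x _; rewrite normrM ler_wpM2r.
Qed.

(** Up to a constant, the L^1 norm is small relative to the integral of the [p]-th power,
    hence to the energy: this is how bounded sources are absorbed. *)
Lemma Int_norm_le v (e : R) : 0 < e -> Lpo v ->
  \int[leb]_(x in Omega) `|v x| <=
  e * fine (leb Omega) + e `^ (1 - p) * \int[leb]_(x in Omega) `|v x| `^ p.
Proof.
move=> e0 Lv; have ic := itg_cst mO Ofin e.
have iv := itgZ mO (e `^ (1 - p)) Lv.2.
have ec : \int[leb]_(x in Omega) e = e * fine (leb Omega).
  by rewrite Rintegral_cst//; exact: mO.
rewrite -(RintegralZl _ mO Lv.2) -ec -(RintegralD mO ic iv).
apply: le_Rintegral; [exact: mO|exact: itg_norm (Lp_itg mO Ofin p1 Lv)|exact: (itgD mO ic iv)|].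
by move=> x _; exact: normr_le_powR.
Qed.

Variables (F f : 'rV[R]_n.+1 -> R -> R) (K K0 : R).
Hypotheses (Fsub : forall x y z, F x y + f x y * (z - y) <= F x z)
  (fK : forall x y, `|f x y| <= K) (fc : forall x, continuous (f x))
  (F0 : forall x, `|F x 0| <= K0)
  (mF : forall v, measurable_fun Omega v -> measurable_fun Omega (fun x => F x (v x)))
  (mf : forall v, measurable_fun Omega v -> measurable_fun Omega (fun x => f x (v x))).

Let Kge0 : 0 <= K.
Proof. exact: le_trans (fK 0 0). Qed.

Let Flip x y z : `|F x z - F x y| <= K * `|z - y|.
Proof.
have hf r d : f x r * d <= K * `|d|.
  by rewrite (le_trans (ler_norm _))// normrM ler_wpM2r.
have h1 := Fsub x y z; have h2 := Fsub x z y.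
have h3 := hf z (z - y); have h4 := hf y (y - z); rewrite distrC in h4.
have E1 : f x z * (y - z) = - (f x z * (z - y)) by ring.
have E2 : f x y * (z - y) = - (f x y * (y - z)) by ring.
rewrite E1 in h2; rewrite E2 in h1.
rewrite ler_norml; move: (f x z * _) (f x y * _) (K * _) h1 h2 h3 h4 => a b d h1 h2 h3 h4.
by apply/andP; split; lra.
Qed.

Let F_itg v : Lpo v -> leb.-integrable Omega (EFin \o (fun x => F x (v x))).
Proof.
move=> Lv; have ic := itg_cst mO Ofin K0.
have iv := itgZ mO K (itg_norm (Lp_itg mO Ofin p1 Lv)).
apply: (itg_le mO (mF Lv.1) _ (itgD mO ic iv)) => x _.
have := Flip x 0 (v x); rewrite subr0 => h.
rewrite -[F x (v x)](subrK (F x 0)) (le_trans (ler_normD _ _))// addrC.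
by apply: lerD; [exact: F0|exact: h].
Qed.

Let Phi v := \int[leb]_(x in Omega) F x (v x).

Let Phi_dist u v : Lpo u -> Lpo v -> `|Phi v - Phi u| <= K * \int[leb]_(x in Omega) `|v x - u x|.
Proof.
move=> Lu Lv; have iB := itgB mO (F_itg Lv) (F_itg Lu).
have id_ := itg_norm (Lp_itg mO Ofin p1 (LpB mO p1 Lv Lu)).
rewrite /Phi -(RintegralB mO (F_itg Lv) (F_itg Lu)) -(RintegralZl _ mO id_).
apply: le_trans (le_normr_Rintegral mO iB) _.
apply: le_Rintegral; [exact: mO|exact: itg_norm iB|exact: (itgZ mO K id_)|].
by move=> x _; exact: Flip.
Qed.

Let Phi_continuous : Lp_continuous Omega p Phi.
Proof.
move=> u Lu e e0; set V := fine (leb Omega).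
have V0 : 0 <= V by rewrite fine_ge0.
have KV0 : 0 <= K * V by exact: mulr_ge0.
pose d := e / (2 * (K * V + 1)); have d0 : 0 < d by rewrite divr_gt0// mulr_gt0// ltr_wpDl.
pose q := d `^ (1 - p); have q0 : 0 < q by exact: powR_gt0.
have Kq0 : 0 <= K * q by rewrite mulr_ge0// ltW.
exists (e / (2 * (K * q + 1))); first by rewrite divr_gt0// mulr_gt0// ltr_wpDl.
move=> v Lv hv; apply: le_trans (Phi_dist Lu Lv) _.
have h := Int_norm_le d0 (LpB mO p1 Lv Lu); rewrite -/V -/q in h.
apply: le_trans (ler_wpM2l Kge0 h) _; rewrite mulrDr [leRHS]splitr; apply: lerD.
  by rewrite mulrCA; apply: mul_half_le => //; exact: ltW.
rewrite mulrA; apply: le_trans (ler_wpM2l Kq0 hv) _.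
by rewrite mulrC; apply: mul_half_le => //; exact: ltW.
Qed.

Let coercive : exists b : R, forall u g, W u g -> (2 * p)^-1 * E g - b <= E g / p - Phi u.
Proof.
have p0 : 0 < p := lt_trans ltr01 p1; have [P P0 hP] := poincare_W oO bO p1.
set V := fine (leb Omega).
pose q := 2 * p * (K * P) + 1.
have q0 : 0 < q by rewrite ltr_wpDl// mulr_ge0// ?mulr_ge0 ?(ltW p0) ?(ltW P0).
pose e := q `^ (p - 1)^-1; have e0 : 0 < e by exact: powR_gt0.
have eE : e `^ (1 - p) = q^-1.
  rewrite -opprB powRN /e -powRrM mulVf ?powRr1 ?(ltW q0)//.
  by rewrite subr_eq0 gt_eqF.
exists (Phi (fun=> 0) + K * (e * V)) => u g Wu; have Lu := W_Lp oO bO p1 Wu.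
have L0 : Lpo (fun=> 0) := W_Lp oO bO p1 (W_0 oO bO p1).
have h1 := Phi_dist L0 Lu; rewrite (_ : (fun x => `|u x - 0|) = fun x => `|u x|) in h1; last first.
  by apply/funext => x; rewrite subr0.
have h2 := Int_norm_le e0 Lu; rewrite -/V eE in h2.
have h3 := hP _ _ Wu.
have E0 : 0 <= E g by apply: Rintegral_ge0 => x _; exact: powR_ge0.
set N1 := Rintegral _ _ _ in h1 h2; set N2 := Rintegral _ _ _ in h2 h3; set e2 := E g in h3 E0 *.
have h4 : K * (q^-1 * N2) <= (2 * p)^-1 * e2 := coercive_arith p1 Kge0 P0 E0 h3.
have h5 : Phi u - Phi (fun=> 0) <= K * N1 by apply: le_trans h1; exact: ler_norm.
have h6 := ler_wpM2l Kge0 h2; rewrite mulrDr in h6.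
have E2 : e2 / p = (2 * p)^-1 * e2 + (2 * p)^-1 * e2 by field; rewrite gt_eqF.
rewrite E2; clear -h4 h5 h6.
move: (Phi u) (Phi _) (K * N1) (K * (e * V)) (K * (q^-1 * N2)) ((2 * p)^-1 * e2) h4 h5 h6 => a b c d x y; lra.
Qed.

Let Phi_quotient u psi : Lpo u -> Lpo psi ->
  (Phi (fun x => u x + (k.+1%:R^-1 : R) * psi x) - Phi u) / (k.+1%:R^-1 : R) @[k --> \oo] -->
  \int[leb]_(x in Omega) (f x (u x) * psi x).
Proof.
move=> Lu Lpsi; pose t (k : nat) : R := k.+1%:R^-1.
have t0 k : 0 < t k by rewrite invr_gt0 ltr0n.
have Lt k : Lpo (fun x => u x + t k * psi x) := LpD mO p1 Lu (LpZ mO (t k) Lpsi).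
pose Q k x := (t k)^-1 * (F x (u x + t k * psi x) - F x (u x)).
have iQ k : leb.-integrable Omega (EFin \o Q k).
  exact: (itgZ mO _ (itgB mO (F_itg (Lt k)) (F_itg Lu))).
have E1 k : (Phi (fun x => u x + t k * psi x) - Phi u) / t k = \int[leb]_(x in Omega) Q k x.
  rewrite /Phi -(RintegralB mO (F_itg (Lt k)) (F_itg Lu)) mulrC.
  by rewrite -(RintegralZl _ mO (itgB mO (F_itg (Lt k)) (F_itg Lu))).
rewrite (_ : (fun k => _) = fun k => \int[leb]_(x in Omega) Q k x); last by apply/funext => k; exact: E1.
have iB := itgZ mO K (itg_norm (Lp_itg mO Ofin p1 Lpsi)).
have [|||_ _ //] := @dct _ _ _ leb _ mO Q (fun x => f x (u x) * psi x) _
  (fun k => itg_meas (iQ k)) _ _ iB _.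
- by apply: measurable_funM; [exact: mf Lu.1|exact: Lpsi.1].
- apply: aeW => x _.
  apply: (@squeeze_cvgr _ _ _ _ (fun=> f x (u x) * psi x)
    (fun k : nat => f x (u x + t k * psi x) * psi x)).
  + apply: nearW => k; rewrite /Q -/(t k).
    have h1 := Fsub x (u x) (u x + t k * psi x); have h2 := Fsub x (u x + t k * psi x) (u x).
    rewrite addrAC subrr add0r in h1; rewrite opprD addrA subrr sub0r in h2.
    move: (t k) (t0 k) (psi x) h1 h2 => a a0 b h1 h2.
    rewrite [a^-1 * _]mulrC ler_pdivlMr// ler_pdivrMr//.
    move: (F x _) (F x _) (f x _) (f x _) h1 h2 => d1 d2 d3 d4 h1 h2.
    by apply/andP; split; lra.
  + exact: cvg_cst.
  + apply: cvgM; last exact: cvg_cst.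
    have cz : (fun k => u x + t k * psi x) @ \oo --> u x + 0 * psi x.
      apply: cvgD; first exact: cvg_cst.
      by apply: cvgM; [exact: cvg_harmonic|exact: cvg_cst].
    rewrite mul0r addr0 in cz.
    by apply: cvg_comp cz _; exact: fc.
- apply: aeW => x k _; rewrite /Q normrM [`|_^-1|]gtr0_norm ?invr_gt0// mulrC ler_pdivrMr ?t0//.
  have := Flip x (u x) (u x + t k * psi x); rewrite addrAC subrr add0r normrM (gtr0_norm (t0 k)).
  by rewrite mulrA mulrAC.
Qed.

(** Since [f x] is the derivative of the convex function [F x] and is bounded, the
    energy is coercive and differentiable along lines. *)
Theorem semilinear_existence : exists v g, W v g /\ forall psi gpsi, W psi gpsi ->
  plap_form Omega p g gpsi = \int[leb]_(x in Omega) (f x (v x) * psi x).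
Proof.
have p0 : 0 < p := lt_trans ltr01 p1; have [b hb] := coercive.
have a0 : 0 < (2 * p)^-1 by rewrite invr_gt0 mulr_gt0.
have [v [g [Wv vmin]]] := minimiser oO bO p1 a0 Phi_continuous hb.
exists v, g; split => //; have Lv := W_Lp oO bO p1 Wv.
apply: (euler_lagrange oO bO p1 (L := fun psi => \int[leb]_(x in Omega) (f x (v x) * psi x)) Wv vmin).
  by move=> psi gpsi Wpsi; exact: Phi_quotient Lv (W_Lp oO bO p1 Wpsi).
move=> psi gpsi Wpsi.
have i1 := itg_bounded_mul (mf Lv.1) (fun x => fK x (v x)) (Lp_itg mO Ofin p1 (W_Lp oO bO p1 Wpsi)).
have := RintegralZl (-1) mO i1; rewrite mulN1r => <-.
by congr Rintegral; apply/funext => x; ring.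
Qed.

End semilinear.

Section truncated_power.
Context {R : realType}.
Variable p : R.
Hypothesis p1 : 1 < p.
Implicit Types (b s y z : R).

Lemma clamp_below a b t : a <= b -> t <= a -> clamp a b t = a.
Proof.
by move=> ab ta; rewrite /clamp !ler0_norm ?subr_le0 ?(le_trans ta)//; field.
Qed.

Lemma clamp_above a b t : a <= b -> b <= t -> clamp a b t = b.
Proof.
by move=> ab bt; rewrite /clamp !ger0_norm ?subr_ge0 ?(le_trans ab)//; field.
Qed.

(** The convex function whose derivative is [clamp 1 b y `^ (p - 1)]. *)
Definition truncated_power b y : R :=
  y * clamp 1 b y `^ (p - 1) - (1 - p^-1) * clamp 1 b y `^ p.

(** [truncated_power b y] is the largest of these affine functions of [y], for [s] in the
    segment; the maximum is reached at [clamp 1 b y]. *)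
Lemma truncated_power_ge b s y : 1 <= s <= b ->
  y * s `^ (p - 1) - (1 - p^-1) * s `^ p <= truncated_power b y.
Proof.
move=> /andP[s1 sb]; have b1 := le_trans s1 sb; have p0 : 0 < p := lt_trans ltr01 p1.
rewrite /truncated_power; have /andP[r1 rb] := clamp_in y b1.
have key : 0 <= (y - clamp 1 b y) * (clamp 1 b y `^ (p - 1) - s `^ (p - 1)).
  have pp : 0 <= p - 1 by rewrite subr_ge0 ltW.
  have [y1|/ltW y1] := leP y 1.
    rewrite clamp_below// mulr_le0 ?subr_le0//; exact: ler_powR2.
  have [yb|/ltW yb] := leP y b; first by rewrite clampE ?y1// subrr mul0r.
  rewrite clamp_above// mulr_ge0 ?subr_ge0//.
  by apply: ler_powR2 => //; exact: le_trans s1.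
move: (clamp 1 b y) r1 rb key => r r1 rb key.
have r0 : 0 <= r by exact: le_trans r1.
have s0 : 0 <= s by exact: le_trans s1.
(* tangent of [X `^ q] with the conjugate exponent [q = p / (p - 1)] at [X = r `^ (p - 1)] *)
pose q := p / (p - 1); have pm0 : 0 < p - 1 by rewrite subr_gt0.
have q1 : 1 < q by rewrite /q ltr_pdivlMr// mul1r ltrBlDr ltrDl.
have qE z : 0 <= z -> (z `^ (p - 1)) `^ q = z `^ p.
  by move=> z0; rewrite -powRrM /q mulrC divfK// gt_eqF.
have q2 : (r `^ (p - 1)) `^ (q - 1) = r.
  rewrite -powRrM (_ : (p - 1) * (q - 1) = 1) ?powRr1//.
  by rewrite /q; field; rewrite gt_eqF.
have := powR_tangent q1 (powR_ge0 r (p - 1)) (powR_ge0 s (p - 1)).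
rewrite !qE// q2 => h.
have qi : q^-1 = 1 - p^-1 by rewrite /q; field; rewrite !gt_eqF.
have h' : q^-1 * r `^ p + r * (s `^ (p - 1) - r `^ (p - 1)) <= q^-1 * s `^ p.
  have q0 : 0 < q := lt_trans ltr01 q1.
  rewrite -(ler_pM2l q0) mulrDr !mulrA divff ?gt_eqF// !mul1r.
  by rewrite -mulrA mulrA.
rewrite qi in h'; move: key h'.
move: (1 - p^-1) (r `^ p) (s `^ p) (r `^ (p - 1)) (s `^ (p - 1)) => x1 x2 x3 x4 x5; nra.
Qed.

Lemma truncated_power_sub b y z : 1 <= b ->
  truncated_power b y + clamp 1 b y `^ (p - 1) * (z - y) <= truncated_power b z.
Proof.
move=> b1; apply: le_trans (truncated_power_ge z (clamp_in y b1)).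
by apply: eq_ler; rewrite /truncated_power; ring.
Qed.

Lemma clamp_continuous (a b : R) : continuous (clamp a b).
Proof.
move=> t; apply: cvgD; first exact: cvg_cst.
apply: cvgMl; apply: cvgB; apply: cvg_norm; apply: cvgB; try exact: cvg_cst; exact: cvg_id.
Qed.

Lemma clamp_powR_continuous b : 1 <= b -> continuous (fun y => clamp 1 b y `^ (p - 1)).
Proof.
move=> b1 t; have /andP[c1 _] := clamp_in t b1.
apply: (@continuous_comp _ _ _ (clamp 1 b) (fun y => y `^ (p - 1))); first exact: clamp_continuous.
apply: is_derive_continuous (is_derive1_powR (p - 1) _).
exact: lt_le_trans c1.
Qed.

End truncated_power.

(** * Comparison and the Hopf-Cole transform *)

Section pointwise.
Context {R : realType} {n : nat}.
Variable p : R.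
Hypothesis p1 : 1 < p.
Implicit Types (t r : R) (a b : 'rV[R]_n).

Lemma heaviside_in t : 0 <= heaviside t <= 1.
Proof.
by rewrite /heaviside; case: sgrP => _; apply/andP; split; lra.
Qed.

Lemma posp_ge0 t : 0 <= posp t.
Proof. by have := ler_norm (- t); rewrite normrN /posp => h; lra. Qed.

Lemma posp_pos t : 0 <= t -> posp t = t.
Proof. by move=> t0; rewrite /posp ger0_norm//; field. Qed.

Lemma posp_neg t : t <= 0 -> posp t = 0.
Proof. by move=> t0; rewrite /posp ler0_norm// subrr mul0r. Qed.

Lemma posp_eq0 t : posp t = 0 -> t <= 0.
Proof.
move=> h; rewrite leNgt; apply/negP => t0; move: h; rewrite posp_pos ?ltW//.
by move=> h; rewrite h ltxx in t0.
Qed.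

Lemma posp_le_norm t : posp t <= `|t|.
Proof. by rewrite /posp; have := ler_norm t => h; lra. Qed.

(** A bounded function of [t] that is positive exactly where [t] is, so that it may
    serve as a test function. *)
Definition cap t : R := posp t - posp (posp t - 1).
Definition dcap t : R := heaviside t * (1 - heaviside (posp t - 1)).

Lemma cap_in t : 0 <= cap t <= 1.
Proof.
rewrite /cap; have t0 := posp_ge0 t; move: (posp t) t0 => s s0.
have [s1|/ltW s1] := leP s 1.
  by rewrite (posp_neg (t := s - 1)) ?subr_le0// subr0 s0.
rewrite (posp_pos (t := s - 1)); last by rewrite subr_ge0.
have -> : s - (s - 1) = 1 by ring.
by rewrite ler01 lexx.
Qed.

Lemma cap_eq0 t : cap t = 0 -> t <= 0.
Proof.
rewrite /cap => /eqP; rewrite subr_eq0 => /eqP h; apply: posp_eq0.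
have [s1|/ltW s1] := leP (posp t) 1; first by rewrite h posp_neg// subr_le0.
by move: h; rewrite (posp_pos (t := posp t - 1)) ?subr_ge0// => h; exfalso; lra.
Qed.

Lemma cap_neg t : t <= 0 -> cap t = 0.
Proof. by move=> t0; rewrite /cap (posp_neg t0) posp_neg ?subr0// sub0r oppr_le0. Qed.

Lemma dcap_in t : 0 <= dcap t <= 1.
Proof.
have /andP[h1 h2] := heaviside_in t; have /andP[h3 h4] := heaviside_in (posp t - 1).
have k1 : 0 <= 1 - heaviside (posp t - 1) by rewrite subr_ge0.
have k2 : 1 - heaviside (posp t - 1) <= 1 by rewrite lerBlDr lerDl.
by rewrite /dcap mulr_ge0//= -[leRHS]mulr1 ler_pM.
Qed.

Lemma powR_le_self t : 0 <= t <= 1 -> t `^ p <= t.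
Proof.
move=> /andP[t0 t1]; rewrite (powR_pow_pred p1 t0) ler_piMr//.
have E1 : (1 : R) `^ (p - 1) = 1 by rewrite powR1.
by rewrite -[leRHS]E1; apply: ler_powR2 => //; rewrite subr_ge0 ltW.
Qed.

Lemma enorm_scale_le t a : 0 <= t <= 1 -> enorm (t *: a) `^ p <= t * enorm a `^ p.
Proof.
move=> t01; have /andP[t0 _] := t01; rewrite (enormZ_powR p a t0).
by rewrite ler_wpM2r ?powR_ge0// powR_le_self.
Qed.

Lemma plapZ r a b : 0 < r ->
  enorm (r *: a) `^ (p - 2) * dotrV (r *: a) b = r `^ (p - 1) * (enorm a `^ (p - 2) * dotrV a b).
Proof.
move=> r0; rewrite enormZ gtr0_norm// dotrVZl powRM ?enorm_ge0 ?(ltW r0)//.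
have -> : p - 1 = (p - 2) + 1 by ring.
rewrite [in RHS]powRD; last by rewrite (gt_eqF r0) implybT.
by rewrite powRr1 ?(ltW r0)// mulrACA.
Qed.

Lemma expR_powR t : expR t `^ (p - 1) = expR ((p - 1) * t).
Proof. by rewrite /powR gt_eqF ?expR_gt0// expRK. Qed.

End pointwise.

Section sobolev_compositions.
Context {R : realType} {n : nat}.
Variables (Omega : set 'rV[R]_n.+1) (p : R).
Hypotheses (oO : open Omega) (bO : bounded_set Omega) (p1 : 1 < p).
Local Notation leb := (lebesgue_rV n.+1).
Local Notation mO := (open_measurable_rV oO).
Local Notation Lpo := (Lp leb Omega p).
Local Notation W := (W01p Omega p).
Local Notation E g := (\int[leb]_(x in Omega) enorm (g x) `^ p).
Implicit Types (u v w z phi : 'rV[R]_n.+1 -> R) (g gw gz gphi : 'rV[R]_n.+1 -> 'rV[R]_n.+1).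

Lemma W_posp u g : W u g -> W (fun x => posp (u x)) (fun x => heaviside (u x) *: g x).
Proof.
move=> Wu; have [_ _ /(_ _ _ Wu)] := chain_pos oO bO p1 0.
rewrite (_ : (fun x => posp (u x - 0) - posp (- 0)) = fun x => posp (u x)).
  by rewrite (_ : (fun x => heaviside (u x - 0) *: g x) = fun x => heaviside (u x) *: g x)//;
    apply/funext => x; rewrite subr0.
by apply/funext => x; rewrite subr0 oppr0 (posp_pos (lexx 0)) subr0.
Qed.

Lemma W_cap w gw : W w gw -> W (fun x => cap (w x)) (fun x => dcap (w x) *: gw x).
Proof.
move=> Ww; have Wp := W_posp Ww; have [_ _ /(_ _ _ Wp)] := chain_pos oO bO p1 1.
move=> /(W_B oO bO p1 Wp).
rewrite (_ : (fun x => posp (w x) - _) = fun x => cap (w x)); last first.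
  by apply/funext => x; rewrite /cap [posp (- 1)]posp_neg ?oppr_le0// subr0.
rewrite (_ : (fun x => _ *: gw x - _) = fun x => dcap (w x) *: gw x)//.
by apply/funext => x; rewrite /dcap scalerA -scalerBl; congr (_ *: _); ring.
Qed.

(** Products of bounded functions of [W_0^{1,p}] with exponentials are the test functions of
    the Hopf-Cole transform. *)
Lemma W_exp_mul (a M B : R) z gz phi gphi : W z gz -> (forall x, `|z x| <= M) ->
  W phi gphi -> (forall x, `|phi x| <= B) ->
  W (fun x => expR (a * z x) * phi x)
    (fun x => expR (a * z x) *: gphi x + (a * expR (a * z x) * phi x) *: gz x).
Proof.
move=> Wz zM Wphi phiB; have We := W_expR oO bO p1 a Wz zM.
pose C := expR (`|a| * M) + 1 + B.
have B0 : 0 <= B := le_trans (normr_ge0 _) (phiB 0).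
have e1 x : `|expR (a * z x) - 1| <= C.
  have h : expR (a * z x) <= expR (`|a| * M).
    by rewrite ler_expR (le_trans (ler_norm _))// normrM ler_wpM2l.
  rewrite (le_trans (ler_normB _ _))// normr1 ger0_norm ?expR_ge0// /C.
  by rewrite -addrA lerD// lerDl.
have e2 x : `|phi x| <= C by rewrite (le_trans (phiB x))// /C lerDr addr_ge0// expR_ge0.
have := W_D oO bO p1 (W_mul oO bO p1 We Wphi e1 e2) Wphi.
rewrite (_ : (fun x => _ * phi x + phi x) = fun x => expR (a * z x) * phi x); last first.
  by apply/funext => x; ring.
rewrite (_ : (fun x => _ + gphi x) = fun x => expR (a * z x) *: gphi x + (a * expR (a * z x) * phi x) *: gz x)//.
by apply/funext => x; apply/rowP => i; rewrite !mxE; ring.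
Qed.

Lemma W_energy_eq0 u g : W u g -> E g <= 0 -> {ae leb, forall x, Omega x -> u x = 0}.
Proof.
move=> Wu Eg; have [P P0 hP] := poincare_W oO bO p1.
apply: (norm_eq0_ae oO p1 (W_Lp oO bO p1 Wu)).
by apply: le_trans (hP _ _ Wu) _; rewrite pmulr_rle0.
Qed.

Lemma measurable_heaviside : measurable_fun setT (@heaviside R).
Proof.
have [_ m _] := chain_pos oO bO p1 0.
by rewrite (_ : heaviside = fun t => heaviside (t - 0))//; apply/funext => t; rewrite subr0.
Qed.

(** A truncation multiplies the gradient by some [th] in [[0, 1]], and [th^p <= th]; testing
    an equation with a truncation produces the integral on the right. *)
Lemma scaled_energy_le (th : 'rV[R]_n.+1 -> R) u g w : W u g ->
  W w (fun x => th x *: g x) -> measurable_fun Omega th -> (forall x, 0 <= th x <= 1) ->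
  leb.-integrable Omega (EFin \o (fun x => th x * enorm (g x) `^ p)) /\
  E (fun x => th x *: g x) <= \int[leb]_(x in Omega) (th x * enorm (g x) `^ p).
Proof.
move=> Wu Ww mth th01.
have i1 : leb.-integrable Omega (EFin \o (fun x => th x * enorm (g x) `^ p)).
  apply: (itg_bounded_mul oO mth (C := 1)); last exact: enorm_powR_itg (W_enorm oO bO p1 Wu).
  by move=> x; have /andP[h1 h2] := th01 x; rewrite ger0_norm.
split=> //; apply: le_Rintegral; [exact: mO|exact: enorm_powR_itg (W_enorm oO bO p1 Ww)|exact: i1|].
by move=> x _; exact: enorm_scale_le.
Qed.

Lemma measurable_clamp (b y : 'rV[R]_n.+1 -> R) (a : R) : measurable_fun Omega b -> measurable_fun Omega y ->
  measurable_fun Omega (fun x => clamp a (b x) (y x)).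
Proof.
move=> mb my; rewrite /clamp; apply: measurable_funD.
  by apply: measurable_funM => //; apply: measurable_funD.
apply: measurable_funM => //; apply: measurable_funB.
  by apply: measurableT_comp => //; apply: measurable_funB.
by apply: measurableT_comp => //; apply: measurable_funB.
Qed.

(** Bounds that hold almost everywhere are turned into bounds that hold everywhere, with the
    same gradient. *)
Lemma W_clamp_ae u g (a b : R) : a <= b -> W u g ->
  {ae leb, forall x, Omega x -> a <= u x <= b} ->
  W (fun x => clamp a b (u x)) g /\ {ae leb, forall x, Omega x -> u x = clamp a b (u x)}.
Proof.
move=> ab Wu h; have ae_eq : {ae leb, forall x, Omega x -> u x = clamp a b (u x)}.
  by apply: filterS h => x /[apply] ub; rewrite clampE.
split=> //; apply: (W_ae_eq oO bO p1 Wu) => //.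
- by apply: measurable_clamp => //; exact: (W_Lp oO bO p1 Wu).1.
- by move=> i; exact: (W_Lp_grad oO bO p1 i Wu).1.
- exact: aeW.
Qed.

End sobolev_compositions.

Section comparison.
Context {R : realType} {n : nat}.
Variables (Omega : set 'rV[R]_n.+1) (p : R).
Hypotheses (oO : open Omega) (bO : bounded_set Omega) (p1 : 1 < p).
Local Notation leb := (lebesgue_rV n.+1).
Local Notation mO := (open_measurable_rV oO).
Local Notation Ofin := (measure_domain_lty oO bO).
Local Notation Lpo := (Lp leb Omega p).
Local Notation W := (W01p Omega p).
Local Notation E g := (\int[leb]_(x in Omega) enorm (g x) `^ p).
Implicit Types (u v w z phi : 'rV[R]_n.+1 -> R) (g gv gw gz gphi : 'rV[R]_n.+1 -> 'rV[R]_n.+1).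
Variables (c h : 'rV[R]_n.+1 -> R) (Mc Mh mu lambda : R).
Hypotheses (mc : measurable_fun Omega c) (cM : forall x, 0 <= c x <= Mc).
Hypotheses (mh : measurable_fun Omega h) (hM : forall x, 0 <= h x <= Mh).
Hypotheses (mu0 : 0 < mu) (l0 : 0 <= lambda).

Definition source u g x := lambda * c x * ppow p (u x) + mu * enorm (g x) `^ p + h x.

Lemma h_itg f : leb.-integrable Omega (EFin \o f) ->
  leb.-integrable Omega (EFin \o (fun x => h x * f x)).
Proof. by move=> fi; exact: (c_itg oO mh hM fi). Qed.

Lemma source_itg u g : W u g -> leb.-integrable Omega (EFin \o source u g).
Proof.
move=> Wu; have i1 := enorm_powR_itg (W_enorm oO bO p1 Wu); have Lu := W_Lp oO bO p1 Wu.
have L1 : Lpo (fun=> 1) by apply: (@Lp_bounded _ _ _ _ _ mO _ Ofin p1 _ 1) => // x _; rewrite normr1.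
have i2 := ppow_mul_itg oO p1 Lu L1.
have ih := h_itg (itg_cst mO Ofin 1).
have i3 := itgZ mO lambda (c_itg oO mc cM i2).
have := itgD mO (itgD mO i3 (itgZ mO mu i1)) ih.
rewrite (_ : (fun x => _ + h x * 1) = source u g)//.
by apply/funext => x; rewrite /source !mulr1 mulrA.
Qed.

(** Test functions are bounded everywhere, not merely almost everywhere; representatives
    reconcile the two. *)
Definition weak_equation u g := forall phi gphi B, W phi gphi -> (forall x, `|phi x| <= B) ->
  plap_form Omega p g gphi = \int[leb]_(x in Omega) (source u g x * phi x).

Lemma source_mul_itg u g phi gphi B : W u g -> W phi gphi -> (forall x, `|phi x| <= B) ->
  leb.-integrable Omega (EFin \o (fun x => source u g x * phi x)).
Proof.
move=> Wu Wphi phiB.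
have := itg_bounded_mul oO (W_Lp oO bO p1 Wphi).1 phiB (source_itg Wu).
by rewrite (_ : (fun x => phi x * _) = fun x => source u g x * phi x)//; apply/funext => x; rewrite mulrC.
Qed.

(** Testing with the negative part [w] of [u] leaves
    [\int |grad w|^p <= lambda \int c w^p], which forces [w = 0]. *)
Lemma solution_ge0 u g M gamma : 0 < lambda < gamma ->
  (forall gamma', eigenvalue_plap Omega p c gamma' -> gamma <= gamma') ->
  W u g -> (forall x, `|u x| <= M) -> weak_equation u g ->
  {ae leb, forall x, Omega x -> 0 <= u x}.
Proof.
move=> lg first Wu uM eqn; have p0 : 0 < p := lt_trans ltr01 p1.
have WN := W_Z oO bO p1 (-1) Wu; have Ww := W_posp oO bO p1 WN.
pose th x := heaviside (-1 * u x).
have mth : measurable_fun Omega th.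
  apply: measurableT_comp (measurable_heaviside oO bO p1) _.
  exact: (W_Lp oO bO p1 WN).1.
have [i1 Ew] := scaled_energy_le oO bO p1 WN Ww mth (fun x => heaviside_in _).
have wM x : `|posp (-1 * u x)| <= M.
  rewrite ger0_norm ?posp_ge0// (le_trans (posp_le_norm _))//.
  by rewrite normrM normrN1 mul1r.
have EL := eqn _ _ _ Ww wM.
have iw := c_itg oO mc cM (W_Lp oO bO p1 Ww).2.
have iR := source_mul_itg Wu Ww wM.
have key : \int[leb]_(x in Omega) (th x * enorm (-1 *: g x) `^ p) <=
    lambda * weighted_mass Omega p c (fun x => posp (-1 * u x)).
  have EL' : plap_form Omega p g (fun x => th x *: (-1 *: g x)) =
      -1 * \int[leb]_(x in Omega) (th x * enorm (-1 *: g x) `^ p).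
    rewrite -(RintegralZl _ mO i1); congr Rintegral; apply/funext => x.
    rewrite /th !dotrVZr scaleN1r enormN mulrCA [_ * (-1 * _)]mulrCA (plap_self _ p1).
    by ring.
  rewrite EL' in EL.
  have {EL'} EL2 : \int[leb]_(x in Omega) (th x * enorm (-1 *: g x) `^ p) =
      \int[leb]_(x in Omega) (-1 * (source u g x * posp (-1 * u x))).
    by rewrite (RintegralZl _ mO iR) -EL; ring.
  rewrite EL2 /weighted_mass -(RintegralZl _ mO iw).
  apply: le_Rintegral; [exact: mO|exact: (itgZ mO _ iR)|exact: (itgZ mO _ iw)|].
  move=> x _; have w0 := posp_ge0 (-1 * u x).
  have /andP[h0 _] := hM x; have e0 : 0 <= mu * enorm (g x) `^ p.
    by rewrite mulr_ge0 ?powR_ge0// ltW.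
  have pw : ppow p (u x) * posp (-1 * u x) = - `|posp (-1 * u x)| `^ p.
    have [ux|/ltW ux] := leP 0 (u x).
      by rewrite posp_neg ?mulN1r ?oppr_le0// mulr0 normr0 powR0 ?oppr0// gt_eqF.
    rewrite posp_pos ?mulN1r ?oppr_ge0// normrN mulrN /ppow.
    have := plap_self (const_mx (u x) : 'rV[R]_1) p1.
    rewrite /enorm /dotrV big_ord1 !mxE -expr2 sqrtr_sqr => <-.
    by rewrite mulrA.
  rewrite (_ : -1 * (source u g x * posp (-1 * u x)) =
    - (lambda * c x) * (ppow p (u x) * posp (-1 * u x)) -
    (mu * enorm (g x) `^ p + h x) * posp (-1 * u x)); last by rewrite /source; ring.
  rewrite pw mulrNN mulrA lerBlDr lerDl mulr_ge0// addr_ge0//.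
have w0 := rayleigh oO bO p1 mc cM lg first Ww (le_trans Ew key).
by apply: filterS w0 => x /[apply] /posp_eq0; rewrite mulN1r oppr_le0.
Qed.

(** Testing the equation with [exp (mu u) phi] cancels the gradient term, and
    [kappa (p - 1) = mu] makes [exp (mu u) |grad u|^(p-2) grad u] the flux of [exp (kappa u) - 1]
    up to the factor [kappa `^ (p - 1)]; the term in [lambda] is dropped, being nonnegative
    since [u >= 0]. *)
Lemma hopf_cole_super u g M phi gphi B (kappa : R) : 0 < kappa -> kappa * (p - 1) = mu ->
  W u g -> (forall x, 0 <= u x <= M) -> weak_equation u g ->
  W phi gphi -> (forall x, 0 <= phi x <= B) ->
  \int[leb]_(x in Omega) (kappa `^ (p - 1) * h x * expR (kappa * u x) `^ (p - 1) * phi x) <=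
  plap_form Omega p (fun x => (kappa * expR (kappa * u x)) *: g x) gphi.
Proof.
move=> k0 kmu Wu uM eqn Wphi phiB; have p0 : 0 < p := lt_trans ltr01 p1.
have uM' x : `|u x| <= M by have /andP[a b] := uM x; rewrite ger0_norm.
have phiB' x : `|phi x| <= B by have /andP[a b] := phiB x; rewrite ger0_norm.
have B0 : 0 <= B := le_trans (normr_ge0 _) (phiB' 0).
have M0 : 0 <= M := le_trans (normr_ge0 _) (uM' 0).
have Wpsi := W_exp_mul oO bO p1 mu Wu uM' Wphi phiB'.
pose e x := expR (mu * u x).
have eB x : `|e x * phi x| <= expR (mu * M) * B.
  by rewrite normrM ger0_norm ?expR_ge0// ler_pM ?expR_ge0// ler_expR ler_pM2l//; case/andP: (uM x).
have EL := eqn _ _ _ Wpsi eB.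
have iR := source_mul_itg Wu Wpsi eB.
have Lg i := W_Lp_grad oO bO p1 i Wu.
have iA := (plap_itg oO p1 Lg (fun i => W_Lp_grad oO bO p1 i Wpsi)).2.
have WV := W_expR oO bO p1 kappa Wu uM'.
have iV := (plap_itg oO p1 (fun i => W_Lp_grad oO bO p1 i WV) (fun i => W_Lp_grad oO bO p1 i Wphi)).2.
have ew x : expR (kappa * u x) `^ (p - 1) = e x.
  by rewrite expR_powR /e -kmu; congr expR; ring.
have me : measurable_fun Omega e.
  apply: (measurableT_comp (@measurable_expR R)).
  by apply: measurable_funM => //; exact: (W_Lp oO bO p1 Wu).1.
have iF : leb.-integrable Omega (EFin \o (fun x => kappa `^ (p - 1) * h x * expR (kappa * u x) `^ (p - 1) * phi x)).
  have i1 := Lp_itg mO Ofin p1 (W_Lp oO bO p1 Wpsi).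
  have := itgZ mO (kappa `^ (p - 1)) (h_itg i1).
  rewrite (_ : (fun x => kappa `^ (p - 1) * _) = fun x => kappa `^ (p - 1) * h x * expR (kappa * u x) `^ (p - 1) * phi x)//.
  by apply/funext => x; rewrite ew /e; ring.
pose K := kappa `^ (p - 1); have K0 : 0 < K by exact: powR_gt0.
pose A x := enorm (g x) `^ (p - 2) * dotrV (g x) (e x *: gphi x + (mu * e x * phi x) *: g x).
have iD := itgZ mO K (itgB mO iA iR).
(* the equation tested with [e phi], written as an integral that can be compared pointwise *)
have D0 : \int[leb]_(x in Omega) (K * (A x - source u g x * (e x * phi x))) = 0.
  rewrite (RintegralZl _ mO (itgB mO iA iR)) (RintegralB mO iA iR).
  by rewrite -EL subrr mulr0.
rewrite -[leLHS]addr0 -D0 -(RintegralD mO iF iD) /plap_form.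
apply: le_Rintegral; [exact: mO|exact: (itgD mO iF iD)|exact: iV|] => x _.
have /andP[u0 _] := uM x; have /andP[c0 _] := cM x; have /andP[phi0 _] := phiB x.
have kx : 0 < kappa * expR (kappa * u x) by rewrite mulr_gt0// expR_gt0.
rewrite (plapZ p _ _ kx) powRM ?expR_ge0 ?(ltW k0)// ew -/K -/(e x) -/(A x).
have -> : A x = e x * (enorm (g x) `^ (p - 2) * dotrV (g x) (gphi x)) + mu * e x * phi x * enorm (g x) `^ p.
  by rewrite /A dotrVDr !dotrVZr -(plap_self (g x) p1); ring.
have pos : 0 <= K * (lambda * c x * ppow p (u x) * (e x * phi x)).
  rewrite mulr_ge0 ?(ltW K0)// mulr_ge0//; last by rewrite mulr_ge0 ?expR_ge0.
  by rewrite mulr_ge0 ?mulr_ge0// powR_ge0.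
rewrite -subr_ge0; move: pos; rewrite /source.
move: (enorm (g x) `^ p) (_ * dotrV _ _) (ppow p _) (e x) => x1 x2 x3 x4 pos.
by apply: le_trans pos _; apply: eq_ler; ring.
Qed.

(** The auxiliary problem [- Delta_p v = k h (clamp 1 b (1 + v))^(p - 1)]. *)
Section truncated_problem.
Variables (k B : R) (b : 'rV[R]_n.+1 -> R).
Hypotheses (k0 : 0 <= k) (mb : measurable_fun Omega b) (b1B : forall x, 1 <= b x <= B).

Definition truncated_source v x := k * h x * clamp 1 (b x) (1 + v x) `^ (p - 1).

Lemma truncated_source_in v x : 0 <= truncated_source v x <= k * Mh * B `^ (p - 1).
Proof.
have /andP[b1 bB] := b1B x; have /andP[h0 h1] := hM x.
have /andP[c1 cb] := clamp_in (1 + v x) b1.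
rewrite /truncated_source; apply/andP; split.
  by rewrite mulr_ge0 ?powR_ge0// mulr_ge0.
apply: ler_pM; [exact: mulr_ge0|exact: powR_ge0|exact: ler_wpM2l|].
apply: ler_powR2; [by rewrite subr_ge0 ltW|exact: le_trans c1|exact: le_trans bB].
Qed.

Let measurable_one_plus v : measurable_fun Omega v -> measurable_fun Omega (fun x => 1 + v x).
Proof. by move=> mv; apply: measurable_funD. Qed.

Let mclamp v q : measurable_fun Omega v ->
  measurable_fun Omega (fun x => clamp 1 (b x) (1 + v x) `^ q).
Proof.
move=> mv; have mq : measurable_fun setT (fun y : R => y `^ q) by exact: measurable_powR.
exact: measurableT_comp mq (measurable_clamp 1 mb (measurable_one_plus mv)).
Qed.

Lemma measurable_truncated_source v : measurable_fun Omega v ->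
  measurable_fun Omega (truncated_source v).
Proof.
move=> mv; apply: measurable_funM; last exact: mclamp.
by apply: measurable_funM.
Qed.

Theorem truncated_existence : exists v gv, W v gv /\ forall psi gpsi, W psi gpsi ->
  plap_form Omega p gv gpsi = \int[leb]_(x in Omega) (truncated_source v x * psi x).
Proof.
have b1 x : 1 <= b x by case/andP: (b1B x).
have kh x : 0 <= k * h x by have /andP[h0 _] := hM x; exact: mulr_ge0.
pose f x y := k * h x * clamp 1 (b x) (1 + y) `^ (p - 1).
pose F x y := k * h x * truncated_power p (b x) (1 + y).
apply: (@semilinear_existence _ _ Omega p oO bO p1 F f (k * Mh * B `^ (p - 1)) (k * Mh)).
- move=> x y z; rewrite /F /f; move: (k * h x) (kh x) => q q0; rewrite -mulrA -mulrDr ler_wpM2l//.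
  have := truncated_power_sub p1 (1 + y) (1 + z) (b1 x).
  by have -> : 1 + z - (1 + y) = z - y by ring.
- by move=> x y; have /andP[h0 h1] := truncated_source_in (fun=> y) x; rewrite ger0_norm.
- move=> x; have c2 : continuous (fun y : R => clamp 1 (b x) (1 + y) `^ (p - 1)).
    move=> y; apply: (@continuous_comp _ _ _ (fun y : R => 1 + y) (fun s => clamp 1 (b x) s `^ (p - 1))).
      have c1 : (fun y => 1 + y) @ y --> 1 + y by apply: cvgD; [exact: cvg_cst|exact: cvg_id].
      exact: c1.
    exact: clamp_powR_continuous.
  by move=> y; exact: (cvgM (cvg_cst (k * h x)) (c2 y)).
- move=> x; rewrite /F addr0 /truncated_power clampE ?lexx ?b1// !powR1 mul1r mulr1.
  rewrite subKr normrM ger0_norm// ger0_norm ?invr_ge0 ?(ltW (lt_trans ltr01 p1))//.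
  have /andP[h0 h1] := hM x; rewrite -[leRHS]mulr1; apply: ler_pM => //.
  + by rewrite invr_ge0 ltW// (lt_trans ltr01).
  + exact: ler_wpM2l.
  + by rewrite invf_le1 ?(lt_trans ltr01 p1)// ltW.
- move=> v mv; apply: measurable_funM; first by apply: measurable_funM.
  apply: measurable_funB; first by apply: measurable_funM; [exact: measurable_one_plus|exact: mclamp].
  by apply: measurable_funM => //; exact: mclamp.
- by move=> v mv; exact: measurable_truncated_source.
Qed.

Variables (v : 'rV[R]_n.+1 -> R) (gv : 'rV[R]_n.+1 -> 'rV[R]_n.+1).
Hypotheses (Wv : W v gv) (v_eqn : forall psi gpsi, W psi gpsi ->
  plap_form Omega p gv gpsi = \int[leb]_(x in Omega) (truncated_source v x * psi x)).

(** The source is nonnegative, so the test with the negative part of [v] leaves no energy. *)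
Lemma truncated_ge0 : {ae leb, forall x, Omega x -> 0 <= v x}.
Proof.
have WN := W_Z oO bO p1 (-1) Wv; have Ww := W_posp oO bO p1 WN.
have mth : measurable_fun Omega (fun x => heaviside (-1 * v x)).
  apply: measurableT_comp (measurable_heaviside oO bO p1) _.
  exact: (W_Lp oO bO p1 WN).1.
have [i1 Ew] := scaled_energy_le oO bO p1 WN Ww mth (fun x => heaviside_in _).
suff E0 : \int[leb]_(x in Omega) (heaviside (-1 * v x) * enorm (-1 *: gv x) `^ p) <= 0.
  have w0 := W_energy_eq0 oO bO p1 Ww (le_trans Ew E0).
  by apply: filterS w0 => x /[apply] /posp_eq0; rewrite mulN1r oppr_le0.
have EL := v_eqn Ww.
have EL' : plap_form Omega p gv (fun x => heaviside (-1 * v x) *: (-1 *: gv x)) =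
    -1 * \int[leb]_(x in Omega) (heaviside (-1 * v x) * enorm (-1 *: gv x) `^ p).
  rewrite -(RintegralZl _ mO i1); congr Rintegral; apply/funext => x.
  rewrite !dotrVZr scaleN1r enormN mulrCA [_ * (-1 * _)]mulrCA (plap_self _ p1).
  by ring.
have S0 : 0 <= \int[leb]_(x in Omega) (truncated_source v x * posp (-1 * v x)).
  apply: Rintegral_ge0 => x _.
  by rewrite mulr_ge0 ?posp_ge0//; have /andP[] := truncated_source_in v x.
by move: S0; rewrite -EL EL' mulN1r oppr_ge0.
Qed.

(** Comparison with a supersolution [V]: where [v > V] the truncation turns the source
    into that of [V], and strict monotonicity of [a |-> |a|^(p-2) a] forces the gradient
    of the truncated difference to vanish. *)
Lemma truncated_le V gV : W V gV -> (forall x, b x = 1 + V x) ->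
  (forall phi gphi, W phi gphi -> (forall x, 0 <= phi x <= 1) ->
    \int[leb]_(x in Omega) (k * h x * b x `^ (p - 1) * phi x) <= plap_form Omega p gV gphi) ->
  {ae leb, forall x, Omega x -> v x <= V x}.
Proof.
move=> WV bV super; have WD := W_B oO bO p1 Wv WV; have Wphi := W_cap oO bO p1 WD.
pose th x := dcap (v x - V x); pose phi x := cap (v x - V x).
have phi01 x : 0 <= phi x <= 1 by exact: cap_in.
have mphi : measurable_fun Omega phi := (W_Lp oO bO p1 Wphi).1.
have h1 := super _ _ Wphi phi01; have h2 := v_eqn Wphi.
(* where [phi] is positive the truncation has reached its upper bound [b] *)
have E1 : (fun x => truncated_source v x * phi x) = fun x => k * h x * b x `^ (p - 1) * phi x.
  apply/funext => x; have [vV|/ltW Vv] := leP (v x) (V x).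
    by rewrite /phi cap_neg ?subr_le0// !mulr0.
  rewrite /truncated_source clamp_above//; first by case/andP: (b1B x).
  by rewrite bV lerD2l.
have {}h2 : plap_form Omega p gv (fun x => th x *: (gv x - gV x)) <=
    plap_form Omega p gV (fun x => th x *: (gv x - gV x)).
  by rewrite h2 E1.
have Lv i := W_Lp_grad oO bO p1 i Wv; have LV i := W_Lp_grad oO bO p1 i WV.
have Lphi i := W_Lp_grad oO bO p1 i Wphi.
have i1 := (plap_itg oO p1 Lv Lphi).2; have i2 := (plap_itg oO p1 LV Lphi).2.
pose m x := enorm (gv x) `^ (p - 2) * dotrV (gv x) (gv x - gV x) -
  enorm (gV x) `^ (p - 2) * dotrV (gV x) (gv x - gV x).
have Em : (fun x => th x * m x) = fun x =>
    enorm (gv x) `^ (p - 2) * dotrV (gv x) (th x *: (gv x - gV x)) -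
    enorm (gV x) `^ (p - 2) * dotrV (gV x) (th x *: (gv x - gV x)).
  by apply/funext => x; rewrite /m !dotrVZr; ring.
have im : leb.-integrable Omega (EFin \o (fun x => th x * m x)).
  by rewrite Em; exact: (itgB mO i1 i2).
have m_gt0 x : gv x != gV x -> 0 < m x by move=> ne; exact: plap_monotone_lt.
have tm0 x : 0 <= th x * m x.
  rewrite mulr_ge0//; first by case/andP: (dcap_in (v x - V x)).
  have [eqg|/m_gt0/ltW//] := eqVneq (gv x) (gV x).
  by rewrite /m eqg !subrr.
have int0 : \int[leb]_(x in Omega) (th x * m x) <= 0.
  by rewrite Em (RintegralB mO i1 i2) subr_le0; exact: h2.
have ae0 := Int_eq0 mO im (aeW leb (fun x _ => tm0 x)) int0.
have grad0 : {ae leb, forall x, Omega x -> th x *: (gv x - gV x) = 0}.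
  apply: filterS ae0 => x /[apply] /eqP; rewrite mulf_eq0 => /orP[/eqP ->|/eqP m0].
    by rewrite scale0r.
  have [->|/m_gt0] := eqVneq (gv x) (gV x); first by rewrite subrr scaler0.
  by rewrite m0 ltxx.
have iE := enorm_powR_itg (W_enorm oO bO p1 Wphi).
have E0 : E (fun x => th x *: (gv x - gV x)) <= 0.
  apply: le_trans (eq_ler (_ : _ = \int[leb]_(x in Omega) (0 : R))) _; last first.
    by rewrite Rintegral_cst ?mul0r//; exact: mO.
  apply: (Int_ae_eq mO); [exact: itg_meas iE|exact: measurable_cst|].
  apply: filterS grad0 => x /[apply] ->; rewrite enorm0 powR0// gt_eqF//.
  exact: lt_trans ltr01 p1.
have w0 := W_energy_eq0 oO bO p1 Wphi E0.
by apply: filterS w0 => x /[apply] /cap_eq0; rewrite subr_le0.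
Qed.

End truncated_problem.

(** The same change of variables, read backwards: the equation for [exp z - 1], of gradient
    [gv], is tested with [exp ((1 - p) z) phi], whose derivative recreates the gradient term
    for [z / kappa]. *)
Lemma hopf_cole_inverse z gz Z gv (f : 'rV[R]_n.+1 -> R) (kappa : R) : 0 < kappa -> kappa * (p - 1) = mu ->
  W z gz -> (forall x, `|z x| <= Z) ->
  (forall x, gv x = expR (z x) *: gz x) ->
  measurable_fun Omega f ->
  {ae leb, forall x, Omega x -> f x = kappa `^ (p - 1) * h x * expR ((p - 1) * z x)} ->
  (forall psi gpsi, W psi gpsi ->
    plap_form Omega p gv gpsi = \int[leb]_(x in Omega) (f x * psi x)) ->
  forall phi gphi B, W phi gphi -> (forall x, `|phi x| <= B) ->
  plap_form Omega p (fun x => kappa^-1 *: gz x) gphi =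
  \int[leb]_(x in Omega) ((mu * enorm (kappa^-1 *: gz x) `^ p + h x) * phi x).
Proof.
move=> k0 kmu Wz zZ gvE mf fE eqn phi gphi B Wphi phiB.
have p0 : 0 < p := lt_trans ltr01 p1; have ki0 : 0 < kappa^-1 by rewrite invr_gt0.
have Wpsi := W_exp_mul oO bO p1 (1 - p) Wz zZ Wphi phiB.
pose e x := expR ((1 - p) * z x).
have Wu := W_Z oO bO p1 kappa^-1 Wz.
have Lgu i := W_Lp_grad oO bO p1 i Wu; have Lgphi i := W_Lp_grad oO bO p1 i Wphi.
have iA := (plap_itg oO p1 Lgu Lgphi).2.
have iE := enorm_powR_itg (W_enorm oO bO p1 Wu).
have iEphi := itg_bounded_mul oO (W_Lp oO bO p1 Wphi).1 phiB iE.
have ihphi := h_itg (Lp_itg mO Ofin p1 (W_Lp oO bO p1 Wphi)).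
have EL := eqn _ _ Wpsi.
pose K := kappa `^ (p - 1); have K0 : 0 < K by exact: powR_gt0.
have lhs : plap_form Omega p gv (fun x => expR ((1 - p) * z x) *: gphi x +
    ((1 - p) * expR ((1 - p) * z x) * phi x) *: gz x) = \int[leb]_(x in Omega)
    (K * (enorm (kappa^-1 *: gz x) `^ (p - 2) * dotrV (kappa^-1 *: gz x) (gphi x) -
      mu * (phi x * enorm (kappa^-1 *: gz x) `^ p))).
  congr Rintegral; apply/funext => x.
  have -> : gv x = (kappa * expR (z x)) *: (kappa^-1 *: gz x).
    by rewrite gvE scalerA mulrAC divff ?gt_eqF// mul1r.
  have -> : gz x = kappa *: (kappa^-1 *: gz x) by rewrite scalerA divff ?gt_eqF// scale1r.
  have -> : kappa^-1 *: (kappa *: (kappa^-1 *: gz x)) = kappa^-1 *: gz x.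
    by congr (_ *: _); rewrite scalerA divff ?gt_eqF// scale1r.
  move: (kappa^-1 *: gz x) => a.
  rewrite (plapZ p _ _ (mulr_gt0 k0 (expR_gt0 _))) powRM ?expR_ge0 ?(ltW k0)// -/K.
  rewrite expR_powR dotrVDr !dotrVZr -(plap_self a p1) -kmu.
  have ee : expR ((p - 1) * z x) * expR ((1 - p) * z x) = 1.
    by rewrite -expRD (_ : _ + _ = 0) ?expR0//; ring.
  move: (expR _) (expR _) ee => e1 e2 ee.
  rewrite [LHS](_ : _ = (e2 * e1) * (K * (enorm a `^ (p - 2) * dotrV a (gphi x) -
    kappa * (p - 1) * (phi x * (enorm a `^ (p - 2) * dotrV a a))))); last by ring.
  by rewrite ee mul1r.
have ihphi' := itgZ mO K ihphi.
have rhs : \int[leb]_(x in Omega) (f x * (expR ((1 - p) * z x) * phi x)) =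
    \int[leb]_(x in Omega) (K * (h x * phi x)).
  apply: (Int_ae_eq mO).
  - by apply: measurable_funM => //; exact: (W_Lp oO bO p1 Wpsi).1.
  - exact: itg_meas ihphi'.
  - apply: filterS fE => x /[apply] ->.
    have ee : expR ((p - 1) * z x) * expR ((1 - p) * z x) = 1.
      by rewrite -expRD (_ : _ + _ = 0) ?expR0//; ring.
    rewrite -/K; move: (expR _) (expR _) ee => e1 e2 ee.
    by rewrite [LHS](_ : _ = (e2 * e1) * (K * (h x * phi x))); [rewrite ee mul1r|ring].
rewrite lhs rhs in EL.
have iE' := itgZ mO mu iEphi.
rewrite (RintegralZl _ mO (itgB mO iA iE')) (RintegralZl _ mO ihphi) in EL.
have {}EL := mulfI (lt0r_neq0 K0) EL.
rewrite (RintegralB mO iA iE') in EL; move/eqP: EL; rewrite subr_eq => /eqP EL.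
rewrite /plap_form EL -(RintegralD mO ihphi iE'); congr Rintegral; apply/funext => x; ring.
Qed.

(** The solution for [lambda] provides, through the Hopf-Cole transform, a bounded
    supersolution of the truncated problem, below which its solution stays. *)
Theorem solution_at_zero u g M gamma : 0 < lambda < gamma ->
  (forall gamma', eigenvalue_plap Omega p c gamma' -> gamma <= gamma') ->
  W u g -> (forall x, `|u x| <= M) -> weak_equation u g ->
  exists w gw, [/\ W w gw, exists B, forall x, `|w x| <= B &
    forall phi gphi B, W phi gphi -> (forall x, `|phi x| <= B) ->
    plap_form Omega p gw gphi =
    \int[leb]_(x in Omega) ((mu * enorm (gw x) `^ p + h x) * phi x)].
Proof.
move=> lg first Wu uM eqn; have p0 : 0 < p := lt_trans ltr01 p1.
have M0 : 0 <= M := le_trans (normr_ge0 _) (uM 0).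
have pm0 : 0 < p - 1 by rewrite subr_gt0.
have u0 := solution_ge0 lg first Wu uM eqn.
(* a representative of [u] with values in [0, M] everywhere *)
have u0M : {ae leb, forall x, Omega x -> 0 <= u x <= M}.
  by apply: filterS u0 => x /[apply] ->; rewrite (le_trans (ler_norm _)).
have [Wu' uu'] := W_clamp_ae oO bO p1 M0 Wu u0M.
pose u' x := clamp 0 M (u x).
have u'M x : 0 <= u' x <= M by exact: clamp_in.
have eqn' : weak_equation u' g.
  move=> phi gphi B Wphi phiB; rewrite (eqn _ _ _ Wphi phiB).
  apply: (Int_ae_eq mO).
  - exact: itg_meas (source_mul_itg Wu Wphi phiB).
  - exact: itg_meas (source_mul_itg Wu' Wphi phiB).
  - by apply: filterS uu' => x /[apply] E1; rewrite /source /u' -E1.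
pose kappa := mu / (p - 1); have k0 : 0 < kappa by rewrite divr_gt0.
have kmu : kappa * (p - 1) = mu by rewrite divfK// gt_eqF.
have u'M' x : `|u' x| <= M by have /andP[a b] := u'M x; rewrite ger0_norm.
have WV := W_expR oO bO p1 kappa Wu' u'M'.
pose V x := expR (kappa * u' x) - 1; pose b x := expR (kappa * u' x).
pose C := expR (kappa * M).
have bC x : 1 <= b x <= C.
  have /andP[a1 a2] := u'M x; rewrite /b /C ler_expR ler_pM2l// a2 andbT.
  by rewrite -expR0 ler_expR mulr_ge0// ltW.
have mb : measurable_fun Omega b.
  apply: (measurableT_comp (@measurable_expR R)).
  by apply: measurable_funM => //; exact: (W_Lp oO bO p1 Wu').1.
pose K := kappa `^ (p - 1); have K0 : 0 <= K by exact: powR_ge0.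
have [v [gv [Wv v_eqn]]] := truncated_existence K0 mb bC.
have v0 := truncated_ge0 K0 bC Wv v_eqn.
have vV : {ae leb, forall x, Omega x -> v x <= V x}.
  apply: (truncated_le bC Wv v_eqn WV); first by move=> x; rewrite /V addrC subrK.
  move=> phi gphi Wphi phi01.
  exact: (hopf_cole_super k0 kmu Wu' u'M eqn' Wphi phi01).
have C1 : 0 <= C - 1 by rewrite subr_ge0; have /andP[/le_trans h1 /h1] := bC 0.
have v0C : {ae leb, forall x, Omega x -> 0 <= v x <= C - 1}.
  apply: filterS2 v0 vV => x h1 h2 Ox; rewrite h1//= (le_trans (h2 Ox))//.
  by rewrite /V lerD2r; have /andP[] := bC x.
have [Wv' vv'] := W_clamp_ae oO bO p1 C1 Wv v0C.
pose v' x := clamp 0 (C - 1) (v x); have v'C x : 0 <= v' x <= C - 1 by exact: clamp_in.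
have v1 x : 0 < 1 + v' x by have /andP[h1 _] := v'C x; rewrite ltr_pwDl.
have Wz := W_ln oO bO p1 Wv' v'C.
pose z x := ln (1 + v' x); pose gz x := (1 + v' x)^-1 *: gv x.
have ez x : expR (z x) = 1 + v' x by rewrite lnK// posrE.
have zC x : `|z x| <= C.
  have /andP[h1 h2] := v'C x; rewrite ger0_norm ?ln_ge0 ?lerDl//.
  apply: (@le_trans _ _ (v' x)); first by apply: le_ln1Dx; rewrite (lt_le_trans _ h1)// ltrN10.
  by rewrite (le_trans h2)// gerBl.
have Ww := W_Z oO bO p1 kappa^-1 Wz.
exists (fun x => kappa^-1 * z x), (fun x => kappa^-1 *: gz x); split; first exact: Ww.
  exists (kappa^-1 * C) => x; have ki0 : 0 < kappa^-1 by rewrite invr_gt0.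
  by rewrite normrM gtr0_norm// ler_pM2l.
apply: (hopf_cole_inverse k0 kmu Wz zC (f := truncated_source K b v)) v_eqn.
- by move=> x; rewrite ez scalerA divff ?gt_eqF// scale1r.
- exact: (measurable_truncated_source K mb (W_Lp oO bO p1 Wv).1).
- have vv : {ae leb, forall x, Omega x -> 0 <= v x <= V x}.
    by apply: filterS2 v0 vV => x h1 h2 Ox; rewrite h1//= h2.
  apply: filterS2 vv vv' => x h1 h2 Ox; have /andP[h3 h4] := h1 Ox.
  rewrite /truncated_source clampE; last first.
    by rewrite lerDl h3/= -lerBrDl.
  by rewrite -(expR_powR p (z x)) ez /v' -h2.
Qed.

End comparison.

(** * Solution of the problem at zero *)

Section representatives.
Context {R : realType} {n : nat}.
Variables (Omega : set 'rV[R]_n.+1) (p : R).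
Hypotheses (oO : open Omega) (bO : bounded_set Omega) (p1 : 1 < p).
Local Notation leb := (lebesgue_rV n.+1).
Local Notation mO := (open_measurable_rV oO).
Local Notation W := (W01p Omega p).
Implicit Types (u phi c h : 'rV[R]_n.+1 -> R) (g gphi : 'rV[R]_n.+1 -> 'rV[R]_n.+1).

Lemma clamp_norm (M t : R) : `|clamp (- `|M|) `|M| t| <= `|M|.
Proof. by rewrite ler_norml clamp_in// ge0_cp. Qed.

(** Clamping turns bounds that hold almost everywhere into bounds that hold everywhere. *)
Lemma nonneg_representative c : in_Lp Omega +oo%E c ->
  {ae leb, forall x, Omega x -> 0 <= c x} -> exists c' M,
  [/\ measurable_fun Omega c, measurable_fun Omega c', forall x, 0 <= c' x <= M &
      {ae leb, forall x, Omega x -> c x = c' x}].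
Proof.
move=> /(LfunP_oo _ mO)[mc [M cM]] c0.
exists (fun x => clamp 0 `|M| (c x)), `|M|; split => //.
- exact: measurable_clamp.
- by move=> x; exact: clamp_in.
- apply: filterS2 c0 cM => x h1 h2 Ox; rewrite clampE// h1//=.
  by rewrite (le_trans (ler_norm _))// (le_trans (h2 Ox))// ler_norm.
Qed.

Lemma bounded_representative u g : W u g -> in_Lp Omega +oo%E u -> exists u' M,
  [/\ W u' g, forall x, `|u' x| <= M & {ae leb, forall x, Omega x -> u x = u' x}].
Proof.
move=> Wu /(LfunP_oo _ mO)[mu [M uM]]; have NM : - `|M| <= `|M| by rewrite ge0_cp.
have h : {ae leb, forall x, Omega x -> - `|M| <= u x <= `|M|}.
  by apply: filterS uM => x /[apply] h; rewrite -ler_norml (le_trans h)// ler_norm.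
have [Wu' uu'] := W_clamp_ae oO bO p1 NM Wu h.
exists (fun x => clamp (- `|M|) `|M| (u x)), `|M|; split => // x.
exact: clamp_norm.
Qed.

Lemma W_bounded_in_Loo u g M : W u g -> (forall x, `|u x| <= M) -> in_Lp Omega +oo%E u.
Proof.
move=> Wu uM; apply/(LfunP_oo _ mO); split; first exact: (W_Lp oO bO p1 Wu).1.
by exists M; apply: aeW => x _.
Qed.

Lemma measurable_source c h (mu lambda : R) u g phi : measurable_fun Omega c -> measurable_fun Omega h ->
  measurable_fun Omega u -> (forall i, measurable_fun Omega (fun x => g x ord0 i)) ->
  measurable_fun Omega phi ->
  measurable_fun Omega (fun x => (lambda * c x * ppow p (u x) + mu * enorm (g x) `^ p + h x) * phi x).
Proof.
move=> mc mh mu_ mg mphi; apply: measurable_funM => //; apply: measurable_funD => //.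
have mq : measurable_fun setT (fun y : R => y `^ p) by exact: measurable_powR.
apply: measurable_funD; apply: measurable_funM => //.
- by apply: measurable_funM.
- exact: (measurable_ppow p mu_).
- exact: measurableT_comp mq (measurable_enorm mg).
Qed.

End representatives.

Theorem corollary9p4 (R : realType) (p : R) (hp : 1 < p)
    (N : nat) (hN : (2 <= N)%N)
    (Omega : set 'rV[R]_N) (hdom : domain Omega) (hbnd : bounded_set Omega)
    (hC2 : C2_boundary Omega)
    (c h : 'rV[R]_N -> R)
    (hcL : in_Lp Omega +oo%E c) (hhL : in_Lp Omega +oo%E h)
    (hc : nonneg_nonzero Omega c) (hh : nonneg_nonzero Omega h)
    (mu : R) (hmu : 0 < mu)
    (gamma1 : R) (hgamma1 : 0 < gamma1)
    (hfirst : first_eigenvalue Omega p c gamma1) :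
  (exists lambda : R, 0 < lambda < gamma1 /\
     exists u : 'rV[R]_N -> R, solution Omega p mu c h lambda u) ->
  exists u : 'rV[R]_N -> R, solution Omega p mu c h 0 u.
Proof.
clear hC2 hgamma1; case: N hN Omega hdom hbnd c h hcL hhL hc hh hfirst => [//|n] _.
move=> Omega [oO _ _] bO c h cL hL [c0 _] [h0 _] [_ first] [lambda [lg [u [g [Wu uL eqn]]]]].
have mO := open_measurable_rV oO.
have l0 : 0 <= lambda by case/andP: lg => /ltW.
have [c' [Mc [mc mc' c'M cc']]] := nonneg_representative oO cL c0.
have [h' [Mh [mh mh' h'M hh']]] := nonneg_representative oO hL h0.
have [u' [M [Wu' u'M uu']]] := bounded_representative oO bO hp Wu uL.
(* weights and functions that agree almost everywhere give the same weak equations *)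
have first' gamma' : eigenvalue_plap Omega p c' gamma' -> gamma1 <= gamma'.
  move=> [v [gv [Wv vn0 veqn]]]; apply: first; exists v, gv; split => // phi gphi Wphi.
  have mv := (W_Lp oO bO hp Wv).1; have mphi := (W_Lp oO bO hp Wphi).1.
  have mcv d : measurable_fun Omega d -> measurable_fun Omega (fun x => gamma' * d x * ppow p (v x) * phi x).
    move=> md; apply: measurable_funM => //; apply: measurable_funM; last exact: measurable_ppow.
    exact: measurable_funM.
  rewrite (veqn _ _ Wphi); apply: (Int_ae_eq mO); [exact: mcv|exact: mcv|].
  by apply: filterS cc' => x /[apply] ->.
have mg i := (W_Lp_grad oO bO hp i Wu).1.
have eqn' : weak_equation Omega p c' h' mu lambda u' g.
  move=> phi gphi B Wphi phiB.
  have mphi := (W_Lp oO bO hp Wphi).1.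
  rewrite (eqn _ _ Wphi (W_bounded_in_Loo oO bO hp Wphi phiB)).
  apply: (Int_ae_eq mO).
  - exact (measurable_source p mu lambda mc mh (W_Lp oO bO hp Wu).1 mg mphi).
  - exact (measurable_source p mu lambda mc' mh' (W_Lp oO bO hp Wu').1 mg mphi).
  - apply: filterS3 cc' hh' uu' => x h1 h2 h3 Ox.
    by rewrite /source -h1// -h2// -h3.
have [w [gw [Ww [B wB] weqn]]] := solution_at_zero oO bO hp mc' c'M mh' h'M hmu l0 lg first' Wu' u'M eqn'.
exists w, gw; split; [exact: Ww|exact: W_bounded_in_Loo Ww wB|] => phi gphi Wphi phiL.
have [phi' [C [Wphi' phi'C phiphi']]] := bounded_representative oO bO hp Wphi phiL.
rewrite (weqn _ _ _ Wphi' phi'C).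
have mgw i := (W_Lp_grad oO bO hp i Ww).1; have mw := (W_Lp oO bO hp Ww).1.
have mphi := (W_Lp oO bO hp Wphi).1; have mphi' := (W_Lp oO bO hp Wphi').1.
have m1 := measurable_source p mu 0 mc mh mw mgw mphi.
have m2 := measurable_source p mu 0 mc' mh' mw mgw mphi'.
rewrite (_ : (fun x => (mu * enorm (gw x) `^ p + h' x) * phi' x) =
  fun x => (0 * c' x * ppow p (w x) + mu * enorm (gw x) `^ p + h' x) * phi' x); last first.
  by apply/funext => x; rewrite !mul0r add0r.
apply: (Int_ae_eq mO m2 m1).
by apply: filterS2 hh' phiphi' => x h1 h2 Ox; rewrite !mul0r h1// h2.
Qed.
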